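(* Let $I$ be a non-empty open interval of $\mathbb{R}$, let $\gamma:I\to\mathbb{R}$ be convex, and let $\phi:[0,\infty)\to[0,\infty)$ be concave, injective (hence strictly increasing) and continuous, with $\phi(0)=0$ and $\lim_{u\to\infty}\phi(u)=\infty$. Let $\mu_1,\mu_2$ be probability measures on $\mathcal{B}_I$ of finite mean, in convex order, with $\int\gamma^+\,d\mu_1<\infty$ and $\int\gamma^+\,d\mu_2<\infty$. Assume that $\lim_{x\downarrow\inf I}(|\gamma(x)|+|x|)=\lim_{x\uparrow\sup I}(|\gamma(x)|+|x|)=\infty$. Let $(S_1,S_2,V)$ be the canonical projections on $I^2\times[0,\infty)$. Let $\mathcal{M}'$ be the set of probability measures $\mu$ on $\mathcal{B}_{I^2\times[0,\infty)}$ such that $S_1$ has law $\mu_1$ and $S_2$ has law $\mu_2$ under $\mu$, and $$E_\mu[S_2\mid S_1,V]=S_1\quad\text{and}\quad \phi\big(E_\mu[\gamma(S_2)\mid S_1,V]-\gamma(S_1)\big)=V\qquad\mu\text{-a.s.}$$ Let $\mathcal{U}'$ be the set of quadruples $(u_1,u_2,\Delta,\Gamma)$ with $u_1\in\mathcal{L}^1(\mu_1)$, $u_2\in\mathcal{L}^1(\mu_2)$, $\Delta:I\times[0,\infty)\to\mathbb{R}$ bounded Borel and $\Gamma:I\times[0,\infty)\to\mathbb{R}$ Borel, such that $$u_1(s_1)+u_2(s_2)+\Delta(s_1,v)(s_2-s_1)+\Gamma(s_1,v)\big(\gamma(s_2)-\gamma(s_1)-\phi^{-1}(v)\big)\ge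 v$$ for all $(s_1,s_2,v)\in I^2\times[0,\infty)$. Then $$\sup_{\mu\in\mathcal{M}'}E_\mu[V]=\inf_{(u_1,u_2,\Delta,\Gamma)\in\mathcal{U}'}\Big(\int u_1\,d\mu_1+\int u_2\,d\mu_2\Big).$$ Furthermore, the supremum on the left is attained, and the equality remains valid if in the definition of $\mathcal{U}'$ one additionally requires that the functions $u_1,u_2$ are each the difference of two convex functions and that the functions $\Delta,\Gamma$ are continuous.
   Context: $\mathcal{B}_A$ denotes the Borel $\sigma$-field of $A$; $\mathcal{L}^1(\mu_i)$ is the set of real-valued $\mu_i$-integrable Borel functions on $I$. Under the assumptions on $\phi$, $\phi^{-1}:[0,\infty)\to[0,\infty)$ is a well-defined increasing bijection. Convex order: probability measures $\lambda_1,\lambda_2$ on $\mathcal{B}_I$ of finite mean are in convex order if $\int\psi\,d\lambda_1\le\int\psi\,d\lambda_2$ for all convex $\psi:I\to\mathbb{R}$. *)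

(* Defs.v *)
From HB Require Import structures.
From mathcomp Require Export all_boot all_order all_algebra.
From mathcomp Require Export all_classical all_reals all_analysis.
Export Order.TTheory GRing.Theory Num.Theory.
Export numFieldNormedType.Exports.

Set Implicit Arguments.
Unset Strict Implicit.
Unset Printing Implicit Defensive.

Local Open Scope classical_set_scope.
Local Open Scope ring_scope.

(* Probability measures on the Borel sets of a Borel set D (D = I in R, or     *)
(* D = I^2 x [0, oo) in R^3) are represented by probability measures P on the  *)
(* Borel sets of the ambient space with P D = 1, and functions on D by         *)
(* functions on the ambient space.  Only the values taken on D matter: Borel   *)
(* measurability, continuity, convexity and integrals are all relative to D.   *)

Section convexity.
Context {R : realType}.
Implicit Types (I : set R) (f g psi : R -> R).

Definition concave_function I f := convex_function I (\- f).

Definition is_difference_of_convex I f :=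
  exists g h, [/\ convex_function I g, convex_function I h &
    forall x, I x -> f x = g x - h x].

(* A convex psi is continuous on the open interval I and bounded below by an   *)
(* affine function, so that for measures of finite mean both integrals are     *)
(* well defined in ]-oo, +oo].                                                 *)
Definition convex_order I (lambda1 lambda2 : probability (measurableTypeR R) R) :=
  forall psi, convex_function I psi ->
    (\int[lambda1]_(x in I) (psi x)%:E <= \int[lambda2]_(x in I) (psi x)%:E)%E.

(* The filters "x decreases to a" and "x increases to b" for extended real     *)
(* endpoints a < +oo and b > -oo.                                              *)
Definition right_of (a : \bar R) : set_system R :=
  if a is r%:E%E then r^'+ else -oo_R.

Definition left_of (b : \bar R) : set_system R :=
  if b is r%:E%E then r^'- else +oo_R.

Definition inf_end I : \bar R := ereal_inf (EFin @` I).
Definition sup_end I : \bar R := ereal_sup (EFin @` I).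

End convexity.

Section conditional_expectation.
Context {d d' : measure_display} {T : measurableType d} {T' : measurableType d'}
  {R : realType}.

Definition sigma_of (D : set T) (Z : T -> T') : set (set T) :=
  preimage_set_system D Z measurable.

(* Y is a version of E_P[X | Z] on the sample space D (where P D = 1).         *)
Record is_condexp (P : probability T R) (D : set T) (Z : T -> T')
    (X Y : T -> R) : Prop := IsCondexp {
  condexp_integrable_arg : P.-integrable D (EFin \o X) ;
  condexp_integrable : P.-integrable D (EFin \o Y) ;
  condexp_measurable : forall B : set (measurableTypeR R), measurable B ->
    sigma_of D Z (D `&` Y @^-1` B) ;
  condexp_integral : forall A, sigma_of D Z A ->
    (\int[P]_(w in A) (Y w)%:E = \int[P]_(w in A) (X w)%:E)%E }.

End conditional_expectation.

Notation sample_type R :=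
  (measurableTypeR R * measurableTypeR R * measurableTypeR R)%type.

Section primal.
Context {R : realType}.

Definition S1 (w : sample_type R) : measurableTypeR R := w.1.1.
Definition S2 (w : sample_type R) : measurableTypeR R := w.1.2.
Definition V (w : sample_type R) : measurableTypeR R := w.2.

Definition nonneg : set R := `[0, +oo[.

Definition sample_space (I : set R) : set (sample_type R) :=
  (I `*` I) `*` nonneg.

(* By the conditional Jensen inequality, the first almost sure identity makes  *)
(* the argument of phi nonnegative almost surely.                              *)
Record primal_feasible (I : set R) (gamma phi : R -> R)
    (mu1 mu2 : probability (measurableTypeR R) R)
    (mu : probability (sample_type R) R) : Prop := PrimalFeasible {
  primal_support : mu (sample_space I) = 1%E ;
  primal_law1 : forall A, measurable A -> pushforward mu S1 A = mu1 A ;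
  primal_law2 : forall A, measurable A -> pushforward mu S2 A = mu2 A ;
  primal_condexp : exists M G : sample_type R -> R,
    [/\ is_condexp mu (sample_space I) (fun w => (S1 w, V w)) S2 M,
        is_condexp mu (sample_space I) (fun w => (S1 w, V w)) (gamma \o S2) G &
        {ae mu, forall w, sample_space I w ->
          M w = S1 w /\ phi (G w - gamma (S1 w)) = V w}] }.

End primal.
Arguments nonneg : clear implicits.

Section dual.
Context {R : realType}.

Definition phi_inv (phi : R -> R) : R -> R := pinv (nonneg R) phi.

Record quadruple : Type := Quadruple {
  u1 : R -> R ;
  u2 : R -> R ;
  Delta : R * R -> R ;
  Gamma : R * R -> R }.

Record dual_feasible (I : set R) (gamma phi : R -> R)
    (mu1 mu2 : probability (measurableTypeR R) R) (q : quadruple) : Prop :=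
  DualFeasible {
  dual_integrable1 : mu1.-integrable I (EFin \o u1 q) ;
  dual_integrable2 : mu2.-integrable I (EFin \o u2 q) ;
  dual_Delta_measurable :
    measurable_fun (I `*` nonneg R : set (measurableTypeR R * measurableTypeR R))
      (Delta q : _ -> measurableTypeR R) ;
  dual_Delta_bounded : [bounded Delta q z | z in I `*` nonneg R] ;
  dual_Gamma_measurable :
    measurable_fun (I `*` nonneg R : set (measurableTypeR R * measurableTypeR R))
      (Gamma q : _ -> measurableTypeR R) ;
  dual_ineq : forall s1 s2 v : R, I s1 -> I s2 -> 0 <= v ->
    v <= u1 q s1 + u2 q s2 + Delta q (s1, v) * (s2 - s1)
         + Gamma q (s1, v) * (gamma s2 - gamma s1 - phi_inv phi v) }.

Record dual_regular (I : set R) (q : quadruple) : Prop := DualRegular {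
  dual_convex1 : is_difference_of_convex I (u1 q) ;
  dual_convex2 : is_difference_of_convex I (u2 q) ;
  dual_Delta_continuous : {within I `*` nonneg R, continuous (Delta q)} ;
  dual_Gamma_continuous : {within I `*` nonneg R, continuous (Gamma q)} }.

Definition dual_cost (I : set R) (mu1 mu2 : probability (measurableTypeR R) R)
    (q : quadruple) : \bar R :=
  (\int[mu1]_(x in I) (u1 q x)%:E + \int[mu2]_(x in I) (u2 q x)%:E)%E.

End dual.

(* Main.v *)
From HB Require Import structures.
Require Import Defs.
From mathcomp Require Import ring lra measurable_realfun.

(* By concavity of phi, replacing V by phi(E[gamma(S2) | S1] - gamma(S1))     *)
(* does not decrease E[V], so that the primal problem concerns martingale     *)
(* couplings of mu1 and mu2 only.  Dually it suffices, with u = phi^-1(v), to *)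
(* superhedge phi(u) by u1(x) + u2(y) + d(x) (y - x) -                        *)
(* a(x) (gamma(y) - gamma(x) - u) where a >= 0 and (d, a) takes finitely many *)
(* values (d_j, a_j).  For fixed (d_j, a_j) the best static positions are     *)
(* u1 = min_j l_j and u2 = max_j (k_j - l_j), where l_j is affine minus       *)
(* a_j gamma; hence u1 is concave, u2 is convex, and a partition of unity     *)
(* subordinate to the sets { l_j < u1 + e } makes (d, a) continuous at the    *)
(* cost e.  The same reduction applied to the zero claim, for which           *)
(* u2 >= - u1 is convex, shows by the convex order that there is no arbitrage.*)
(*                                                                            *)
(* The Hahn-Banach theorem therefore gives a positive linear functional L     *)
(* with L(phi(u)) equal to the dual value.  The bimeasure L(1_A(x) 1_B(y))    *)
(* has sigma-additive marginals mu1 and mu2, hence is given by a coupling:    *)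
(* disintegrate by Radon-Nikodym the mass of each ray with rational endpoint  *)
(* and realize y by a quantile transform of a uniform variable.  This         *)
(* coupling P is a martingale, and with Y = E_P[gamma(y) | x] - gamma(x) >= 0 *)
(* the tangents of phi yield L(phi(u)) <= E_P[phi(Y)], so that V = phi(Y) is  *)
(* optimal.                                                                   *)


Set Implicit Arguments.
Unset Strict Implicit.
Unset Printing Implicit Defensive.

Local Open Scope classical_set_scope.
Local Open Scope ring_scope.

(** * Conic Hahn-Banach theorem *)

Section conic_hahn_banach.
Context {R : realType} {T : Type}.
Implicit Types (f g : T -> R) (c d t : R) (K : set ((T -> R) * R)).

Definition cone K := [/\ K (cst 0, 0),
  (forall f c g d, K (f, c) -> K (g, d) -> K (f \+ g, c + d)) &
  (forall t f c, 0 <= t -> K (f, c) -> K (t \*o f, t * c))].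

Definition arbitrage_free K := forall c, K (cst 0, c) -> 0 <= c.

Definition cone_add K v : set ((T -> R) * R) :=
  [set w | exists u t, [/\ K u, 0 <= t &
     w = (u.1 \+ t \*o v.1, u.2 + t * v.2)]].

Lemma cone_add_cone K v : cone K -> cone (cone_add K v).
Proof.
move=> [K0 KD KM]; split.
- exists (cst 0, 0), 0; split => //=.
  by congr pair; [apply/funext => x /=; ring|ring].
- move=> f c g d [[u1 u2] [t [Ku t0 [-> ->]]]] [[w1 w2] [s [Kw s0 [-> ->]]]].
  exists (u1 \+ w1, u2 + w2), (t + s); split; [exact: KD|exact: addr_ge0|].
  by congr pair; [apply/funext => x /=; ring|rewrite /=; ring].
- move=> s f c s0 [[u1 u2] [t [Ku t0 [-> ->]]]].
  exists (s \*o u1, s * u2), (s * t); split; [exact: KM|exact: mulr_ge0|].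
  by congr pair; [apply/funext => x /=; ring|rewrite /=; ring].
Qed.

Lemma sub_cone_add K v : K `<=` cone_add K v.
Proof.
move=> [f c] Ku; exists (f, c), 0; split => //=.
by congr pair; [apply/funext => x /=; ring|ring].
Qed.

Lemma cone_add_mem K v : cone K -> cone_add K v v.
Proof.
case: v => f c [K0 _ _]; exists (cst 0, 0), 1; split => //=.
by congr pair; [apply/funext => x /=; ring|ring].
Qed.

Lemma cone_add_arbitrage K f c : cone K -> ~ arbitrage_free (cone_add K (f, c)) ->
  arbitrage_free K -> exists2 d, d < - c & K (\- f, d).
Proof.
move=> [K0 KD KM] /existsNP[d /not_implyP[]] [[u1 u2] [t [Ku t0 /= [fE dE]]]].
move=> /negP; rewrite -ltNge => d0 aK; have [t0'|tn0] := eqVneq t 0.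
  suff /aK : K (cst 0, d) by rewrite leNgt d0.
  have -> : d = u2 by rewrite dE t0'; ring.
  suff -> : cst 0 = u1 by [].
  by rewrite fE t0'; apply/funext => x /=; ring.
have tgt0 : 0 < t by rewrite lt0r tn0.
exists (t^-1 * u2).
  have -> : u2 = d - t * c by rewrite dE; ring.
  by rewrite mulrBr mulKf// ltrBlDr addNr pmulr_rlt0// invr_gt0.
suff -> : \- f = t^-1 \*o u1 by apply: KM => //; rewrite invr_ge0.
apply/funext => x /=; move/(congr1 (fun g => g x)) : fE => /= fE.
have -> : u1 x = - (t * f x) by apply/eqP; rewrite -subr_eq0 opprK -fE.
by rewrite mulrN mulKf.
Qed.

Lemma maximal_cone K : cone K -> arbitrage_free K -> exists M, [/\ cone M,
  arbitrage_free M, K `<=` M &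
  forall f c, ~ M (f, c) -> exists2 d, d < - c & M (\- f, d)].
Proof.
move=> cK aK.
pose P : set (set ((T -> R) * R)) :=
  [set A | cone (A `|` K) /\ arbitrage_free (A `|` K)].
have [F FP totF|M [[cM aM] Mmax]] := @Zorn_bigcup _ P.
  have pair_in u v : (\bigcup_(A in F) A `|` K) u ->
      (\bigcup_(A in F) A `|` K) v ->
      (K u /\ K v) \/ exists A, [/\ F A, (A `|` K) u & (A `|` K) v].
    move=> [[A FA Au]|Ku] [[B FB Bv]|Kv].
    - by right; have [AB|BA] := totF _ _ FA FB;
        [exists B; split => //; left => //; exact: AB
        |exists A; split => //; left => //; exact: BA].
    - by right; exists A; split => //; [left|right].
    - by right; exists B; split => //; [right|left].
    - by left.
  have incl A : F A -> A `|` K `<=` \bigcup_(A in F) A `|` K.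
    by move=> FA u [Au|]; [left; exists A|right].
  split; first split.
  - by right; case: cK.
  - move=> f c g d Ku Kv.
    have [[{}Ku {}Kv]|[A [FA Au Av]]] := pair_in _ _ Ku Kv.
      by right; case: cK => _ + _; exact.
    by apply: (incl _ FA); have [[_ + _] _] := FP _ FA; exact.
  - move=> t f c t0 Ku; have [[{}Ku _]|[A [FA Au _]]] := pair_in _ _ Ku Ku.
      by right; case: cK => _ _; exact.
    by apply: (incl _ FA); have [[_ _ +] _] := FP _ FA; exact.
  - move=> c Ku; have [[{}Ku _]|[A [FA Au _]]] := pair_in _ _ Ku Ku.
      exact: aK.
    by have [_] := FP _ FA; exact.
exists (M `|` K); split => //.
move=> f c Mfc; pose M' := cone_add (M `|` K) (f, c).
have MM' : M `|` K `<=` M' by exact: sub_cone_add.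
have M'K : M' `|` K = M' by apply/setUidPl => u Ku; apply: MM'; right.
have cM' : cone M' by exact: cone_add_cone.
apply: cone_add_arbitrage => // aM'; apply: (Mmax M').
  split; first by move=> u Mu; apply: MM'; left.
  by move=> /(_ (f, c)) H; apply: Mfc; left; apply: H; exact: cone_add_mem.
by rewrite /P/= M'K.
Qed.

Definition two_sided K f := exists c d, K (f, c) /\ K (\- f, d).

Lemma two_sidedD K f g : cone K -> two_sided K f -> two_sided K g -> two_sided K (f \+ g).
Proof.
move=> [_ KD _] [c [d [? ?]]] [c' [d' [? ?]]]; exists (c + c'), (d + d').
split; first exact: KD.
have -> : \- (f \+ g) = (\- f) \+ (\- g) by apply/funext => x /=; ring.
exact: KD.
Qed.

Lemma two_sidedZ K t f : cone K -> two_sided K f -> two_sided K (t \*o f).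
Proof.
move=> [_ _ KZ] [c [d [Kc Kd]]]; have [t0|t0] := leP 0 t.
  exists (t * c), (t * d); split; first exact: KZ.
  have -> : \- (t \*o f) = t \*o (\- f) by apply/funext => x /=; ring.
  exact: KZ.
exists (- t * d), (- t * c).
have -> : t \*o f = (- t) \*o (\- f) by apply/funext => x /=; ring.
have -> : \- ((- t) \*o (\- f)) = (- t) \*o f by apply/funext => x /=; ring.
by split; apply: KZ => //; rewrite oppr_ge0 ltW.
Qed.

(* [K (f, c)] reads "[f] can be superhedged at cost [c]". *)
Lemma conic_hahn_banach K v p (S := two_sided K) :
  cone K -> arbitrage_free K -> (forall c, K (v, c) -> p <= c) ->
  exists L : (T -> R) -> R, [/\
    forall f g, S f -> S g -> L (f \+ g) = L f + L g,
    forall t f, S f -> L (t \*o f) = t * L f,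
    forall f c, S f -> K (f, c) -> L f <= c &
    S v -> p <= L v].
Proof.
move=> cK aK Kvp.
pose K' := cone_add K (\- v, - p).
have cK' : cone K' by exact: cone_add_cone.
have aK' : arbitrage_free K'.
  apply: contrapT => /(cone_add_arbitrage cK)/(_ aK)[d]; rewrite opprK => dp.
  have -> : \- (\- v) = v by apply/funext => x /=; rewrite opprK.
  by move=> /Kvp; rewrite leNgt dp.
have [M [[M0 MD MM] aM K'M Mmax]] := maximal_cone cK' aK'.
have KM : K `<=` M by move=> u Ku; apply: K'M; exact: sub_cone_add.
pose A f : set R := [set c | M (f, c)].
pose L f := inf (A f).
have negK f : \- (\- f) = f by apply/funext => x /=; rewrite opprK.
have MDN f c d : M (f, c) -> M (\- f, d) -> - d <= c.
  move=> Mf MNf; rewrite lerNl -subr_ge0 opprK addrC; apply: aM.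
  suff -> : cst 0 = f \+ (\- f) by exact: MD.
  by apply/funext => x /=; rewrite subrr.
have SN f : S f -> S (\- f).
  by move=> [c [d [? ?]]]; exists d, c; split; rewrite ?negK.
have SA f : S f -> has_inf (A f).
  move=> [c [d [/KM Kf /KM KNf]]]; split; first by exists c.
  by exists (- d) => e /= Me; exact: MDN Me KNf.
have Lle f c : S f -> M (f, c) -> L f <= c.
  by move=> Sf Mf; apply: ge_inf => //; have [] := SA _ Sf.
have LN f : S f -> L (\- f) = - L f.
  move=> Sf; apply/eqP; rewrite eq_le; apply/andP; split.
    rewrite leNgt; apply/negP => lt1.
    have : ~ M (f, (L f - L (\- f)) / 2).
      by move/(Lle _ _ Sf); lra.
    by move=> /Mmax[d dlt /(Lle _ _ (SN _ Sf))]; lra.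
  rewrite lerNl; apply: lb_le_inf; first by have [] := SA _ Sf.
  move=> c /= Mfc; rewrite lerNl; apply: lb_le_inf.
    by have [] := SA _ (SN _ Sf).
  by move=> d /= MNd; rewrite lerNl; exact: MDN MNd.
have SD f g : S f -> S g -> S (f \+ g) by exact: two_sidedD.
have LDle f g : S f -> S g -> L (f \+ g) <= L f + L g.
  move=> Sf Sg; rewrite -lerBlDr; apply: lb_le_inf; first by have [] := SA _ Sf.
  move=> c /= Mf; rewrite lerBlDr addrC -lerBlDr.
  apply: lb_le_inf; first by have [] := SA _ Sg.
  move=> d /= Mg; rewrite lerBlDr addrC; apply: Lle; first exact: SD.
  exact: MD.
have SZ t f : S f -> S (t \*o f) by exact: two_sidedZ.
have LZle t f : 0 < t -> S f -> L (t \*o f) <= t * L f.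
  move=> t0 Sf; rewrite -ler_pdivrMl//; apply: lb_le_inf.
    by have [] := SA _ Sf.
  move=> c /= Mf; rewrite ler_pdivrMl//; apply: Lle; first exact: SZ.
  by apply: MM => //; exact: ltW.
have LZ0 t f : 0 < t -> S f -> L (t \*o f) = t * L f.
  move=> t0 Sf; apply/eqP; rewrite eq_le LZle//= -ler_pdivlMl//.
  have {1}-> : f = t^-1 \*o (t \*o f).
    by apply/funext => x /=; rewrite mulKf// gt_eqF.
  by apply: LZle; [rewrite invr_gt0|exact: SZ].
exists L; split.
- move=> f g Sf Sg; apply/eqP; rewrite eq_le LDle//=.
  have {1}-> : f = (f \+ g) \+ (\- g) by apply/funext => x /=; ring.
  by rewrite -lerBrDr -LN//; apply: LDle; [exact: SD|exact: SN].
- move=> t f Sf; have [t0|t0|->] := ltgtP t 0.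
  + have -> : t \*o f = (- t) \*o (\- f) by apply/funext => x /=; ring.
    by rewrite LZ0 ?oppr_gt0 ?LN ?mulrNN//; exact: SN.
  + exact: LZ0.
  + have S0 : S (0 \*o f) by exact: SZ.
    have := LZ0 2 _ ltac:(by []) S0.
    have -> : 2 \*o (0 \*o f) = 0 \*o f by apply/funext => x /=; ring.
    by rewrite mul0r => E; lra.
- by move=> f c Sf /KM; exact: Lle.
- move=> Sv; have : L (\- v) <= - p.
    apply: Lle; first exact: SN.
    by apply: K'M; exact: cone_add_mem.
  by rewrite LN// lerN2.
Qed.

End conic_hahn_banach.

(** * Convex functions of one variable *)

Section convex_functions.
Context {R : realType}.
Implicit Types (I : set R) (f g : R -> R).

Lemma convex_functionP I f : convex_function I f <->
  forall x z t, I x -> I z -> 0 <= t <= 1 ->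
    f (t * x + (1 - t) * z) <= t * f x + (1 - t) * f z.
Proof.
split=> [cf x z t Ix Iz /andP[t0 t1]|cf t x z xI zI].
  pose i : {i01 R} := Itv01 t0 t1.
  by have := cf i x z (mem_set Ix) (mem_set Iz).
have := cf x z t%:num (set_mem xI) (set_mem zI).
by rewrite ge0 le1; exact.
Qed.

Lemma convex_function_chord I f x y z : convex_function I f -> I x -> I z ->
  x < z -> x <= y <= z ->
  (z - x) * f y <= (z - y) * f x + (y - x) * f z.
Proof.
move=> /convex_functionP cf Ix Iz xz /andP[xy yz].
have zx0 : 0 < z - x by rewrite subr_gt0.
have := cf x z ((z - y) / (z - x)) Ix Iz.
have -> : 1 - (z - y) / (z - x) = (y - x) / (z - x) by field; lra.
have -> : (z - y) / (z - x) * x + (y - x) / (z - x) * z = y by field; lra.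
rewrite divr_ge0 ?subr_ge0// ?(ltW xz)// ler_pdivrMr// mul1r lerD2l lerN2 xy.
move=> /(_ isT) H; rewrite mulrC -ler_pdivlMr//.
by apply: (le_trans H); rewrite le_eqVlt; apply/orP; left; apply/eqP; field; lra.
Qed.

Lemma convex_function_support I f a x b : convex_function I f ->
  I a -> I x -> I b -> a < x -> x < b ->
  exists s, forall y, I y -> f x + s * (y - x) <= f y.
Proof.
move=> cf Ia Ix Ib ax xb.
pose A := [set r | exists c, [/\ I c, c < x & r = (f x - f c) / (x - c)]].
have slopes c y : I c -> I y -> c < x -> x < y ->
    (f x - f c) / (x - c) <= (f y - f x) / (y - x).
  move=> Ic Iy cx xy.
  have := convex_function_chord cf Ic Iy (lt_trans cx xy).
  move=> /(_ x); rewrite (ltW cx) (ltW xy) => /(_ isT) H.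
  rewrite ler_pdivrMr ?subr_gt0// mulrAC ler_pdivlMr ?subr_gt0//; nra.
have supA : has_sup A.
  split; first by exists ((f x - f a) / (x - a)), a.
  by exists ((f b - f x) / (b - x)) => r [c [Ic cx ->]]; exact: slopes.
exists (sup A) => y Iy; have [yx|xy|->] := ltgtP y x; last 1 first.
- by rewrite subrr mulr0 addr0.
- have : (f x - f y) / (x - y) <= sup A.
    by apply: ub_le_sup; [exact: supA.2|exists y].
  rewrite ler_pdivrMr ?subr_gt0//; nra.
- have : sup A <= (f y - f x) / (y - x).
    by apply: ge_sup; [exact: supA.1|move=> r [c [Ic cx ->]]; exact: slopes].
  rewrite ler_pdivlMr ?subr_gt0//; nra.
Qed.

Lemma open_nbr I x : open I -> I x -> exists a b, [/\ I a, I b, a < x & x < b].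
Proof.
move=> oI Ix; have /nbhs_ballP[e /= e0 Be] := open_nbhs_nbhs (conj oI Ix).
exists (x - e / 2), (x + e / 2); split.
- by apply: Be; rewrite /ball/= opprD addNKr opprK ger0_norm; lra.
- by apply: Be; rewrite /ball/= opprD addNKr normrN ger0_norm; lra.
- lra.
- lra.
Qed.

Lemma convex_function_continuous I f x : open I -> convex_function I f -> I x ->
  {for x, continuous f}.
Proof.
move=> oI cf Ix; have [a [b [Ia Ib ax xb]]] := open_nbr oI Ix.
have [s fs] := convex_function_support cf Ia Ix Ib ax xb.
pose K := `|s| + `|(f b - f x) / (b - x)| + `|(f a - f x) / (x - a)| + 1.
have K0 : 0 < K by rewrite /K ltr_wpDl ?addr_ge0.
have KP y : I y -> a < y -> y < b -> `|f y - f x| <= K * `|y - x|.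
  move=> Iy ay yb; rewrite ler_norml; apply/andP; split.
    have := fs _ Iy; have := ler_norm (- (s * (y - x))); rewrite normrN normrM.
    have : `|s| * `|y - x| <= K * `|y - x|.
      by rewrite ler_wpM2r// /K -!addrA lerDl !addr_ge0.
    lra.
  have [yx|xy] := leP y x.
    apply: (@le_trans _ _ (`|(f a - f x) / (x - a)| * `|y - x|)); last first.
      rewrite ler_wpM2r// /K; have := normr_ge0 s.
      by have := normr_ge0 ((f b - f x) / (b - x)); lra.
    have := convex_function_chord cf Ia Ix ax.
    move=> /(_ y); rewrite (ltW ay) yx => /(_ isT) H.
    rewrite [X in _ * X]ler0_norm ?subr_le0// opprB.
    apply: (@le_trans _ _ ((f a - f x) / (x - a) * (x - y))); last first.
      by rewrite ler_wpM2r ?subr_ge0// ler_norm.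
    rewrite mulrAC ler_pdivlMr ?subr_gt0//; nra.
  apply: (@le_trans _ _ (`|(f b - f x) / (b - x)| * `|y - x|)); last first.
    rewrite ler_wpM2r// /K; have := normr_ge0 s.
    by have := normr_ge0 ((f a - f x) / (x - a)); lra.
  have := convex_function_chord cf Ix Ib xb.
  move=> /(_ y); rewrite (ltW xy) (ltW yb) => /(_ isT) H.
  rewrite [X in _ * X]gtr0_norm ?subr_gt0//.
  apply: (@le_trans _ _ ((f b - f x) / (b - x) * (y - x))); last first.
    by rewrite ler_wpM2r ?ler_norm// subr_ge0 ltW.
  rewrite mulrAC ler_pdivlMr ?subr_gt0//; nra.
apply/cvgrPdist_le => /= e e0.
near=> y; rewrite distrC; apply: (le_trans (KP y _ _ _)).
- by near: y; exact: (open_nbhs_nbhs (conj oI Ix)).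
- by near: y; exact: lt_nbhsr.
- by near: y; exact: lt_nbhsl.
- rewrite -ler_pdivlMl// distrC; near: y.
  by apply: cvgr_dist_le; [exact: cvg_id|rewrite mulr_gt0 ?invr_gt0].
Unshelve. all: by end_near. Qed.

Lemma convex_function_measurable I f : open I -> convex_function I f ->
  measurable_fun (I : set (measurableTypeR R)) (f : _ -> measurableTypeR R).
Proof.
move=> oI cf; apply: open_continuous_measurable_fun => // x /set_mem Ix.
exact: convex_function_continuous cf Ix.
Qed.

Lemma nondecreasing_on_measurable I f : is_interval I -> {in I &, {homo f : x y / x <= y}} ->
  measurable_fun (I : set (measurableTypeR R)) (f : _ -> measurableTypeR R).
Proof.
move=> iI ndf mI; apply: (measurability (@RGenOInfty.G R) (RGenOInfty.measurableE R)) => //.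
move=> _ [_ [r ->] <-]; apply: is_interval_measurable => x y /= [Ix fx] [Iy fy] z xzy.
have Iz : I z by exact: (iI _ _ Ix Iy).
split => //; move: fx fy xzy; rewrite !in_itv/= !andbT => fx fy /andP[xz zy].
by apply: (lt_le_trans fx); apply: ndf => //; exact: mem_set.
Qed.

Lemma convex_subgradient I f : open I -> is_interval I -> convex_function I f ->
  exists2 g : R -> R,
    measurable_fun (I : set (measurableTypeR R)) (g : _ -> measurableTypeR R) &
    forall x y, I x -> I y -> f x + g x * (y - x) <= f y.
Proof.
move=> oI iI cf.
have /choice[g gP] : forall x, exists s, I x -> forall y, I y -> f x + s * (y - x) <= f y.
  move=> x; have [Ix|] := pselect (I x); last by exists 0.
  have [a [b [Ia Ib ax xb]]] := open_nbr oI Ix.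
  by have [s] := convex_function_support cf Ia Ix Ib ax xb; exists s.
exists g; last by move=> x y Ix; exact: gP.
apply: nondecreasing_on_measurable => // x y /set_mem Ix /set_mem Iy.
rewrite le_eqVlt => /orP[/eqP->//|xy].
have := gP _ Ix _ Iy; have := gP _ Iy _ Ix => H1 H2.
have : g x * (y - x) <= g y * (y - x) by lra.
by rewrite ler_pM2r// subr_gt0.
Qed.

Lemma convex_function_max I f g : convex_function I f -> convex_function I g ->
  convex_function I (f \max g).
Proof.
move=> /convex_functionP cf /convex_functionP cg; apply/convex_functionP.
move=> x z t Ix Iz t01; have /andP[t0 t1] := t01; rewrite /= ge_max.
apply/andP; split.
- apply: (le_trans (cf _ _ _ Ix Iz t01)).
  by rewrite lerD// ler_wpM2l ?subr_ge0// le_max lexx.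
- apply: (le_trans (cg _ _ _ Ix Iz t01)).
  by rewrite lerD// ler_wpM2l ?subr_ge0// le_max lexx orbT.
Qed.

Lemma convex_function_affine I f c d a : 0 <= a -> convex_function I f ->
  convex_function I (fun x => c + d * x + a * f x).
Proof.
move=> a0 /convex_functionP cf; apply/convex_functionP => x z t Ix Iz t01.
by have := ler_wpM2l a0 (cf _ _ _ Ix Iz t01); lra.
Qed.

End convex_functions.

Section concave_link.
Context {R : realType} (phi : R -> R).
Hypothesis phi_ge0 : forall u : R, 0 <= u -> 0 <= phi u.
Hypothesis phi_concave : concave_function (nonneg R) phi.
Hypothesis phi_cont : {within nonneg R, continuous phi}.
Hypothesis phi0 : phi 0 = 0.

Lemma nonnegE (x : R) : nonneg R x <-> 0 <= x.
Proof. by rewrite /nonneg/= in_itv/= andbT. Qed.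

Lemma concave_tangent y : 0 < y -> exists s, [/\ 0 <= s, s * y <= phi y &
  forall u, 0 <= u -> phi u <= phi y + s * (u - y)].
Proof.
move=> y0.
have [| | | | | s sP] := @convex_function_support _ _ _ 0 y (y + 1) phi_concave.
- exact/nonnegE.
- exact/nonnegE/ltW.
- by apply/nonnegE; lra.
- exact: y0.
- lra.
exists (- s).
have le_tan u : 0 <= u -> phi u <= phi y + - s * (u - y).
  by move=> /nonnegE/sP/=; lra.
split=> //; last by have := le_tan 0 (lexx _); rewrite phi0; lra.
rewrite leNgt; apply/negP => s0.
have s0' : 0 < s by lra.
have ph0 := phi_ge0 (ltW y0).
have h0 : 0 <= (phi y + 1) / s by rewrite divr_ge0//; lra.
have u0 : 0 <= y + (phi y + 1) / s by lra.
have := phi_ge0 u0; have := le_tan _ u0.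
have -> : - s * (y + (phi y + 1) / s - y) = - (phi y + 1) by field; lra.
lra.
Qed.

Lemma concave_nondecreasing x y : 0 <= x -> x <= y -> phi x <= phi y.
Proof.
move=> x0 xy; have [y0|y0] := leP y 0.
  by have -> : x = y by lra.
have [s [s0 _ /(_ x x0)]] := concave_tangent y0.
have : s * (x - y) <= 0 by rewrite mulr_ge0_le0 ?subr_le0.
lra.
Qed.

Lemma concave_growth : exists2 K, 0 <= K & forall u, 0 <= u -> phi u <= K * (1 + u).
Proof.
have [s [s0 s1 sP]] := concave_tangent (ltr01 : 0 < 1 :> R).
by exists (phi 1) => [|u u0]; [exact: phi_ge0|have := sP u u0; nra].
Qed.

Lemma concave_small e : 0 < e -> exists2 d, 0 < d & forall u, 0 <= u -> u <= d -> phi u <= e.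
Proof.
move=> e0; have : phi x @[x --> 0^'+] --> phi 0.
  have := phi_cont; rewrite (_ : nonneg R = [set` `[0, +oo[])// => /continuous_within_itvcyP.
  by case.
rewrite phi0 => /cvgrPdist_le/(_ _ e0)[d /= d0 dP].
exists (d / 2) => [|u]; first by rewrite divr_gt0.
rewrite le_eqVlt => /orP[/eqP<- _|u0 ud]; first by rewrite phi0 ltW.
have := dP u; rewrite /= !sub0r !normrN (gtr0_norm u0) => /(_ _ u0) H.
by apply: (le_trans (ler_norm _)); apply: H; lra.
Qed.

Lemma concave_countable_tangents : exists al s : nat -> R,
  [/\ forall k, 0 <= s k, forall k u, 0 <= u -> phi u <= al k + s k * u &
      forall u e, 0 <= u -> 0 < e -> exists k, al k + s k * u <= phi u + e].
Proof.
pose y k : R := let r := ratr (odflt 0%Q (unpickle k)) in if 0 < r then r else 1.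
have y0 k : 0 < y k by rewrite /y; case: ifPn.
have yP (q : rat) : 0 < (ratr q : R) -> exists k, y k = ratr q.
  by move=> q0; exists (pickle q); rewrite /y pickleK/= q0.
have /choice[s sP] := fun k => concave_tangent (y0 k).
exists (fun k => phi (y k) - s k * y k), s; split.
- by move=> k; case: (sP k).
- by move=> k u u0; have [_ _ /(_ u u0)] := sP k; lra.
move=> u e; rewrite le_eqVlt => /orP[/eqP<- e0|u0 e0].
  have [d d0 dP] := concave_small e0.
  have [q] := rat_in_itvoo d0; rewrite in_itv/= => /andP[q0 qd].
  have [k yk] := yP _ q0; exists k; rewrite phi0 mulr0 !addr0 add0r yk.
  have := sP k; rewrite yk => -[s0 _ _].
  have : 0 <= s k * ratr q by rewrite mulr_ge0// ltW.
  have := dP _ (ltW q0) (ltW qd); lra.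
have pu := phi_ge0 (ltW u0).
pose l := phi u * u / (phi u + e).
have pe0 : 0 < phi u + e by lra.
have lu : l < u by rewrite /l ltr_pdivrMr//; nra.
have [q] := rat_in_itvoo lu; rewrite in_itv/= => /andP[q0 qd].
have l0 : 0 <= l by rewrite /l divr_ge0 ?(ltW pe0)// mulr_ge0// ltW.
have qgt0 : 0 < (ratr q : R) by exact: le_lt_trans q0.
have [k yk] := yP _ qgt0; exists k; rewrite yk.
have := sP k; rewrite yk => -[s0 sq _].
have pq : phi (ratr q) <= phi u by apply: concave_nondecreasing; exact: ltW.
rewrite /l ltr_pdivrMr// in q0.
rewrite -(ler_pM2r qgt0).
have h1 : phi (ratr q) * ratr q <= phi u * ratr q by rewrite ler_pM2r.
have h2 : s k * ratr q * (u - ratr q) <= phi u * (u - ratr q).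
  by rewrite ler_wpM2r ?subr_ge0 ?(ltW qd)// (le_trans sq).
have -> : (phi (ratr q) - s k * ratr q + s k * u) * ratr q =
  phi (ratr q) * ratr q + s k * ratr q * (u - ratr q) by ring.
rewrite [leRHS]mulrC; apply/ltW/le_lt_trans/q0; lra.
Qed.

Lemma link_measurable :
  measurable_fun (nonneg R : set (measurableTypeR R)) (phi : _ -> measurableTypeR R).
Proof. by apply: subspace_continuous_measurable_fun => //; exact: measurable_itv. Qed.

Hypothesis phi_pinfty : phi u @[u --> +oo] --> +oo.

Lemma link_surj v : 0 <= v -> exists2 u, 0 <= u & phi u = v.
Proof.
move=> v0; have [b [b0 vb]] : exists b, 0 <= b /\ v <= phi b.
  have /cvgryPge/(_ v) [M [_ MP]] := phi_pinfty.
  have h0 := normr_ge0 M; have h := ler_norm M.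
  by exists (`|M| + 1); split; [lra|apply: MP; lra].
have [||c] := @IVT _ phi 0 b v b0.
- apply: continuous_subspaceW phi_cont => x /=; rewrite in_itv/= => /andP[x0 _].
  exact/nonnegE.
- rewrite phi0 min_l ?phi_ge0// max_r ?phi_ge0//; exact/andP.
by rewrite in_itv/= => /andP[c0 _] <-; exists c.
Qed.

Hypothesis phi_inj : set_inj (nonneg R) phi.

Lemma phi_invK u : 0 <= u -> phi_inv phi (phi u) = u.
Proof. by move=> /nonnegE u0; rewrite /phi_inv pinvKV// inE. Qed.

Lemma phi_invKV v : 0 <= v -> 0 <= phi_inv phi v /\ phi (phi_inv phi v) = v.
Proof. by move=> /link_surj[u u0 <-]; rewrite phi_invK. Qed.

End concave_link.

(** * Hedges *)

Section real_integrable.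
Context d (T : measurableType d) {R : realType} (mu : {measure set T -> \bar R}).
Context (D : set T) (mD : measurable D).
Implicit Types f g : T -> R.
Local Notation integ f := (mu.-integrable D (EFin \o f)).

Lemma integrable_realD f g : integ f -> integ g -> integ (fun x => f x + g x).
Proof. by move=> fi gi; exact: (integrableD mD fi gi). Qed.

Lemma integrable_realN f : integ f -> integ (fun x => - f x).
Proof. by move=> fi; exact: (integrableN fi). Qed.

Lemma integrable_realB f g : integ f -> integ g -> integ (fun x => f x - g x).
Proof. by move=> fi gi; exact: (integrableB mD fi gi). Qed.

Lemma integrable_realZ r f : integ f -> integ (fun x => r * f x).
Proof. by move=> fi; exact: (integrableZl mD r fi). Qed.

Lemma integrable_real_measurable f : integ f -> measurable_fun D f.
Proof. by move=> /(measurable_int mu)/measurable_EFinP. Qed.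

Lemma integrable_real_le f g : measurable_fun D f -> (forall x, D x -> `|f x| <= g x) ->
  integ g -> integ f.
Proof.
move=> mf fg gi; apply: (le_integrable mD _ _ gi); first exact/measurable_EFinP.
by move=> x Dx /=; rewrite lee_fin (le_trans (fg _ Dx))// ler_norm.
Qed.

Lemma integrable_real_norm f : integ f -> integ (fun x => `|f x|).
Proof.
move=> fi; have mf := integrable_real_measurable fi.
apply: (le_integrable mD _ _ fi).
  by apply/measurable_EFinP; exact: measurableT_comp.
by move=> x Dx /=; rewrite lee_fin normr_id.
Qed.

Lemma integrable_real_max f g : integ f -> integ g -> integ (f \max g).
Proof.
move=> fi gi; apply: (@integrable_real_le _ (fun x => `|f x| + `|g x|)).
- by apply: measurable_maxr; exact: integrable_real_measurable.
- move=> x Dx /=; have := normr_ge0 (f x); have := normr_ge0 (g x).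
  by case: (leP (f x) (g x)); lra.
- by apply: integrable_realD; exact: integrable_real_norm.
Qed.

Lemma integrable_real_eq f g : (forall x, D x -> f x = g x) -> integ f -> integ g.
Proof. by move=> fg; apply: eq_integrable => // x /set_mem Dx /=; rewrite fg. Qed.

Lemma integralE_real f : integ f ->
  (\int[mu]_(x in D) (f x)%:E = (\int[mu]_(x in D) f x)%:E)%E.
Proof. by move=> fi; rewrite /Rintegral fineK//; exact: integrable_fin_num. Qed.

Lemma RintegralN f : integ f -> \int[mu]_(x in D) (- f x) = - \int[mu]_(x in D) f x.
Proof.
move=> fi; rewrite -mulN1r -RintegralZl//.
by apply: eq_Rintegral => x _; rewrite mulN1r.
Qed.

End real_integrable.

Fixpoint max_upto {R : realType} (f : nat -> R -> R) n : R -> R :=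
  if n is m.+1 then max_upto f m \max f m.+1 else f 0%N.

Section max_upto.
Context {R : realType}.
Implicit Types (I : set R) (f : nat -> R -> R) (n : nat).

Lemma le_max_upto f n j x : (j <= n)%N -> f j x <= max_upto f n x.
Proof.
elim: n => [|n IH]; first by rewrite leqn0 => /eqP->.
by rewrite leq_eqVlt ltnS => /orP[/eqP->|/IH jn] /=; rewrite le_max ?lexx ?orbT ?jn.
Qed.

Lemma max_uptoP f n x : exists2 j, (j <= n)%N & max_upto f n x = f j x.
Proof.
elim: n => [|n [j jn jE]]; first by exists 0%N.
have [h|h] := leP (max_upto f n x) (f n.+1 x).
  by exists n.+1 => //=; apply/max_idPr.
by exists j; [exact: leq_trans jn _|rewrite /= -jE; apply/max_idPl/ltW].
Qed.

Lemma max_upto_convex I f n : (forall j, (j <= n)%N -> convex_function I (f j)) ->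
  convex_function I (max_upto f n).
Proof.
elim: n => [H|n IH H]; first exact: H.
by apply: convex_function_max; [apply: IH => j jn; exact/H/leqW|exact: H].
Qed.

Lemma max_upto_integrable (mu : {measure set (measurableTypeR R) -> \bar R}) I f n :
  measurable I ->
  (forall j, (j <= n)%N -> mu.-integrable I (EFin \o (f j))) ->
  mu.-integrable I (EFin \o (max_upto f n)).
Proof.
move=> mI; elim: n => [H|n IH H]; first exact: H.
by apply: integrable_real_max => //; [apply: IH => j jn; exact/H/leqW|exact: H].
Qed.

End max_upto.

Section hedges.
Context {R : realType} (I : set R) (gamma : R -> R)
  (mu1 mu2 : probability (measurableTypeR R) R).
Hypothesis I_neq0 : I !=set0.
Hypothesis I_open : open I.
Hypothesis gamma_convex : convex_function I gamma.
Hypothesis mu1_mean : mu1.-integrable I (EFin \o @id R).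
Hypothesis mu2_mean : mu2.-integrable I (EFin \o @id R).
Hypothesis mu12_order : convex_order I mu1 mu2.
Hypothesis gamma_mu1 : mu1.-integrable I (EFin \o gamma).
Hypothesis gamma_mu2 : mu2.-integrable I (EFin \o gamma).

Let mI : measurable (I : set (measurableTypeR R)).
Proof. exact: open_measurable. Qed.

(* The third coordinate is [u = phi^-1(v)]. *)
Record hedge (f : R * R * R -> R) (u1 u2 d a : R -> R) : Prop := Hedge {
  hedge_int1 : mu1.-integrable I (EFin \o u1) ;
  hedge_int2 : mu2.-integrable I (EFin \o u2) ;
  hedge_fin1 : finite_set (d @` I) ;
  hedge_fin2 : finite_set (a @` I) ;
  hedge_ge0 : forall x, I x -> 0 <= a x ;
  hedge_le : forall x y u, I x -> I y -> 0 <= u ->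
    f (x, y, u) <= u1 x + u2 y + d x * (y - x) - a x * (gamma y - gamma x - u) }.

Definition hedgeable : set ((R * R * R -> R) * R) :=
  [set w | exists u1 u2 d a, hedge w.1 u1 u2 d a /\
    w.2 = \int[mu1]_(x in I) u1 x + \int[mu2]_(x in I) u2 x].

Lemma hedgeable_cone : cone hedgeable.
Proof.
split.
- exists (cst 0), (cst 0), (cst 0), (cst 0); split; last first.
    by rewrite !Rintegral_cst// !mul0r addr0.
  have f0 : finite_set ((cst 0 : R -> R) @` I).
    by apply: (@sub_finite_set _ _ [set 0]) => // _ [x _ <-].
  split => //=; try exact: integrable0.
  - by move=> x y u _ _ _; rewrite !mul0r !addr0 oppr0.
- move=> f c g c' [u1 [u2 [d [a [[i1 i2 fd fa a0 H] /= ->]]]]]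
    [u1' [u2' [d' [a' [[i1' i2' fd' fa' a0' H'] /= ->]]]]].
  exists (fun x => u1 x + u1' x), (fun x => u2 x + u2' x),
    (fun x => d x + d' x), (fun x => a x + a' x); split; last first.
    by rewrite /= !RintegralD//; ring.
  split => //=; try exact: integrable_realD.
  - exact: (finite_image11 (fun x y => x + y)).
  - exact: (finite_image11 (fun x y => x + y)).
  - by move=> x Ix; rewrite addr_ge0 ?a0 ?a0'.
  - move=> x y u Ix Iy u0; apply: (le_trans (lerD (H x y u Ix Iy u0) (H' x y u Ix Iy u0))).
    by rewrite le_eqVlt; apply/orP; left; apply/eqP; ring.
- move=> t f c t0 [u1 [u2 [d [a [[i1 i2 fd fa a0 H] /= ->]]]]].
  exists (fun x => t * u1 x), (fun x => t * u2 x),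
    (fun x => t * d x), (fun x => t * a x); split; last first.
    by rewrite /= !RintegralZl//; ring.
  split => //=; try exact: integrable_realZ.
  - by rewrite -(image_comp d ( *%R t)); exact: finite_image.
  - by rewrite -(image_comp a ( *%R t)); exact: finite_image.
  - by move=> x Ix; rewrite mulr_ge0 ?a0.
  - move=> x y u Ix Iy u0; apply: (le_trans (ler_wpM2l t0 (H x y u Ix Iy u0))).
    by rewrite le_eqVlt; apply/orP; left; apply/eqP; ring.
Qed.

Lemma hedgeable_le (f g : R * R * R -> R) c : (forall x y u, I x -> I y -> 0 <= u -> g (x, y, u) <= f (x, y, u)) ->
  hedgeable (f, c) -> hedgeable (g, c).
Proof.
move=> gf [u1 [u2 [d [a [[i1 i2 fd fa a0 H] /= ->]]]]].
exists u1, u2, d, a; split => //; split => // x y u Ix Iy u0.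
exact: le_trans (gf _ _ _ Ix Iy u0) (H _ _ _ Ix Iy u0).
Qed.

(* Lowering the static positions to the best ones for finitely many dynamic   *)
(* positions makes [u1] concave and [u2] convex.                              *)
Lemma hedge_reduction (g : R -> R) u1 u2 d a : hedge (fun w => g w.2) u1 u2 d a ->
  exists n (C D A K : nat -> R), [/\
    forall j, (j <= n)%N -> 0 <= A j,
    forall j u, (j <= n)%N -> 0 <= u -> g u <= K j + A j * u,
    forall x, I x -> exists2 j, (j <= n)%N & C j + D j * x - A j * gamma x <= u1 x &
    forall j y, (j <= n)%N -> I y -> K j - C j - D j * y + A j * gamma y <= u2 y].
Proof.
move=> [i1 i2 fd fa a0 H]; have [x0 Ix0] := I_neq0.
pose J := [set (d x, a x) | x in I].
have /finite_seqP[s sJ] : finite_set J.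
  exact: (finite_image11 pair).
have s0 : (0 < size s)%N.
  have : J (d x0, a x0) by exists x0.
  by rewrite sJ; case: (s).
have nthJ j : (j <= (size s).-1)%N -> exists2 x, I x & nth (0, 0) s j = (d x, a x).
  move=> js; have : [set` s] (nth (0, 0) s j).
    by apply: mem_nth; rewrite -(prednK s0) ltnS.
  by rewrite -sJ => -[x Ix <-]; exists x.
pose D j := (nth (0, 0) s j).1; pose A j := (nth (0, 0) s j).2.
pose Cset j := [set c | exists y u, [/\ I y, 0 <= u &
  c = g u - A j * u - u2 y - D j * y + A j * gamma y]].
pose C j := sup (Cset j).
pose Kset j := [set g u - A j * u | u in [set u | 0 <= u]].
pose K j := sup (Kset j).
have C0 j : Cset j !=set0.
  by exists (g 0 - A j * 0 - u2 x0 - D j * x0 + A j * gamma x0), x0, 0.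
have Cub x j : I x -> nth (0, 0) s j = (d x, a x) ->
    ubound (Cset j) (u1 x - D j * x + A j * gamma x).
  move=> Ix sj c [y [u [Iy u0 ->]]]; have := H x y u Ix Iy u0.
  by rewrite /D /A sj/=; lra.
have CP j y u : (j <= (size s).-1)%N -> I y -> 0 <= u ->
    g u - A j * u <= C j + u2 y + D j * y - A j * gamma y.
  move=> /nthJ[x Ix sj] Iy u0.
  have : g u - A j * u - u2 y - D j * y + A j * gamma y <= C j.
    by apply: ub_le_sup; [exists (u1 x - D j * x + A j * gamma x); exact: Cub|exists y, u].
  by lra.
have K0 j : Kset j !=set0 by exists (g 0 - A j * 0), 0 => //=.
exists (size s).-1, C, D, A, K; split.
- by move=> j /nthJ[x Ix]; rewrite /A => ->; exact: a0.
- move=> j u jn u0; rewrite -lerBlDr; apply: ub_le_sup; last by exists u.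
  exists (C j + u2 x0 + D j * x0 - A j * gamma x0) => _ [v /= v0 <-].
  exact: CP.
- move=> x Ix; have : J (d x, a x) by exists x.
  rewrite sJ => /(nthP (0, 0))[j js sj]; exists j; first by rewrite -ltnS prednK.
  have : C j <= u1 x - D j * x + A j * gamma x by apply: ge_sup => //; exact: Cub.
  by lra.
- move=> j y jn Iy.
  have : K j <= C j + u2 y + D j * y - A j * gamma y.
    by apply: ge_sup => // _ [u /= u0 <-]; exact: CP.
  by lra.
Qed.

Lemma affine_gamma_integrable (mu : probability (measurableTypeR R) R) c d a :
  mu.-integrable I (EFin \o @id R) -> mu.-integrable I (EFin \o gamma) ->
  mu.-integrable I (EFin \o (fun x => c + d * x + a * gamma x)).
Proof.
move=> idi gi; apply: integrable_realD => //; last exact: integrable_realZ.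
apply: integrable_realD => //; last exact: integrable_realZ.
exact: finite_measure_integrable_cst.
Qed.

Lemma hedgeable_arbitrage_free : arbitrage_free hedgeable.
Proof.
move=> c [u1 [u2 [d [a [/= H ->]]]]]; have := H => -[i1 i2 _ _ _ _].
have [n [C [D [A [K [A0 KP Cu1 Ku2]]]]]] := @hedge_reduction (fun=> 0) _ _ _ _ H.
pose l j x := - C j + (- D j) * x + A j * gamma x.
have lc j : (j <= n)%N -> convex_function I (l j).
  by move=> jn; apply: convex_function_affine => //; exact: A0.
have mc : convex_function I (max_upto l n) by exact: max_upto_convex.
have m1 : mu1.-integrable I (EFin \o max_upto l n).
  by apply: max_upto_integrable => // j jn; exact: affine_gamma_integrable.
have m2 : mu2.-integrable I (EFin \o max_upto l n).
  by apply: max_upto_integrable => // j jn; exact: affine_gamma_integrable.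
have h1 : - (\int[mu1]_(x in I) max_upto l n x) <= \int[mu1]_(x in I) u1 x.
  rewrite -RintegralN//; apply: le_Rintegral => //; first exact: integrable_realN.
  move=> x Ix; have [j jn] := Cu1 _ Ix; apply: le_trans.
  rewrite lerNl; apply: le_trans (le_max_upto l x jn); rewrite /l; lra.
have h2 : \int[mu2]_(x in I) max_upto l n x <= \int[mu2]_(x in I) u2 x.
  apply: le_Rintegral => // y Iy; have [j jn ->] := max_uptoP l n y.
  apply: le_trans (Ku2 j y jn Iy); have := KP j 0 jn (lexx _); rewrite /l; lra.
have : \int[mu1]_(x in I) max_upto l n x <= \int[mu2]_(x in I) max_upto l n x.
  by have := mu12_order mc; rewrite !integralE_real// lee_fin.
lra.
Qed.

End hedges.

Section regular_dual.
Context {R : realType} (I : set R) (gamma phi : R -> R)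
  (mu1 mu2 : probability (measurableTypeR R) R).
Hypothesis I_neq0 : I !=set0.
Hypothesis I_open : open I.
Hypothesis gamma_convex : convex_function I gamma.
Hypothesis phi_invP : forall v, 0 <= v -> 0 <= phi_inv phi v /\ phi (phi_inv phi v) = v.
Hypothesis mu1_I : mu1 I = 1%E.
Hypothesis mu1_mean : mu1.-integrable I (EFin \o @id R).
Hypothesis mu2_mean : mu2.-integrable I (EFin \o @id R).
Hypothesis gamma_mu1 : mu1.-integrable I (EFin \o gamma).
Hypothesis gamma_mu2 : mu2.-integrable I (EFin \o gamma).

Let mI : measurable (I : set (measurableTypeR R)).
Proof. exact: open_measurable. Qed.

Section softmax.
Variables (l : nat -> R -> R) (n : nat) (e : R).
Hypothesis e0 : 0 < e.

(* Weights of a continuous partition of unity carried by the indices that     *)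
(* are [e]-optimal in [max_upto l n].                                         *)
Definition weight j x := Num.max 0 (l j x - max_upto l n x + e).
Definition weighted (c : nat -> R) x := \sum_(j < n.+1) weight j x * c j.
Definition total_weight x := \sum_(j < n.+1) weight j x.

Lemma weight_ge0 j x : 0 <= weight j x.
Proof. by rewrite /weight le_max lexx. Qed.

Lemma total_weight_gt0 x : 0 < total_weight x.
Proof.
have [j jn jE] := max_uptoP l n x.
have jn' : (j < n.+1)%N by rewrite ltnS.
rewrite /total_weight (bigD1 (Ordinal jn'))//= ltr_pwDl//.
  by rewrite /weight -jE subrr add0r lt_max e0 orbT.
by apply: sumr_ge0 => i _; exact: weight_ge0.
Qed.

Lemma weight_optimal j x : weight j x * (max_upto l n x - e) <= weight j x * l j x.
Proof.
rewrite /weight; have [h|h] := leP 0 (l j x - max_upto l n x + e).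
  by rewrite ler_wpM2l//; lra.
by rewrite !mul0r.
Qed.

Lemma weight_continuous x j : {for x, continuous (l j)} ->
  {for x, continuous (max_upto l n)} -> {for x, continuous (weight j)}.
Proof.
move=> cl cm; apply: continuous_max; first exact: cvg_cst.
by apply: cvgD; [exact: cvgB|exact: cvg_cst].
Qed.

Lemma weighted_continuous c x : (forall j, (j <= n)%N -> {for x, continuous (l j)}) ->
  {for x, continuous (max_upto l n)} ->
  {for x, continuous (fun x => weighted c x / total_weight x)}.
Proof.
move=> cl cm.
have cw (j : 'I_n.+1) : {for x, continuous (weight j)}.
  by apply: weight_continuous => //; apply: cl; rewrite -ltnS.
apply: cvgM.
  apply: cvg_big => [|j _]; first exact: add_continuous.
  by apply: cvgM; [exact: cw|exact: cvg_cst].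
apply: cvgV; first by rewrite gt_eqF// total_weight_gt0.
by apply: cvg_big => [|j _]; [exact: add_continuous|exact: cw].
Qed.

End softmax.

Lemma hedgeable_regular c e : 0 < e ->
  hedgeable I gamma mu1 mu2 (fun w => phi w.2, c) ->
  exists q, [/\ dual_feasible I gamma phi mu1 mu2 q, dual_regular I q &
    (dual_cost I mu1 mu2 q <= (c + e)%:E)%E].
Proof.
move=> e0 [U1 [U2 [d [a [/= H ->]]]]]; have := H => -[i1 i2 _ _ _ _].
have [n [C [D [A [K [A0 KP Cu1 Ku2]]]]]] := hedge_reduction I_neq0 H.
pose l j x := - C j + (- D j) * x + A j * gamma x.
pose r j x := (K j - C j) + (- D j) * x + A j * gamma x.
have lc j : (j <= n)%N -> convex_function I (l j).
  by move=> jn; apply: convex_function_affine => //; exact: A0.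
have rc j : (j <= n)%N -> convex_function I (r j).
  by move=> jn; apply: convex_function_affine => //; exact: A0.
pose M1 := max_upto l n; pose M2 := max_upto r n.
have M1c : convex_function I M1 by exact: max_upto_convex.
have M2c : convex_function I M2 by exact: max_upto_convex.
have M1i : mu1.-integrable I (EFin \o M1).
  by apply: max_upto_integrable => // j jn; exact: affine_gamma_integrable.
have M2i : mu2.-integrable I (EFin \o M2).
  by apply: max_upto_integrable => // j jn; exact: affine_gamma_integrable.
have cst_convex k : convex_function I (fun=> k).
  have := convex_function_affine k 0 (lexx 0) gamma_convex.
  by congr (convex_function _ _); apply/funext => x; rewrite !mul0r !addr0.
pose De x := weighted l n e D x / total_weight l n e x.
pose Ga x := - (weighted l n e A x / total_weight l n e x).
have lcont j x : I x -> (j <= n)%N -> {for x, continuous (l j)}.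
  by move=> Ix jn; apply: (convex_function_continuous I_open _ Ix); exact: lc.
have Mcont x : I x -> {for x, continuous M1}.
  by move=> Ix; exact: (convex_function_continuous I_open M1c Ix).
have Dec x : I x -> {for x, continuous De}.
  by move=> Ix; apply: weighted_continuous => // [j|]; [exact: lcont|exact: Mcont].
have Gac x : I x -> {for x, continuous Ga}.
  move=> Ix; apply: cvgN.
  by apply: weighted_continuous => // [j|]; [exact: lcont|exact: Mcont].
have comp_fst (f : R -> R) (z : R * R) : {for z.1, continuous f} ->
    {for z, continuous (f \o fst)}.
  by move=> cf; apply: continuous_comp => //; exact: cvg_fst.
have mfst (f : R -> R) : (forall x, I x -> {for x, continuous f}) ->
    measurable_fun (I `*` nonneg R : set (measurableTypeR R * measurableTypeR R))
      (f \o fst : _ -> measurableTypeR R).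
  move=> cf; apply: (@measurable_comp _ _ _ _ _ _ I) => //.
  - by move=> _ [z [/= Iz _] <-].
  - by apply: open_continuous_measurable_fun => // x /set_mem; exact: cf.
  - exact: measurable_funS measurable_fst.
exists (Quadruple (fun x => e - M1 x) M2 (De \o fst) (Ga \o fst)); split.
- split => /=.
  + by apply: integrable_realB => //; exact: finite_measure_integrable_cst.
  + exact: M2i.
  + exact: mfst.
  + exists (\sum_(j < n.+1) `|D j|); split; first by rewrite num_real.
    move=> b /ltW bb z _; apply: le_trans bb; rewrite /= /De.
    set s := total_weight l n e z.1; have s0 : 0 < s by exact: total_weight_gt0.
    rewrite normrM normfV (gtr0_norm s0) ler_pdivrMr// mulr_suml.
    apply: (le_trans (ler_norm_sum _ _ _)); apply: ler_sum => j _.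
    rewrite normrM mulrC ler_wpM2l// ger0_norm ?weight_ge0//.
    rewrite /s /total_weight (bigD1 j)//= lerDl sumr_ge0// => i _.
    exact: weight_ge0.
  + exact: mfst.
  + move=> x y v Ix Iy v0; have [u0 uv] := phi_invP v0.
    set u := phi_inv phi v in u0 uv *.
    set s := total_weight l n e x; have s0 : 0 < s by exact: total_weight_gt0.
    have vj j : (j <= n)%N -> v <= M2 y - l j x + D j * (y - x)
        - A j * (gamma y - gamma x - u).
      move=> jn; have := KP j u jn u0; rewrite uv.
      have := le_max_upto r y jn; rewrite -/M2 /r /l; lra.
    rewrite -(ler_pM2l s0) /De /Ga /= -/s.
    have -> : s * (e - M1 x + M2 y + weighted l n e D x / s * (y - x) +
        - (weighted l n e A x / s) * (gamma y - gamma x - u)) =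
        s * (e - M1 x + M2 y) + weighted l n e D x * (y - x)
        - weighted l n e A x * (gamma y - gamma x - u).
      by field; rewrite gt_eqF.
    rewrite /s /total_weight /weighted !mulr_suml -big_split/= -sumrB.
    apply: ler_sum => j _.
    have jn : (j <= n)%N by rewrite -ltnS.
    have := ler_wpM2l (weight_ge0 l n e j x) (vj _ jn).
    have := weight_optimal l n e j x; rewrite -/M1; lra.
- split => /=.
  + by exists (fun=> e), M1; split => // x _.
  + by exists M2, (fun=> 0); split => // x _; rewrite subr0.
  + by apply: continuous_in_subspaceT => z /set_mem[Iz _]; apply/comp_fst/Dec.
  + by apply: continuous_in_subspaceT => z /set_mem[Iz _]; apply/comp_fst/Gac.
- rewrite /dual_cost/= !integralE_real//; last first.
    by apply: integrable_realB => //; exact: finite_measure_integrable_cst.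
  rewrite -EFinD lee_fin RintegralB//; last exact: finite_measure_integrable_cst.
  rewrite Rintegral_cst// [X in fine X]mu1_I mulr1.
  have h1 : - (\int[mu1]_(x in I) M1 x) <= \int[mu1]_(x in I) U1 x.
    rewrite -RintegralN//; apply: le_Rintegral => //; first exact: integrable_realN.
    move=> x Ix; have [j jn] := Cu1 _ Ix; apply: le_trans.
    rewrite lerNl; apply: le_trans (le_max_upto l x jn); rewrite /l; lra.
  have h2 : \int[mu2]_(x in I) M2 x <= \int[mu2]_(x in I) U2 x.
    apply: le_Rintegral => // y Iy; have [j jn E] := max_uptoP r n y.
    by rewrite /M2 E; apply: le_trans (Ku2 j y jn Iy); rewrite /r; lra.
  lra.
Qed.

End regular_dual.

(** * Couplings with a given bimeasure *)

Section dominated_additive.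
Context d (T : measurableType d) {R : realType} (mu : probability T R) (m : set T -> R).
Hypothesis m_ge0 : forall A, 0 <= m A.
Hypothesis mU : forall A B, measurable A -> measurable B -> A `&` B = set0 ->
  m (A `|` B) = m A + m B.
Hypothesis m_le : forall A, measurable A -> ((m A)%:E <= mu A)%E.

Lemma dominated_additive0 : m set0 = 0.
Proof. by have := mU measurable0 measurable0 (setI0 _); rewrite setU0; lra. Qed.

Lemma dominated_additive_sum (F : (set T)^nat) n : (forall i, measurable (F i)) ->
  trivIset setT F -> m (\big[setU/set0]_(i < n) F i) = \sum_(i < n) m (F i).
Proof.
move=> mF tF; elim: n => [|n IH].
  by rewrite !big_ord0 dominated_additive0.
rewrite !big_ord_recr/= mU ?IH//; first exact: bigsetU_measurable.
rewrite -bigcup_mkord; apply/eqP; apply: contraT => /set0P[x [[i /= ni Fix] Fnx]].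
have : i = n by apply: (tF i n) => //; exists x.
by move=> E; rewrite E ltnn in ni.
Qed.

Lemma dominated_sigma_additive : semi_sigma_additive (fun A => (m A)%:E).
Proof.
move=> F mF tF mUF; pose B n := \big[setU/set0]_(i < n) F i.
have mB n : measurable (B n) by exact: bigsetU_measurable.
have BU n : B n `<=` \bigcup_n F n.
  by rewrite /B -bigcup_mkord => x [i _ Fix]; exists i.
have mE n : \sum_(0 <= i < n) m (F i) = m (\bigcup_n F n) - m (\bigcup_n F n `\` B n).
  rewrite big_mkord -dominated_additive_sum// -/(B n).
  rewrite -{1}(setDUK (BU n)) mU//; first by ring.
  - exact: measurableD.
  - by rewrite setDE setIA [B n `&` _]setIC -setIA setICr setI0.
have tail : mu (\bigcup_n F n `\` B n) @[n --> \oo] --> 0%E.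
  rewrite [X in _ --> X](_ : _ = mu (\bigcap_n (\bigcup_n F n `\` B n))); last first.
    rewrite (_ : \bigcap_n _ = set0) ?measure0//.
    apply/eqP; apply: contraT => /set0P[x Hx]; have [[i _ Fix] _] := Hx 0%N I.
    have [_] := Hx i.+1 I; case; rewrite /B -bigcup_mkord.
    by exists i => //=.
  apply: nonincreasing_cvg_mu.
  - by rewrite -ge0_fin_numE// fin_num_measure//; exact: measurableD.
  - by move=> n; exact: measurableD.
  - by apply: bigcap_measurable => // n _; exact: measurableD.
  - move=> i j ij; apply/subsetPset; apply: setDS.
    rewrite /B -!bigcup_mkord => x [k /= ki Fkx].
    by exists k => //=; exact: leq_trans ki ij.
rewrite (_ : (fun n => _) = fun n => (m (\bigcup_n F n) - m (\bigcup_n F n `\` B n))%:E); last first.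
  by apply/funext => n; rewrite sumEFin mE.
apply: cvg_EFin; first by near=> n.
rewrite -[X in _ --> X]subr0; apply: cvgB; first exact: cvg_cst.
have : (m (\bigcup_n F n `\` B n))%:E @[n --> \oo] --> 0%E.
  apply: squeeze_cvge tail; last exact: cvg_cst.
  by near=> n; rewrite lee_fin m_ge0/= m_le//; exact: measurableD.
by move=> /fine_cvg.
Unshelve. all: by end_near. Qed.

Lemma dominated_additive_measure : exists M : {measure set T -> \bar R},
  forall A, M A = (m A)%:E.
Proof.
pose nu A := (m A)%:E.
have nu_ge0 A : (0 <= nu A)%E by rewrite lee_fin.
pose M : {measure set T -> \bar R} := HB.pack nu (isMeasure.Build _ _ _ nu
  (congr1 EFin dominated_additive0) nu_ge0 dominated_sigma_additive).
by exists M.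
Qed.

Lemma dominated_additive_density : exists F : T -> R,
  [/\ measurable_fun setT F, mu.-integrable setT (EFin \o F) &
   forall A, measurable A -> ((m A)%:E = \int[mu]_(x in A) (F x)%:E)%E].
Proof.
pose nu A := (m A)%:E.
pose nuC : {charge set T -> \bar R} := HB.pack nu (isCharge.Build _ _ _ nu
  (congr1 EFin dominated_additive0) (fun A _ => erefl : nu A \is a fin_num)
  dominated_sigma_additive).
have nuac : nuC `<< mu.
  apply/null_content_dominatesP => A mA muA; apply/eqP; rewrite eq_le.
  by rewrite -{1}muA m_le// lee_fin m_ge0.
exists (fine \o Radon_Nikodym nuC mu); have H x := Radon_Nikodym_fin_num x nuac.
have E : EFin \o (fine \o Radon_Nikodym nuC mu) = Radon_Nikodym nuC mu.
  by apply/funext => x /=; rewrite fineK.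
split.
- by apply/measurable_EFinP; rewrite E; apply: (measurable_int mu); exact: Radon_Nikodym_integrable.
- by rewrite E; exact: Radon_Nikodym_integrable.
- move=> A mA; rewrite -[LHS]/(nuC A) (Radon_Nikodym_integral nuac)//.
  by apply: eq_integral => x _; rewrite /= fineK.
Qed.

End dominated_additive.

Section null_sets.
Context d (T : measurableType d) {R : realType} (mu : {measure set T -> \bar R}).

Lemma negative_integrand_null (A : set T) (f : T -> R) : measurable A ->
  mu.-integrable A (EFin \o f) -> (forall x, A x -> f x < 0) ->
  0 <= \int[mu]_(x in A) f x -> mu A = 0%E.
Proof.
move=> mA fi f0 int0.
have mf : measurable_fun A (EFin \o f) := measurable_int mu fi.
have /ae_eq_integral_abs : (\int[mu]_(x in A) `|(EFin \o f) x|)%E = 0%E.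
  rewrite (eq_integral (fun x => (- f x)%:E)); last first.
    by move=> x /set_mem Ax; rewrite /= ltr0_norm// f0.
  rewrite integralE_real//; last exact: integrable_realN.
  congr EFin; apply/eqP; rewrite eq_le Rintegral_ge0 ?andbT; last first.
    by move=> x Ax; rewrite oppr_ge0 ltW// f0.
  by rewrite RintegralN// oppr_le0.
move=> /(_ mA mf)[N [mN N0 AN]].
apply/eqP; rewrite eq_le measure_ge0 andbT -N0 le_measure ?inE// => x Ax.
apply: AN => /= /(_ Ax) [] fx0; have := f0 _ Ax; rewrite fx0; lra.
Qed.

Lemma lt_null_of_integral_le (f g : T -> R) : mu.-integrable setT (EFin \o f) ->
  mu.-integrable setT (EFin \o g) ->
  (forall A, measurable A -> \int[mu]_(x in A) f x <= \int[mu]_(x in A) g x) ->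
  measurable [set x | g x < f x] /\ mu [set x | g x < f x] = 0%E.
Proof.
move=> fi gi fg.
have mf := integrable_real_measurable fi; have mg := integrable_real_measurable gi.
have mA : measurable [set x | g x < f x].
  rewrite -[X in measurable X]setTI.
  rewrite (_ : [set x | g x < f x] = (fun x => g x < f x) @^-1` [set true]).
    by apply: measurable_fun_ltr.
  by apply/seteqP; split => x /=; [move=> ->|].
split => //; apply: (@negative_integrand_null _ (fun x => g x - f x)) => //.
- by apply: integrable_realB => //; apply: integrableS measurableT mA _ _.
- by move=> x /=; rewrite subr_lt0.
- rewrite RintegralB// ?subr_ge0 ?fg//; exact: integrableS measurableT mA _ _.
Qed.

End null_sets.

Section monotone_densities.
Context d (T : measurableType d) {R : realType} (mu : probability T R).
Variable m : rat -> set T -> R.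
Hypothesis m_ge0 : forall q A, 0 <= m q A.
Hypothesis mU : forall q A B, measurable A -> measurable B -> A `&` B = set0 ->
  m q (A `|` B) = m q A + m q B.
Hypothesis m_le : forall q A, measurable A -> ((m q A)%:E <= mu A)%E.
Hypothesis m_nd : forall q q' A, measurable A -> q <= q' -> m q A <= m q' A.

Lemma monotone_densities : exists F : rat -> T -> R,
  [/\ forall q, measurable_fun setT (F q),
   forall q x, 0 <= F q x <= 1,
   forall x q q', q <= q' -> F q x <= F q' x &
   forall q A, measurable A -> ((m q A)%:E = \int[mu]_(x in A) (F q x)%:E)%E].
Proof.
have /choice[G GP] q := dominated_additive_density (m_ge0 q) (@mU q) (@m_le q).
have mG q : measurable_fun setT (G q) by case: (GP q).
have iG q A : measurable A -> mu.-integrable A (EFin \o G q).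
  by move=> mA; case: (GP q) => _ + _; exact: integrableS.
have GE q A : measurable A -> m q A = \int[mu]_(x in A) G q x.
  move=> mA; apply: EFin_inj; rewrite -integralE_real ?iG//.
  by case: (GP q) => _ _; exact.
have ic k A : measurable A -> mu.-integrable A (EFin \o cst k).
  by move=> mA; exact: finite_measure_integrable_cst.
pose N0 q := [set x | G q x < cst 0 x].
pose N1 q := [set x | cst 1 x < G q x].
pose N2 (qq : rat * rat) := if qq.1 <= qq.2 then [set x | G qq.2 x < G qq.1 x] else set0.
have N0P q : measurable (N0 q) /\ mu (N0 q) = 0%E.
  apply: lt_null_of_integral_le; [exact: ic|exact: iG|].
  by move=> A mA; rewrite Rintegral_cst// mul0r -GE.
have N1P q : measurable (N1 q) /\ mu (N1 q) = 0%E.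
  apply: lt_null_of_integral_le; [exact: iG|exact: ic|].
  move=> A mA; rewrite Rintegral_cst// mul1r -GE// -lee_fin fineK ?m_le//.
  exact: fin_num_measure.
have N2P qq : measurable (N2 qq) /\ mu (N2 qq) = 0%E.
  rewrite /N2; case: ifPn => [q12|_]; last by rewrite measure0.
  apply: lt_null_of_integral_le; [exact: iG|exact: iG|].
  by move=> A mA; rewrite -!GE// m_nd.
pose N := \bigcup_q N0 q `|` \bigcup_q N1 q `|` \bigcup_qq N2 qq.
have null_rat (I : countType) (F : I -> set T) :
    (forall i, measurable (F i) /\ mu (F i) = 0%E) ->
    measurable (\bigcup_i F i) /\ mu (\bigcup_i F i) = 0%E.
  move=> H.
  pose F' n := if unpickle n is Some i then F i else set0.
  have F'P n : measurable (F' n) /\ mu (F' n) = 0%E.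
    by rewrite /F'; case: unpickle => [i|]; [exact: H|rewrite measure0].
  have -> : \bigcup_i F i = \bigcup_n F' n.
    apply/seteqP; split => x.
      by move=> [i _ Fix]; exists (pickle i) => //; rewrite /F' pickleK.
    by move=> [n _]; rewrite /F'; case: unpickle => // i Fix; exists i.
  have mF : measurable (\bigcup_n F' n).
    by apply: bigcupT_measurable => n; case: (F'P n).
  split => //; apply: (@negligibleP _ _ _ mu _ mF).1.
  apply: negligible_bigcup => n.
  by have [mF'n ?] := F'P n; exact: (@negligibleP _ _ _ mu _ mF'n).2.
have [[mA0 A0] [mA1 A1] [mA2 A2]] :
    [/\ measurable (\bigcup_q N0 q) /\ mu (\bigcup_q N0 q) = 0%E,
        measurable (\bigcup_q N1 q) /\ mu (\bigcup_q N1 q) = 0%E &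
        measurable (\bigcup_qq N2 qq) /\ mu (\bigcup_qq N2 qq) = 0%E].
  by split; exact: null_rat.
have mN : measurable N by apply: measurableU => //; exact: measurableU.
have muN : mu N = 0%E.
  apply: null_set_setU => //; first exact: measurableU.
  exact: null_set_setU.
exists (fun q x => G q x * \1_(~` N) x); split.
- by move=> q; apply: measurable_funM => //; exact/measurable_indicP/measurableC.
- move=> q x; rewrite indicE; have [xN|] := boolP (x \in ~` N); last by rewrite mulr0 lexx ler01.
  move/set_mem: xN => /not_orP[/not_orP[x0 x1] _]; rewrite mulr1.
  apply/andP; split; rewrite leNgt; apply/negP => h; [apply: x0|apply: x1]; by exists q.
- move=> x q q' qq'; rewrite indicE; have [xN|] := boolP (x \in ~` N); last by rewrite !mulr0.
  move/set_mem: xN => /not_orP[_ x2]; rewrite !mulr1 leNgt; apply/negP => h.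
  by apply: x2; exists (q, q') => //; rewrite /N2/= qq'.
- move=> q A mA; case: (GP q) => _ _ ->//; apply: ae_eq_integral => //.
  + exact/measurable_EFinP/measurable_funTS.
  + apply/measurable_EFinP/measurable_funTS/measurable_funM => //.
    exact/measurable_indicP/measurableC.
  + exists N; split => // x /= /not_implyP[Ax]; apply: contra_notP => xN.
    by rewrite indicE mem_set// mulr1.
Qed.

End monotone_densities.

Section real_line_measures.
Context {R : realType}.
Local Notation X := (measurableTypeR R).

Lemma vanishing_measure d (T : measurableType d) (nu : {finite_measure set T -> \bar R})
    (F : (set T)^nat) (e : R) : (forall n, measurable (F n)) -> nonincreasing_seq F ->
  \bigcap_n F n = set0 -> 0 < e -> exists n, (nu (F n) < e%:E)%E.
Proof.
move=> mF ndF F0 e0.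
have : nu \o F @ \oo --> nu (\bigcap_n F n).
  apply: nonincreasing_cvg_mu => //.
  - by rewrite -ge0_fin_numE// fin_num_measure.
  - by rewrite F0.
rewrite F0 measure0 => /fine_cvgP[_ /cvgrPdist_lt/(_ _ e0)[n _ /(_ n (leqnn n))]].
rewrite /= sub0r normrN => h; exists n; rewrite -[ltLHS]fineK; last exact: fin_num_measure.
by rewrite lte_fin; apply: le_lt_trans h; exact: ler_norm.
Qed.

Lemma right_continuous_measure (nu : {finite_measure set X -> \bar R}) (y e : R) :
  0 < e -> exists2 d, 0 < d & forall z, z <= y + d -> (nu `]y, z]%classic < e%:E)%E.
Proof.
move=> e0; have [n nuF] : exists n, (nu `]y, (y + n.+1%:R^-1)%R]%classic < e%:E)%E.
  apply: (@vanishing_measure _ _ nu (fun n => `]y, (y + n.+1%:R^-1)%R]%classic)) => //.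
  - move=> i j ij; apply/subsetPset => x /=; rewrite !in_itv/= => /andP[-> /le_trans->]//.
    by rewrite lerD2l lef_pV2 ?posrE// ler_nat.
  - apply/eqP; apply: contraT => /set0P[x Hx].
    have := Hx 0%N I; rewrite /= in_itv/= => /andP[yx _].
    have xy0 : 0 < x - y by rewrite subr_gt0.
    have [k] := ltr_add_invr xy0; rewrite add0r => kx.
    have := Hx k I; rewrite /= in_itv/= => /andP[_]; rewrite -lerBlDl.
    by rewrite leNgt kx.
exists n.+1%:R^-1 => // z zy; apply: le_lt_trans nuF.
apply: le_measure; rewrite ?inE; [exact: measurable_itv|exact: measurable_itv|].
by move=> x /=; rewrite !in_itv/= => /andP[-> /le_trans->].
Qed.

Lemma tail_measure (nu : {finite_measure set X -> \bar R}) (e : R) : 0 < e ->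
  exists n : nat, (nu `]n%:R, +oo[%classic < e%:E)%E /\ (nu `]-oo, (- n%:R)%R]%classic < e%:E)%E.
Proof.
move=> e0.
have [n nun] : exists n : nat, (nu `]n%:R, +oo[%classic < e%:E)%E.
  apply: (@vanishing_measure _ _ nu (fun n => `]n%:R, +oo[%classic)) => //.
  - move=> i j ij; apply/subsetPset => x /=; rewrite !in_itv/= !andbT.
    by apply: le_lt_trans; rewrite ler_nat.
  - apply/eqP; apply: contraT => /set0P[x Hx].
    have := Hx (Num.bound `|x|) I; rewrite /= in_itv/= andbT ltNge.
    by rewrite (le_trans (ler_norm _))// ltW// archi_boundP.
have [k nuk] : exists n : nat, (nu `]-oo, (- n%:R)%R]%classic < e%:E)%E.
  apply: (@vanishing_measure _ _ nu (fun n => `]-oo, (- n%:R)%R]%classic)) => //.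
  - move=> i j ij; apply/subsetPset => x /=; rewrite !in_itv/= => /le_trans; apply.
    by rewrite lerN2 ler_nat.
  - apply/eqP; apply: contraT => /set0P[x Hx].
    have := Hx (Num.bound `|- x|).+1 I; rewrite /= in_itv/= leNgt ltrNl.
    by rewrite (le_lt_trans (ler_norm _))// (lt_trans (archi_boundP _))// ltr_nat.
exists (maxn n k); split.
- apply: le_lt_trans nun; apply: le_measure; rewrite ?inE; [exact: measurable_itv..|].
  move=> x /=; rewrite !in_itv/= !andbT; apply: le_lt_trans.
  by rewrite ler_nat leq_maxl.
- apply: le_lt_trans nuk; apply: le_measure; rewrite ?inE; [exact: measurable_itv..|].
  move=> x /=; rewrite !in_itv/= => /le_trans; apply.
  by rewrite lerN2 ler_nat leq_maxr.
Qed.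

Lemma uniform01_le (t : R) : 0 <= t <= 1 ->
  uniform_prob (@ltr01 R) [set x | x <= t] = t%:E.
Proof.
move=> /andP[t0 t1]; rewrite /uniform_prob integral_uniform_pdf.
have -> : [set x | x <= t] `&` `[0, 1]%classic = `[0, t]%classic.
  apply/seteqP; split => x /=; rewrite !in_itv/=.
    by move=> [-> /andP[-> _]].
  by move=> /andP[-> xt]; rewrite xt (le_trans xt).
rewrite (eq_integral (cst 1%E)); last first.
  move=> x /set_mem/=; rewrite in_itv/= => /andP[x0 xt].
  by rewrite /uniform_pdf x0 (le_trans xt t1)/= subr0 invr1.
rewrite integral_cst//= mul1e lebesgue_measure_itv/= lte_fin.
by move: t0; rewrite le_eqVlt => /orP[/eqP<-|->]; rewrite ?ltxx//= -EFinB subr0.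
Qed.

End real_line_measures.

Section law_of_map.
Context d d' (T : measurableType d) (T' : measurableType d') {R : realType}.

Lemma exists_law (P : probability T R) (f : T -> T') : measurable_fun setT f ->
  exists Q : probability T' R, forall A, Q A = P (f @^-1` A).
Proof.
move=> mf.
pose X : {mfun T >-> T'} := HB.pack f (isMeasurableFun.Build _ _ _ _ f mf).
by exists (distribution P X).
Qed.

End law_of_map.

Section real_probabilities.
Context d (T : measurableType d) {R : realType} (P : probability T R).

Definition Pr (S : set T) : R := fine (P S).

Lemma PrE S : measurable S -> P S = (Pr S)%:E.
Proof. by move=> mS; rewrite /Pr fineK//; exact: fin_num_measure. Qed.

Lemma Pr_ge0 S : 0 <= Pr S.
Proof. exact: fine_ge0. Qed.

Lemma Pr_le S S' : measurable S -> measurable S' -> S `<=` S' -> Pr S <= Pr S'.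
Proof. by move=> mS mS' SS'; rewrite -lee_fin -!PrE// le_measure ?inE. Qed.

Lemma Pr_setU_le S S' : measurable S -> measurable S' -> Pr (S `|` S') <= Pr S + Pr S'.
Proof.
move=> mS mS'; rewrite -lee_fin EFinD -!PrE//; last exact: measurableU.
exact: measureU2.
Qed.

Lemma Pr_setU S S' : measurable S -> measurable S' -> S `&` S' = set0 ->
  Pr (S `|` S') = Pr S + Pr S'.
Proof.
move=> mS mS' SS'; apply: EFin_inj; rewrite EFinD -!PrE//; last exact: measurableU.
exact: measureU.
Qed.

Lemma Pr_setC S : measurable S -> Pr (~` S) = 1 - Pr S.
Proof.
move=> mS; apply: EFin_inj; rewrite EFinB -!PrE//; last exact: measurableC.
exact: probability_setC.
Qed.

End real_probabilities.

Section rays.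
Context {R : realType}.
Local Notation X := (measurableTypeR R).

Lemma rays_determine (nu1 nu2 : probability X R) (n1 n2 : set X -> R) :
  (forall B, 0 <= n1 B) -> (forall B, 0 <= n2 B) ->
  (forall B B', measurable B -> measurable B' -> B `&` B' = set0 ->
    n1 (B `|` B') = n1 B + n1 B') ->
  (forall B B', measurable B -> measurable B' -> B `&` B' = set0 ->
    n2 (B `|` B') = n2 B + n2 B') ->
  (forall B, measurable B -> ((n1 B)%:E <= nu1 B)%E) ->
  (forall B, measurable B -> ((n2 B)%:E <= nu2 B)%E) ->
  n1 setT = n2 setT ->
  (forall y, n1 `]-oo, y]%classic = n2 `]-oo, y]%classic) ->
  forall B, measurable B -> n1 B = n2 B.
Proof.
move=> n1_ge0 n2_ge0 n1U n2U n1_le n2_le nT nray B mB.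
have [M1 M1E] := dominated_additive_measure n1_ge0 n1U n1_le.
have [M2 M2E] := dominated_additive_measure n2_ge0 n2U n2_le.
suff : M1 B = M2 B by rewrite M1E M2E => -[].
apply: (@measure_unique _ R X (@RGenOInfty.G R) (fun n => `](- n%:R), +oo[%classic) _ _ _ _ M1 M2 _ _ B mB).
- exact: RGenOInfty.measurableE.
- move=> _ _ [x ->] [y ->]; exists (Num.max x y).
  by apply/seteqP; split => z /=; rewrite !in_itv/= !andbT gt_max => /andP.
- by move=> n; exists (- n%:R).
- apply/seteqP; split => // x _; exists (Num.bound `|- x|) => //=.
  rewrite in_itv/= andbT ltrNl (le_lt_trans (ler_norm _))//; exact: archi_boundP.
- move=> _ [y ->]; rewrite M1E M2E; congr EFin.
  have mr : measurable (`]-oo, y]%classic : set X) by exact: measurable_itv.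
  have mc : measurable (`]y, +oo[%classic : set X) by exact: measurable_itv.
  have d0 : (`]-oo, y]%classic : set X) `&` `]y, +oo[%classic = set0.
    by rewrite -setCitvl setICr.
  have uT : (`]-oo, y]%classic : set X) `|` `]y, +oo[%classic = setT.
    by rewrite -setCitvl setUv.
  have := n1U _ _ mr mc d0; have := n2U _ _ mr mc d0; rewrite uT nT nray; lra.
- by move=> n; rewrite M1E ltry.
Qed.

End rays.

Section quantile.
Context d (T : measurableType d) {R : realType} (P : probability T R).
Variable E : rat -> set T.
Hypothesis mE : forall q, measurable (E q).
Hypothesis ndE : forall q q', q <= q' -> E q `<=` E q'.
Hypothesis E_lim : forall e, 0 < e -> exists q q', Pr P (~` E q) <= e /\ Pr P (E q') <= e.

Let Q (z : T) : R := inf [set ratr q | q in [set q | E q z]].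
Let G := [set z | (exists q, E q z) /\ (exists q, ~ E q z)].

Let GE1 z q : G z -> E q z -> Q z <= ratr q.
Proof.
move=> [_ [q0 Eq0]] Eq; apply: ge_inf; last by exists q.
exists (ratr q0) => _ [q' /= Eq' <-]; rewrite ler_rat leNgt; apply/negP => q'q.
by apply: Eq0; apply: ndE Eq'; exact: ltW.
Qed.

Let GE2 z q : G z -> Q z < ratr q -> E q z.
Proof.
move=> [[q1 Eq1] _] Qq; have [|_ [q' /= Eq' <-]] := inf_lt _ Qq.
  by exists (ratr q1), q1.
by rewrite ltr_rat => /ltW/ndE; exact.
Qed.

Let GE3 z : ~ G z -> Q z = 0.
Proof.
move=> nG; rewrite /Q inf_out// => -[[_ [q Eq _]] [l lE]]; apply: nG.
split; first by exists q.
have l1 : l - 1 < l by rewrite ltrBlDr ltrDl.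
have [q'] := rat_in_itvoo l1; rewrite in_itv/= => /andP[_ q'l].
exists q' => Eq'; have : l <= ratr q' by apply: lE; exists q'.
by rewrite leNgt q'l.
Qed.

Let mcapE (D : set rat) : measurable (\bigcap_(q in D) E q).
Proof.
rewrite -[X in measurable X]setCK; apply: measurableC; rewrite setC_bigcap.
rewrite bigcup_mkcond; apply: bigcupT_measurable_rat => q; case: ifP => // _.
exact: measurableC.
Qed.

Let mG : measurable G.
Proof.
have -> : G = \bigcup_q E q `&` ~` (\bigcap_q E q).
  apply/seteqP; split => z /=.
    by move=> [[q ?] [q' nE]]; split; [exists q|move=> /(_ q' I)].
  move=> [[q _ ?] /existsNP[q' /not_implyP[_ nE]]].
  by split; [exists q|exists q'].
apply: measurableI; first exact: bigcupT_measurable_rat.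
exact: measurableC.
Qed.

Let PG : P (~` G) = 0%E.
Proof.
rewrite PrE; last exact: measurableC.
congr EFin; apply/eqP; rewrite eq_le Pr_ge0 andbT.
apply/ler_addgt0Pl => e e0; rewrite addr0.
have [q [q' [hq hq']]] := E_lim (divr_gt0 e0 (ltr0n R 2)).
have sub : ~` G `<=` ~` E q `|` E q'.
  move=> z /= /not_andP[nE|nE]; first by left => ?; apply: nE; exists q.
  by right; apply: contrapT => ?; apply: nE; exists q'.
have mEq := measurableC (mE q).
have h := Pr_le P (measurableC mG) (measurableU _ _ mEq (mE q')) sub.
have h' := Pr_setU_le P mEq (mE q').
apply: (le_trans h); apply: (le_trans h'); rewrite [leRHS]splitr; exact: lerD.
Qed.

Lemma exists_quantile : exists (Q : T -> R) (N : set T),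
  [/\ measurable_fun setT (Q : _ -> measurableTypeR R), measurable N, P N = 0%E &
   forall z q, ~ N z -> (E q z -> Q z <= ratr q) /\ (Q z < ratr q -> E q z)].
Proof.
exists Q, (~` G); split; [|exact: measurableC|exact: PG|]; last first.
  by move=> z q /contrapT Gz; split; [exact: GE1|exact: GE2].
move=> _; apply: (measurability (@RGenOInfty.G R) (RGenOInfty.measurableE R)) => //.
move=> _ [_ [y ->] <-]; rewrite setTI -[X in measurable X]setCK; apply: measurableC.
have -> : ~` (Q @^-1` `]y, +oo[%classic) =
    (G `&` \bigcap_(q in [set q : rat | y < ratr q]) E q) `|` (~` G `&` [set z | 0 <= y]).
  apply/seteqP; split => z /=; rewrite in_itv/= andbT.
    move/negP; rewrite -leNgt => Qy; have [Gz|nGz] := pselect (G z).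
      by left; split => // q /= yq; apply: GE2 => //; exact: le_lt_trans yq.
    by right; split => //; rewrite -(GE3 nGz).
  move=> [[Gz Ez]|[nGz y0]]; apply/negP; rewrite -leNgt; last by rewrite GE3.
  rewrite leNgt; apply/negP => yQ; have [q] := rat_in_itvoo yQ.
  rewrite in_itv/= => /andP[yq qQ]; have := GE1 Gz (Ez _ yq).
  by rewrite leNgt qQ.
apply: measurableU; first exact: measurableI.
apply: measurableI; first exact: measurableC.
have [y0|y0] := boolP (0 <= y).
  by rewrite (_ : [set _ | _] = setT)//; apply/seteqP; split.
by rewrite (_ : [set _ | _] = set0)//; apply/seteqP; split => // z /=.
Qed.

End quantile.

Section hypograph.
Context {R : realType} d (T : measurableType d).
Local Notation X := (measurableTypeR R).

Lemma exists_uniform_extension (mu : probability T R) :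
  exists2 P : probability (T * X)%type R, forall A, measurable A -> P (A `*` setT) = mu A &
    forall (F : T -> R) A, measurable_fun setT F -> (forall x, 0 <= F x <= 1) ->
    measurable A ->
    measurable [set z : T * X | z.2 <= F z.1] /\
    P ((A `*` setT) `&` [set z : T * X | z.2 <= F z.1]) = (\int[mu]_(x in A) (F x)%:E)%E.
Proof.
pose U := uniform_prob (@ltr01 R).
exists (mu \x U)%E => [A mA|F A mF F01 mA].
  transitivity (mu A * U setT)%E; first exact: product_measure1E.
  by rewrite [X in (_ * X)%E]probability_setT mule1.
split.
  rewrite -[X in measurable X]setTI.
  rewrite (_ : [set _ | _] = (fun z : T * X => z.2 <= F z.1) @^-1` [set true]); last first.
    by apply/seteqP; split => z /=; [move=> ->|].
  apply: (@measurable_fun_ler _ _ R) => //.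
  exact: (measurableT_comp mF measurable_fst).
rewrite integral_mkcond; apply: eq_integral => x _ /=.
rewrite patchE; case: ifPn => xA.
  rewrite -(uniform01_le (F01 x)); congr (U _).
  apply/seteqP; split => t; rewrite /xsection/= inE/=; first by case.
  by move=> ?; split => //; split => //; exact: set_mem.
rewrite (_ : xsection _ _ = set0) ?measure0//.
apply/seteqP; split => t //; rewrite /xsection/= inE/= => -[[xA' _] _].
by rewrite notin_setE in xA.
Qed.

End hypograph.

Section quantile_coupling.
Context {R : realType}.
Local Notation X := (measurableTypeR R).
Variables (mu1 mu2 : probability X R) (m : set R -> set R -> R).
Hypothesis m_ge0 : forall A B, 0 <= m A B.
Hypothesis mUl : forall A A' B, measurable (A : set X) -> measurable (A' : set X) ->
  measurable (B : set X) -> A `&` A' = set0 -> m (A `|` A') B = m A B + m A' B.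
Hypothesis mUr : forall A B B', measurable (A : set X) -> measurable (B : set X) ->
  measurable (B' : set X) -> B `&` B' = set0 -> m A (B `|` B') = m A B + m A B'.
Hypothesis m1 : forall A, measurable (A : set X) -> (m A setT)%:E = mu1 A.
Hypothesis m2 : forall B, measurable (B : set X) -> (m setT B)%:E = mu2 B.

Lemma bimeasure_ler A B B' : measurable (A : set X) -> measurable (B : set X) ->
  measurable (B' : set X) -> B `<=` B' -> m A B <= m A B'.
Proof.
move=> mA mB mB' BB'; rewrite -(setDUK BB') mUr//; last 2 first.
- exact: measurableD.
- by rewrite setDIK.
by rewrite lerDl.
Qed.

Lemma bimeasure_lel A A' B : measurable (A : set X) -> measurable (A' : set X) ->
  measurable (B : set X) -> A `<=` A' -> m A B <= m A' B.
Proof.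
move=> mA mA' mB AA'; rewrite -(setDUK AA') mUl//; last 2 first.
- exact: measurableD.
- by rewrite setDIK.
by rewrite lerDl.
Qed.

Lemma bimeasure_le1 A B : measurable (A : set X) -> measurable (B : set X) ->
  ((m A B)%:E <= mu1 A)%E.
Proof. by move=> mA mB; rewrite -m1// lee_fin bimeasure_ler. Qed.

Lemma bimeasure_le2 A B : measurable (A : set X) -> measurable (B : set X) ->
  ((m A B)%:E <= mu2 B)%E.
Proof. by move=> mA mB; rewrite -m2// lee_fin bimeasure_lel. Qed.

Let ray (y : R) : set X := `]-oo, y]%classic.
Let mray y : measurable (ray y). Proof. exact: measurable_itv. Qed.
Let rayE y x : ray y x = (x <= y) :> Prop.
Proof. by rewrite /ray/= in_itv. Qed.
Let le_ray y z : y <= z -> ray y `<=` ray z.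
Proof. by move=> yz x; rewrite /ray/= !in_itv/= => /le_trans; exact. Qed.

Theorem exists_coupling : exists P : probability (X * X)%type R,
  forall A B, measurable A -> measurable B -> P (A `*` B) = (m A B)%:E.
Proof.
have [F [mF F01 ndF FE]] : exists F : rat -> X -> R,
  [/\ forall q, measurable_fun setT (F q),
   forall q x, 0 <= F q x <= 1,
   forall x q q', q <= q' -> F q x <= F q' x &
   forall q A, measurable A -> ((m A (ray (ratr q)))%:E = \int[mu1]_(x in A) (F q x)%:E)%E].
  apply: (@monotone_densities _ X R mu1 (fun q A => m A (ray (ratr q)))) => //.
  - by move=> q A B mA mB AB; exact: mUl.
  - by move=> q A mA; exact: bimeasure_le1.
  - by move=> q q' A mA qq'; apply: bimeasure_ler => //; apply: le_ray; rewrite ler_rat.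
have [P0 P0T P0F] := exists_uniform_extension mu1.
pose E q : set (X * X) := [set z | z.2 <= F q z.1].
have mE q : measurable (E q) by have [] := P0F _ _ (mF q) (F01 q) measurableT.
have ndE q q' : q <= q' -> E q `<=` E q'.
  by move=> qq' z /= /le_trans; apply; exact: ndF.
have P0E A q : measurable (A : set X) -> Pr P0 ((A `*` setT) `&` E q) = m A (ray (ratr q)).
  by move=> mA; have [_ ] := P0F _ _ (mF q) (F01 q) mA; rewrite -FE// /Pr => ->.
have P0ET q : Pr P0 (E q) = Pr mu2 (ray (ratr q)).
  have := P0E setT q measurableT; rewrite setXTT setTI => ->.
  by apply: EFin_inj; rewrite m2// PrE.
have [|Q [N [mQ mN N0 QE]]] := exists_quantile (P := P0) mE ndE.
  move=> e e0; have [n [n1 n2]] := tail_measure mu2 e0.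
  exists n%:R, (- n%:R); split.
    rewrite Pr_setC// P0ET -Pr_setC// ratr_nat /ray setCitvl.
    by rewrite -lee_fin -PrE ?ltW//; exact: measurable_itv.
  rewrite P0ET rmorphN/= ratr_nat.
  by rewrite -lee_fin -PrE ?ltW//; exact: measurable_itv.
have mf : measurable_fun setT (fun z : X * X => (z.1, Q z) : X * X).
  exact: measurable_fun_pair.
have [P PE] := exists_law P0 mf.
have [P2 P2E] := exists_law P (@measurable_snd _ _ X X).
have mcyl A B : measurable (A : set X) -> measurable (B : set X) ->
  measurable (A `*` B) by move=> mA mB; exact: measurableX.
exists P => A B mA mB; rewrite PrE; last exact: measurableX.
have rays y : Pr P (A `*` ray y) = m A (ray y).
  pose S y := (A `*` setT) `&` Q @^-1` ray y.
  have mQr (C : set X) : measurable C -> measurable (Q @^-1` C).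
    by move=> mC; rewrite -[X in measurable X]setTI; exact: mQ.
  have mS z : measurable (S z) by apply: measurableI; [exact: mcyl|exact: mQr].
  have PS z : Pr P (A `*` ray z) = Pr P0 (S z).
    rewrite /Pr PE; congr (fine (P0 _)).
    by apply/seteqP; split => -[x t] /=; [move=> [? ?]|move=> [[? _] ?]].
  have PN : Pr P0 N = 0 by rewrite /Pr N0.
  have mAE q : measurable ((A `*` setT) `&` E q) by apply: measurableI => //; exact: mcyl.
  have lower q : m A (ray (ratr q)) <= Pr P0 (S (ratr q)).
    rewrite -P0E// -[leRHS]addr0 -PN; apply: le_trans (Pr_setU_le P0 (mS _) mN).
    apply: Pr_le => //; first exact: measurableU.
    move=> z [Az Ez]; have [Nz|/QE-/(_ q)[H _]] := pselect (N z); [by right|left].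
    by split => //; rewrite /preimage/= rayE; exact: H.
  have upper q z : z < ratr q -> Pr P0 (S z) <= m A (ray (ratr q)).
    move=> zq; rewrite -P0E// -[leRHS]addr0 -PN.
    apply: le_trans (Pr_setU_le P0 (mAE _) mN).
    apply: Pr_le => //; first exact: measurableU.
    move=> w [Aw Qw]; have [Nw|/QE-/(_ q)[_ H]] := pselect (N w); [by right|left].
    by split => //; apply: H; move: Qw; rewrite /preimage/= rayE => /le_lt_trans; exact.
  have [LQ LQE] := exists_law P0 mQ.
  rewrite PS; apply/eqP; rewrite eq_le; apply/andP; split; apply/ler_addgt0Pl => e e0.
    have [dl d0 dP] := right_continuous_measure mu2 y e0.
    have [q] := rat_in_itvoo (ltr_pwDr d0 (lexx y)).
    rewrite in_itv/= => /andP[yq qd]; apply: (le_trans (upper q y yq)).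
    have mI : measurable (`]y, ratr q]%classic : set X) by exact: measurable_itv.
    have -> : ray (ratr q) = ray y `|` `]y, ratr q]%classic.
      apply/seteqP; split => x; rewrite /ray/= !in_itv/=.
        by move=> xq; have [xy|xy] := leP x y; [left|right].
      by move=> [/le_trans|/andP[_]//]; apply; exact: ltW.
    rewrite mUr//; last first.
      apply/seteqP; split => x //; rewrite /ray/= !in_itv/= => -[xy /andP[yx _]].
      by move: yx; rewrite ltNge xy.
    rewrite addrC lerD2r -lee_fin; apply: le_trans (bimeasure_le2 mA mI) _.
    exact/ltW/dP/ltW.
  have [dl d0 dP] := right_continuous_measure LQ y e0.
  have [q] := rat_in_itvoo (ltr_pwDr d0 (lexx y)).
  rewrite in_itv/= => /andP[yq qd].
  have mI : measurable (`]y, ratr q]%classic : set X) by exact: measurable_itv.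
  apply: (@le_trans _ _ (m A (ray (ratr q)))).
    by apply: bimeasure_ler => //; apply: le_ray; exact: ltW.
  apply: (le_trans (lower q)).
  apply: (@le_trans _ _ (Pr P0 (S y `|` Q @^-1` `]y, ratr q]%classic))).
    apply: Pr_le => //; first by apply: measurableU => //; exact: mQr.
    move=> w [Aw]; rewrite /preimage/= rayE => Qw.
    have [Qy|Qy] := leP (Q w) y; [left|right].
      by split => //; rewrite /preimage/= rayE.
    by rewrite /preimage/= in_itv/= Qy.
  apply: (le_trans (Pr_setU_le P0 (mS _) (mQr _ mI))).
  rewrite addrC lerD2r -lee_fin; have := LQE `]y, ratr q]%classic.
  rewrite (PrE P0 (mQr _ mI)).
  by move=> <-; exact/ltW/dP/ltW.
congr EFin; apply: (@rays_determine _ P2 mu2 (fun B => Pr P (A `*` B)) (m A)) => //.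
- by move=> B'; exact: Pr_ge0.
- move=> B1 B2 mB1 mB2 B12; have -> : A `*` (B1 `|` B2) = A `*` B1 `|` A `*` B2.
    apply/seteqP; split => z /=; first by move=> [? [?|?]]; [left|right].
    by move=> [[? ?]|[? ?]]; split => //; [left|right].
  by rewrite Pr_setU//; [exact: mcyl..|rewrite -setXI B12 setX0].
- by move=> B1 B2 mB1 mB2 B12; exact: mUr.
- move=> B' mB'; rewrite -(PrE P (mcyl _ _ mA mB')).
  suff : (P (A `*` B') <= P (snd @^-1` B'))%E by have <- := P2E B'.
  apply: le_measure; rewrite ?inE.
  + exact: mcyl.
  + by rewrite -[X in measurable X]setTI; exact: measurable_snd.
  + by move=> z [].
- by move=> B' mB'; exact: bimeasure_le2.
- apply: EFin_inj; transitivity (P0 (A `*` setT)); last by rewrite P0T// m1.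
  rewrite -(PrE P (mcyl _ _ mA measurableT)); apply: etrans (PE _) _; congr (P0 _).
Qed.

End quantile_coupling.

(** * From the functional to a primal measure *)

Section change_of_variables.
Context d d' (T : measurableType d) (T' : measurableType d') {R : realType}.
Variables (P : probability T R) (Q : probability T' R) (g : T -> T').
Hypothesis mg : measurable_fun setT g.
Hypothesis QE : forall B, measurable B -> Q B = P (g @^-1` B).

Lemma law_integrable (D : set T') (f : T' -> R) : measurable D ->
  Q.-integrable D (EFin \o f) ->
  P.-integrable (g @^-1` D) (EFin \o (f \o g)) /\
  \int[P]_(x in g @^-1` D) f (g x) = \int[Q]_(y in D) f y.
Proof.
move=> mD fi.
have mgD : measurable (g @^-1` D) by rewrite -[X in measurable X]setTI; exact: mg.
pose F := (EFin \o f) \_ D.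
have Fi : Q.-integrable setT F by apply/(integrable_mkcond _ mD).
have mF : measurable_fun setT F := measurable_int Q Fi.
have E : (EFin \o (f \o g)) \_ (g @^-1` D) = F \o g.
  apply/funext => x; rewrite /F /= !patchE /=.
  by congr (if _ then _ else _); rewrite !mem_setE.
have Fgi : P.-integrable setT (F \o g).
  apply/integrableP; split; first exact: measurableT_comp.
  move/integrableP : Fi => [_]; apply: le_lt_trans.
  rewrite le_eqVlt; apply/orP; left; apply/eqP.
  transitivity (\int[pushforward P g]_y `|F y|)%E; last first.
    by apply: eq_measure_integral => A mA _; exact/esym/QE.
  by rewrite ge0_integral_pushforward//; exact: measurableT_comp.
split; first by apply/(integrable_mkcond _ mgD); rewrite E.
congr fine; rewrite -/F integral_mkcond.
rewrite [RHS]integral_mkcond -/F.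
transitivity (\int[pushforward P g]_y F y)%E; last first.
  by apply: eq_measure_integral => A mA _; exact/esym/QE.
by rewrite integral_pushforward.
Qed.

End change_of_variables.

Import HBSimple.

Section functionals_on_L1.
Context d (T : measurableType d) {R : realType} (mu : probability T R) (D : set T).
Hypothesis mD : measurable D.
Local Notation integ f := (mu.-integrable D (EFin \o f)).

Record L1_functional (La : (T -> R) -> R) : Prop := L1Functional {
  L1_functionalD : forall f g, integ f -> integ g ->
    La (fun x => f x + g x) = La f + La g ;
  L1_functionalZ : forall c f, integ f -> La (fun x => c * f x) = c * La f ;
  L1_functional_bound : forall f, integ f -> `|La f| <= \int[mu]_(x in D) `|f x| }.

Lemma L1_functional_sum La n (f : 'I_n -> T -> R) : L1_functional La ->
  (forall i, integ (f i)) ->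
  integ (fun x => \sum_(i < n) f i x) /\
  La (fun x => \sum_(i < n) f i x) = \sum_(i < n) La (f i).
Proof.
move=> FL; elim: n f => [f fi|n IH f fi].
  have E : (fun x : T => \sum_(i < 0) f i x) = (fun x => 0 * (cst 0 : T -> R) x).
    by apply/funext => x; rewrite big_ord0 mul0r.
  have i0 : integ (cst 0 : T -> R) by exact: integrable0.
  by rewrite E big_ord0 (L1_functionalZ FL)// mul0r; split => //; exact: integrable_realZ.
have [IHi IHE] := IH (fun i => f (widen_ord (leqnSn n) i)) (fun i => fi _).
have E : (fun x : T => \sum_(i < n.+1) f i x) =
    (fun x => (\sum_(i < n) f (widen_ord (leqnSn n) i) x) + f ord_max x).
  by apply/funext => x; rewrite big_ord_recr.
rewrite E big_ord_recr /= (L1_functionalD FL)// IHE; split => //.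
exact: integrable_realD.
Qed.

Lemma L1_functional_eq La1 La2 : L1_functional La1 -> L1_functional La2 ->
  (forall B, measurable B -> La1 \1_B = La2 \1_B) ->
  forall f, integ f -> La1 f = La2 f.
Proof.
move=> F1 F2 F12 f fi.
have iind B : measurable B -> integ (\1_B : T -> R).
  by move=> mB; apply: (integrableS measurableT) => //; exact: integrable_indic.
have [g [gi _ gf]] := approximation_sfun_integrable mD fi.
have sumE k (c : 'I_k -> R) (B : 'I_k -> set T) : (forall i, measurable (B i)) ->
    La1 (fun x => \sum_(i < k) (c i * \1_(B i) x)) =
    La2 (fun x => \sum_(i < k) (c i * \1_(B i) x)).
  move=> mB; have ii i : integ (fun x => c i * \1_(B i) x).
    by apply: integrable_realZ => //; exact: iind.
  have [_ ->] := L1_functional_sum F1 ii.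
  have [_ ->] := L1_functional_sum F2 ii.
  apply: eq_bigr => i _.
  by rewrite (L1_functionalZ F1) ?(L1_functionalZ F2) ?F12//; exact: iind.
have gE n : La1 (g n) = La2 (g n).
  have gS : (g n : T -> R) = _ := funext (fimfunEord (g n)).
  apply: etrans (congr1 La1 gS) (etrans _ (esym (congr1 La2 gS))).
  by apply: sumE => i; exact: measurable_funPTI.
apply/eqP; rewrite -subr_eq0 -normr_le0; apply/ler_addgt0Pl => e e0; rewrite addr0.
have e20 : 0 < e / 2 by rewrite divr_gt0.
have /fine_cvgP[_ /cvgrPdist_lt/(_ _ e20)[n _ /(_ n (leqnn n))]] := gf.
rewrite /= sub0r normrN => gne.
have fgi : integ (fun x => f x - g n x) by exact: integrable_realB.
have dE : \int[mu]_(x in D) `|f x - g n x| < e / 2.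
  by apply: le_lt_trans gne; exact: ler_norm.
have bnd La : L1_functional La -> `|La f - La (g n)| <= \int[mu]_(x in D) `|f x - g n x|.
  move=> FL; suff -> : La f - La (g n) = La (fun x => f x - g n x).
    exact: L1_functional_bound.
  have := L1_functionalD FL fgi (gi n).
  have -> : (fun x => (f x - g n x) + g n x) = f by apply/funext => x; rewrite subrK.
  by move=> ->; rewrite addrK.
have := bnd _ F1; have := bnd _ F2; rewrite gE => h2 h1.
have -> : La1 f - La2 f = (La1 f - La2 (g n)) - (La2 f - La2 (g n)) by ring.
apply: (le_trans (ler_normB _ _)); lra.
Qed.

End functionals_on_L1.

Section conditional_density.
Context d d' (T : measurableType d) (T' : measurableType d') {R : realType}.
Variables (P : probability T R) (Q : probability T' R) (g : T -> T').
Hypothesis mg : measurable_fun setT g.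
Hypothesis QE : forall B, measurable B -> Q B = P (g @^-1` B).

Lemma conditional_density (f : T -> R) : P.-integrable setT (EFin \o f) ->
  exists Y : T' -> R, Q.-integrable setT (EFin \o Y) /\
    forall B, measurable B -> \int[P]_(x in g @^-1` B) f x = \int[Q]_(y in B) Y y.
Proof.
move=> fi.
have mpre B : measurable B -> measurable (g @^-1` B).
  by move=> mB; rewrite -[X in measurable X]setTI; exact: mg.
pose nu : {charge set T -> \bar R} := induced_charge fi.
pose nuP B := nu (g @^-1` B).
have nu0 : nuP set0 = 0%E by rewrite /nuP preimage_set0 charge0.
have nufin B : measurable B -> nuP B \is a fin_num.
  by move=> mB; apply: fin_num_measure; exact: mpre.
have nusig : semi_sigma_additive nuP.
  move=> F mF tF mUF; rewrite /nuP preimage_bigcup.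
  apply: charge_semi_sigma_additive.
  - by move=> n; exact: mpre.
  - apply/trivIsetP => /= i j _ _ ij; rewrite -preimage_setI.
    by move/trivIsetP : tF => /(_ _ _ _ _ ij) ->//; rewrite preimage_set0.
  - by rewrite -preimage_bigcup; exact: mpre.
pose nuC : {charge set T' -> \bar R} := HB.pack nuP (isCharge.Build _ _ _ nuP nu0 nufin nusig).
have nuac : nuC `<< Q.
  apply/null_content_dominatesP => B mB QB0.
  apply: null_set_integral; first exact: mpre.
    by apply: measurable_funTS; exact: (measurable_int P fi).
  by have := QE mB; rewrite QB0.
have H x := Radon_Nikodym_fin_num x nuac.
have E : EFin \o (fine \o Radon_Nikodym nuC Q) = Radon_Nikodym nuC Q.
  by apply/funext => x /=; rewrite fineK.
exists (fine \o Radon_Nikodym nuC Q); split.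
  by rewrite E; exact: Radon_Nikodym_integrable.
move=> B mB; congr fine.
rewrite -[LHS]/(nuC B) (Radon_Nikodym_integral nuac)//.
by apply: eq_integral => x _; rewrite /= fineK.
Qed.

End conditional_density.

Section real_integral_extra.
Context d (T : measurableType d) {R : realType} (mu : {measure set T -> \bar R}).

Lemma Rintegral_subset (A D : set T) (f : T -> R) : measurable A -> measurable D ->
  A `<=` D -> mu.-integrable D (EFin \o f) -> (forall x, D x -> 0 <= f x) ->
  \int[mu]_(x in A) f x <= \int[mu]_(x in D) f x.
Proof.
move=> mA mD AD fi f0; have fiA := integrableS mD mA AD fi.
rewrite -lee_fin -!integralE_real//.
by apply: ge0_subset_integral => //; exact: measurable_int fi.
Qed.

Lemma Rintegral_indicM (A D : set T) (f : T -> R) :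
  \int[mu]_(x in D) (\1_A x * f x) = \int[mu]_(x in D `&` A) f x.
Proof.
rewrite Rintegral_mkcondr; apply: eq_Rintegral => x _.
by rewrite patchE indicE; case: ifP => _; rewrite ?mul1r ?mul0r.
Qed.

Lemma integrable_indicM (A D : set T) (f : T -> R) : measurable A -> measurable D ->
  mu.-integrable D (EFin \o f) -> mu.-integrable D (EFin \o (fun x => \1_A x * f x)).
Proof.
move=> mA mD fi; apply: (integrable_real_le mD _ _ (integrable_real_norm mD fi)).
  apply: measurable_funM; last exact: integrable_real_measurable fi.
  exact: measurable_funTS.
by move=> x Dx; rewrite indicE; case: (x \in A); rewrite ?mul1r// mul0r normr0.
Qed.

End real_integral_extra.

Lemma probability_setI_full d (T : measurableType d) (R : realType)
    (P : probability T R) (I A : set T) :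
  measurable I -> P I = 1%E -> measurable A -> P (A `&` I) = P A.
Proof.
move=> mI PI mA; have mC := measurableC mI.
have C0 : P (~` I) = 0%E by rewrite probability_setC// [X in (_ - X)%E]PI subee.
rewrite -[in RHS](setIT A) -(setUv I) setIUr measureU0//; [exact: measurableI..|].
apply: (subset_measure0 _ mC) => //; exact: measurableI.
Qed.

Section superhedging_functional.
Context {R : realType} (I : set R) (gamma : R -> R)
  (mu1 mu2 : probability (measurableTypeR R) R).
Local Notation X := (measurableTypeR R).
Hypothesis I_open : open I.
Hypothesis mu1_I : mu1 I = 1%E.
Hypothesis mu2_I : mu2 I = 1%E.
Hypothesis mu1_mean : mu1.-integrable I (EFin \o @id R).
Hypothesis mu2_mean : mu2.-integrable I (EFin \o @id R).
Hypothesis gamma_mu1 : mu1.-integrable I (EFin \o gamma).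
Hypothesis gamma_mu2 : mu2.-integrable I (EFin \o gamma).

Let mI : measurable (I : set X).
Proof. exact: open_measurable. Qed.

Local Notation K := (hedgeable I gamma mu1 mu2).
Local Notation S := (two_sided K).

Variable L : (R * R * R -> R) -> R.
Hypothesis LD : forall f g, S f -> S g -> L (f \+ g) = L f + L g.
Hypothesis LZ : forall t f, S f -> L (t \*o f) = t * L f.
Hypothesis L_le : forall f c, S f -> K (f, c) -> L f <= c.

Let kcone : cone K := hedgeable_cone gamma mu1 mu2 I_open.

Lemma two_sided_bound f p q c : mu1.-integrable I (EFin \o p) ->
  mu2.-integrable I (EFin \o q) -> 0 <= c ->
  (forall x y u, I x -> I y -> 0 <= u -> `|f (x, y, u)| <= p x + q y + c * u) -> S f.
Proof.
move=> ip iq c0 H.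
suff hb g : (forall x y u, I x -> I y -> 0 <= u -> g (x, y, u) <= p x + q y + c * u) ->
    exists d, K (g, d).
  have [k1 k1P] := hb f (fun x y u Ix Iy u0 => le_trans (ler_norm _) (H x y u Ix Iy u0)).
  have [|k2 k2P] := hb (\- f).
    by move=> x y u Ix Iy u0; rewrite (le_trans (ler_norm _))//= normrN H.
  by exists k1, k2.
move=> gH; eexists; exists (fun x => p x - c * gamma x), (fun y => q y + c * gamma y).
have f0 k : finite_set ((cst k : R -> R) @` I).
  by apply: (@sub_finite_set _ _ [set k]) => // _ [x _ <-].
exists (cst 0), (cst c); split; last reflexivity.
split => //=.
- by apply: integrable_realB => //; exact: integrable_realZ.
- by apply: integrable_realD => //; exact: integrable_realZ.
- by move=> x y u Ix Iy u0; apply: (le_trans (gH x y u Ix Iy u0)); lra.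
Qed.

Lemma functional_mono f g : S f -> S g ->
  (forall x y u, I x -> I y -> 0 <= u -> f (x, y, u) <= g (x, y, u)) -> L f <= L g.
Proof.
move=> Sf Sg fg; rewrite -subr_le0.
have SNg : S ((-1) \*o g) by exact: two_sidedZ.
have -> : L f - L g = L (f \+ ((-1) \*o g)) by rewrite LD// LZ// mulN1r.
apply: L_le; first exact: two_sidedD.
have [K0 _ _] := kcone.
apply: hedgeable_le K0 => x y u Ix Iy u0 /=.
by have := fg x y u Ix Iy u0; lra.
Qed.

Lemma functional_eq f g : S f -> S g ->
  (forall x y u, I x -> I y -> 0 <= u -> f (x, y, u) = g (x, y, u)) -> L f = L g.
Proof.
move=> Sf Sg fg; apply/eqP; rewrite eq_le; apply/andP; split;
  by apply: functional_mono => // x y u Ix Iy u0; rewrite fg.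
Qed.

Let f0 k : finite_set ((cst k : R -> R) @` I).
Proof. by apply: (@sub_finite_set _ _ [set k]) => // _ [x _ <-]. Qed.

Let i0 (mu : probability X R) : mu.-integrable I (EFin \o (cst 0 : R -> R)).
Proof. exact: integrable0. Qed.

Let i1 (mu : probability X R) c : mu.-integrable I (EFin \o (cst c : R -> R)).
Proof. exact: finite_measure_integrable_cst. Qed.

Lemma functional_static1 k : mu1.-integrable I (EFin \o k) ->
  S (fun w => k w.1.1) /\ L (fun w => k w.1.1) = \int[mu1]_(x in I) k x.
Proof.
move=> ik.
have Sk h : mu1.-integrable I (EFin \o h) -> S (fun w => h w.1.1).
  move=> ih; apply: (two_sided_bound (integrable_real_norm mI ih) (i0 mu2) (lexx 0)).
  by move=> x y u _ _ _ /=; rewrite mul0r !addr0.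
have up h : mu1.-integrable I (EFin \o h) -> L (fun w => h w.1.1) <= \int[mu1]_(x in I) h x.
  move=> ih; apply: L_le; first exact: Sk.
  exists h, (cst 0), (cst 0), (cst 0); split; last first.
    by rewrite /= Rintegral_cst// mul0r addr0.
  split => //=; by move=> x y u _ _ _; rewrite !mul0r subr0 !addr0.
split; first exact: Sk.
apply/eqP; rewrite eq_le up//= -lerN2 -RintegralN//.
have := up _ (integrable_realN ik).
have -> : (fun w : R * R * R => - k w.1.1) = (-1) \*o (fun w => k w.1.1).
  by apply/funext => w /=; rewrite mulN1r.
by rewrite LZ ?mulN1r//; exact: Sk.
Qed.

Lemma functional_static2 k : mu2.-integrable I (EFin \o k) ->
  S (fun w => k w.1.2) /\ L (fun w => k w.1.2) = \int[mu2]_(x in I) k x.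
Proof.
move=> ik.
have Sk h : mu2.-integrable I (EFin \o h) -> S (fun w => h w.1.2).
  move=> ih; apply: (two_sided_bound (i0 mu1) (integrable_real_norm mI ih) (lexx 0)).
  by move=> x y u _ _ _ /=; rewrite mul0r addr0 add0r.
have up h : mu2.-integrable I (EFin \o h) -> L (fun w => h w.1.2) <= \int[mu2]_(x in I) h x.
  move=> ih; apply: L_le; first exact: Sk.
  exists (cst 0), h, (cst 0), (cst 0); split; last first.
    by rewrite /= Rintegral_cst// mul0r add0r.
  split => //=; by move=> x y u _ _ _; rewrite !mul0r subr0 !addr0 add0r.
split; first exact: Sk.
apply/eqP; rewrite eq_le up//= -lerN2 -RintegralN//.
have := up _ (integrable_realN ik).
have -> : (fun w : R * R * R => - k w.1.2) = (-1) \*o (fun w => k w.1.2).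
  by apply/funext => w /=; rewrite mulN1r.
by rewrite LZ ?mulN1r//; exact: Sk.
Qed.

Lemma two_sided_indicM1 A h : mu2.-integrable I (EFin \o h) ->
  S (fun w => \1_A w.1.1 * h w.1.2).
Proof.
move=> ih; apply: (two_sided_bound (i0 mu1) (integrable_real_norm mI ih) (lexx 0)).
move=> x y u _ _ _ /=; rewrite mul0r addr0 add0r indicE.
by case: (x \in A); rewrite ?mul1r// mul0r normr0.
Qed.

Lemma functional_indic_norm A h : mu2.-integrable I (EFin \o h) ->
  `|L (fun w => \1_A w.1.1 * h w.1.2)| <= \int[mu2]_(x in I) `|h x|.
Proof.
move=> ih; have inh := integrable_real_norm mI ih.
have [Sn <-] := functional_static2 inh; have SA := two_sided_indicM1 A ih.
have LN : - L (fun w => `|h w.1.2|) = L ((-1) \*o (fun w => `|h w.1.2|)).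
  by rewrite LZ// mulN1r.
rewrite ler_norml LN; apply/andP; split; apply: functional_mono => //.
- exact: two_sidedZ.
- move=> x y u _ _ _ /=; rewrite indicE mulN1r lerNl.
  by case: (x \in A); rewrite ?mul1r ?mul0r ?oppr0// -normrN ler_norm.
- move=> x y u _ _ _ /=; rewrite indicE.
  by case: (x \in A); rewrite ?mul1r ?mul0r// ler_norm.
Qed.

Let m (A B : set R) := L (fun w => \1_A w.1.1 * \1_B w.1.2).

Let Sm A B : S (fun w => \1_A w.1.1 * \1_B w.1.2).
Proof.
apply: (two_sided_bound (i1 mu1 1) (i0 mu2) (lexx 0)) => x y u _ _ _ /=.
rewrite mul0r !addr0 !indicE.
by case: (x \in A); case: (y \in B); rewrite ?mul1r ?mul0r ?normr0 ?normr1 ?ler01.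
Qed.

Lemma functional_coupling : exists P : probability (X * X)%type R,
  [/\ forall A, measurable A -> P (A `*` setT) = mu1 A,
      forall B, measurable B -> P (setT `*` B) = mu2 B &
      forall A B, measurable A -> measurable B ->
        P (A `*` B) = (L (fun w => \1_A w.1.1 * \1_B w.1.2))%:E].
Proof.
have indU (A A' : set R) x : A `&` A' = set0 ->
    \1_(A `|` A') x = \1_A x + \1_A' x :> R.
  move=> AA'; rewrite !indicE in_setU.
  case: (boolP (x \in A)) => xA; case: (boolP (x \in A')) => xA'; rewrite ?addr0 ?add0r//.
  have : (A `&` A') x by split; exact: set_mem.
  by rewrite AA'.
have m1 A : measurable (A : set X) -> (m A setT)%:E = mu1 A.
  move=> mA; have iA : mu1.-integrable I (EFin \o \1_A).
    by apply: (integrableS measurableT) => //; exact: integrable_indic.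
  have [SA LA] := functional_static1 iA.
  rewrite /m (@functional_eq _ (fun w => \1_A w.1.1))//; last first.
    by move=> x y u _ _ _ /=; rewrite indicT mulr1.
  by rewrite LA -integralE_real// integral_indic//; exact: probability_setI_full.
have m2 B : measurable (B : set X) -> (m setT B)%:E = mu2 B.
  move=> mB; have iB : mu2.-integrable I (EFin \o \1_B).
    by apply: (integrableS measurableT) => //; exact: integrable_indic.
  have [SB LB] := functional_static2 iB.
  rewrite /m (@functional_eq _ (fun w => \1_B w.1.2))//; last first.
    by move=> x y u _ _ _ /=; rewrite indicT mul1r.
  by rewrite LB -integralE_real// integral_indic//; exact: probability_setI_full.
have m_ge0 A B : 0 <= m A B.
  have <- : L (0 \*o (fun w => \1_A w.1.1 * \1_B w.1.2)) = 0 by rewrite LZ// mul0r.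
  apply: functional_mono => //; first exact: two_sidedZ.
  by move=> x y u _ _ _ /=; rewrite mul0r mulr_ge0.
have mUl A A' B : A `&` A' = set0 -> m (A `|` A') B = m A B + m A' B.
  move=> AA'; rewrite /m -LD//; congr L.
  by apply/funext => w /=; rewrite indU// mulrDl.
have mUr A B B' : B `&` B' = set0 -> m A (B `|` B') = m A B + m A B'.
  move=> BB'; rewrite /m -LD//; congr L.
  by apply/funext => w /=; rewrite indU// mulrDr.
have [P PE] := exists_coupling m_ge0 (fun A A' B _ _ _ => @mUl A A' B)
  (fun A B B' _ _ _ => @mUr A B B') m1 m2.
exists P; split => [A mA|B mB|A B mA mB]; last exact: PE.
- by rewrite PE// m1.
- by rewrite PE// m2.
Qed.

End superhedging_functional.

Section functional_disintegration.
Context {R : realType} (I : set R) (gamma : R -> R)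
  (mu1 mu2 : probability (measurableTypeR R) R).
Local Notation X := (measurableTypeR R).
Hypothesis I_open : open I.
Hypothesis mu1_mean : mu1.-integrable I (EFin \o @id R).
Hypothesis mu2_mean : mu2.-integrable I (EFin \o @id R).
Hypothesis gamma_mu1 : mu1.-integrable I (EFin \o gamma).
Hypothesis gamma_mu2 : mu2.-integrable I (EFin \o gamma).

Let mI : measurable (I : set X).
Proof. exact: open_measurable. Qed.

Local Notation K := (hedgeable I gamma mu1 mu2).
Local Notation S := (two_sided K).

Variable L : (R * R * R -> R) -> R.
Hypothesis LD : forall f g, S f -> S g -> L (f \+ g) = L f + L g.
Hypothesis LZ : forall t f, S f -> L (t \*o f) = t * L f.
Hypothesis L_le : forall f c, S f -> K (f, c) -> L f <= c.

Variable P : probability (X * X)%type R.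
Hypothesis P1 : forall A, measurable A -> P (A `*` setT) = mu1 A.
Hypothesis P2 : forall B, measurable B -> P (setT `*` B) = mu2 B.
Hypothesis PL : forall A B, measurable A -> measurable B ->
  P (A `*` B) = (L (fun w => \1_A w.1.1 * \1_B w.1.2))%:E.

Let kcone : cone K := hedgeable_cone gamma mu1 mu2 I_open.

Let law1 B : measurable B -> mu1 B = P (fst @^-1` B).
Proof.
move=> mB; rewrite -P1//; congr (P _); apply/seteqP; split => z /=; [by case|by split].
Qed.

Let law2 B : measurable B -> mu2 B = P (snd @^-1` B).
Proof.
move=> mB; rewrite -P2//; congr (P _); apply/seteqP; split => z /=; [by case|by split].
Qed.

Let mcyl (A : set X) : measurable A -> measurable (A `*` [set: X]).
Proof. by move=> mA; exact: measurableX. Qed.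

Let onI (mu : probability X R) h : mu.-integrable setT (EFin \o h) ->
  mu.-integrable I (EFin \o h).
Proof. by move=> ih; exact: integrableS ih. Qed.

Lemma integrable_snd h : mu2.-integrable setT (EFin \o h) ->
  P.-integrable setT (EFin \o (fun z : X * X => h z.2)) /\
  \int[P]_z h z.2 = \int[mu2]_y h y.
Proof.
move=> ih; have := law_integrable (measurable_snd : measurable_fun setT (@snd X X)) law2 measurableT ih.
by rewrite preimage_setT.
Qed.

Lemma integrable_fst h : mu1.-integrable setT (EFin \o h) ->
  P.-integrable setT (EFin \o (fun z : X * X => h z.1)) /\
  forall A, measurable A -> \int[P]_(z in A `*` setT) h z.1 = \int[mu1]_(x in A) h x.
Proof.
move=> ih; split.
  have := law_integrable (measurable_fst : measurable_fun setT (@fst X X)) law1 measurableT ih.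
  by rewrite preimage_setT => -[].
move=> A mA; have ihA : mu1.-integrable A (EFin \o h) by exact: integrableS ih.
have [_ <-] := law_integrable (measurable_fst : measurable_fun setT (@fst X X)) law1 mA ihA.
by congr (Rintegral _ _ _); apply/seteqP; split => z /=; [case|split].
Qed.

Lemma functional_indic_integral A h : measurable A -> mu2.-integrable setT (EFin \o h) ->
  L (fun w => \1_A w.1.1 * h w.1.2) = \int[P]_(z in A `*` setT) h z.2.
Proof.
move=> mA; move: h; apply: (@L1_functional_eq _ _ _ mu2 setT measurableT
    (fun h => L (fun w => \1_A w.1.1 * h w.1.2))
    (fun h => \int[P]_(z in A `*` setT) h z.2)).
- split.
  + move=> f g /onI fi /onI gi; rewrite -LD; [|exact: two_sided_indicM1..].
    by congr L; apply/funext => w /=; rewrite mulrDr.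
  + move=> c f /onI fi; rewrite -LZ; last exact: two_sided_indicM1.
    by congr L; apply/funext => w /=; rewrite mulrCA.
  + move=> f fi; apply: (@le_trans _ _ (\int[mu2]_(x in I) `|f x|)).
      by apply: (functional_indic_norm I_open gamma_mu1 gamma_mu2 LD LZ L_le); exact: onI.
    by apply: Rintegral_subset => //; exact: integrable_real_norm.
- have iA f : mu2.-integrable setT (EFin \o f) ->
      P.-integrable (A `*` setT) (EFin \o (fun z : X * X => f z.2)).
    by move=> /integrable_snd[fi _]; apply: integrableS fi => //; exact: mcyl.
  split.
  + by move=> f g fi gi; rewrite RintegralD//; [exact: mcyl|exact: iA..].
  + by move=> c f fi; rewrite RintegralZl//; [exact: mcyl|exact: iA].
  + move=> f fi; apply: (le_trans (le_normr_Rintegral (mcyl mA) (iA _ fi))).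
    have [nfi <-] := integrable_snd (integrable_real_norm measurableT fi).
    by apply: Rintegral_subset => //; exact: mcyl.
- move=> B mB; apply: EFin_inj; rewrite -PL//.
  have iB : mu2.-integrable setT (EFin \o (\1_B : X -> R)) by exact: integrable_indic.
  have [iBP _] := integrable_snd iB.
  rewrite -integralE_real; [|exact: mcyl|apply: integrableS iBP => //; exact: mcyl].
  transitivity (\int[P]_(z in A `*` setT) (\1_(snd @^-1` B) z)%:E)%E; last by [].
  rewrite integral_indic; [|exact: mcyl|]; last first.
    by rewrite -[X in measurable X]setTI; exact: measurable_snd.
  congr (P _); apply/seteqP; split => z /=; first by case.
  by move=> [? [? _]].
Qed.

Let indic_fin A : finite_set ((\1_A : R -> R) @` I).
Proof.
apply: (@sub_finite_set _ _ [set 0; 1]) => // _ [x _ <-]; rewrite indicE.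
by case: (x \in A); [right|left].
Qed.

Let cst_fin k : finite_set ((cst k : R -> R) @` I).
Proof. by apply: (@sub_finite_set _ _ [set k]) => // _ [x _ <-]. Qed.

Let i0 (mu : probability X R) : mu.-integrable I (EFin \o (cst 0 : R -> R)).
Proof. exact: integrable0. Qed.

Let onT (mu : probability X R) h : mu.-integrable I (EFin \o h) ->
  mu.-integrable setT (EFin \o (h \_ I)).
Proof. by move=> /(integrable_mkcond _ mI); rewrite restrict_EFin. Qed.

Let zero_hedge f d a : finite_set (d @` I) -> finite_set (a @` I) ->
  (forall x, I x -> 0 <= a x) ->
  (forall x y u, I x -> I y -> 0 <= u ->
    f (x, y, u) <= d x * (y - x) - a x * (gamma y - gamma x - u)) -> K (f, 0).
Proof.
move=> fd fa a0 H; exists (cst 0), (cst 0), d, a; split; last first.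
  by rewrite /= !Rintegral_cst// !mul0r addr0.
by split => //= x y u Ix Iy u0; rewrite !add0r; exact: H.
Qed.

Let patchI (h : R -> R) x : I x -> (h \_ I) x = h x.
Proof. by move=> Ix; rewrite patchE mem_set. Qed.

Let L_first A h : measurable A -> mu1.-integrable I (EFin \o h) ->
  S (fun w => \1_A w.1.1 * (h \_ I) w.1.1) /\
  L (fun w => \1_A w.1.1 * (h \_ I) w.1.1) = \int[mu1]_(x in A) (h \_ I) x.
Proof.
move=> mA hi; have iA : mu1.-integrable I (EFin \o (fun x => \1_A x * (h \_ I) x)).
  by apply: integrable_indicM => //; exact/onI/onT.
have [SA ->] := functional_static1 I_open gamma_mu1 gamma_mu2 LZ L_le iA.
split => //; rewrite Rintegral_indicM setIC Rintegral_mkcondr.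
by apply: eq_Rintegral => x _; rewrite !patchE; case: ifP => // ->.
Qed.

Lemma functional_martingale A : measurable A ->
  \int[P]_(z in A `*` setT) (@id R \_ I) z.2 = \int[mu1]_(x in A) (@id R \_ I) x.
Proof.
move=> mA; rewrite -functional_indic_integral//; last exact: onT.
have [Sg <-] := L_first mA mu1_mean.
have Sf : S (fun w => \1_A w.1.1 * (@id R \_ I) w.1.2).
  by apply: two_sided_indicM1 => //; exact/onI/onT.
apply/eqP; rewrite eq_le -subr_le0 -[X in _ && X]subr_le0; apply/andP; split.
- rewrite -mulN1r -LZ// -LD//; last exact: two_sidedZ.
  apply: L_le; first by apply: two_sidedD => //; exact: two_sidedZ.
  apply: (@zero_hedge _ \1_A (cst 0)) => //= x y u Ix Iy u0.
  by rewrite !patchI//=; lra.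
- rewrite -mulN1r -LZ// -LD//; last exact: two_sidedZ.
  apply: L_le; first by apply: two_sidedD => //; exact: two_sidedZ.
  apply: (@zero_hedge _ (fun x => -1 * \1_A x) (cst 0)) => //=.
    by rewrite -(image_comp \1_A ( *%R (-1))); exact: finite_image.
  by move=> x y u Ix Iy u0; rewrite !patchI//=; lra.
Qed.

Lemma two_sided_third A : S (fun w => \1_A w.1.1 * w.2).
Proof.
apply: (two_sided_bound I_open gamma_mu1 gamma_mu2 (i0 mu1) (i0 mu2) ler01).
move=> x y u _ _ u0 /=; rewrite indicE !add0r mul1r.
by case: (x \in A); rewrite ?mul1r ?mul0r ?normr0// ger0_norm.
Qed.

Lemma functional_variance A : measurable A ->
  0 <= L (fun w => \1_A w.1.1 * w.2) /\
  L (fun w => \1_A w.1.1 * w.2) <=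
  \int[P]_(z in A `*` setT) (gamma \_ I) z.2 - \int[mu1]_(x in A) (gamma \_ I) x.
Proof.
move=> mA; have Su := two_sided_third A; split.
  have <- : L (0 \*o (fun w => \1_A w.1.1 * w.2)) = 0 by rewrite LZ// mul0r.
  apply: (functional_mono I_open LD LZ L_le) => //; first exact: two_sidedZ.
  by move=> x y u _ _ u0 /=; rewrite mul0r mulr_ge0.
rewrite -functional_indic_integral//; last exact: onT.
have [Sg <-] := L_first mA gamma_mu1.
have Sf : S (fun w => \1_A w.1.1 * (gamma \_ I) w.1.2).
  by apply: two_sided_indicM1 => //; exact/onI/onT.
rewrite lerBrDr -LD// -subr_le0 -mulN1r -LZ// -LD//; last 2 first.
- exact: two_sidedD.
- exact: two_sidedZ.
apply: L_le; first by apply: two_sidedD; [exact|exact: two_sidedD|exact: two_sidedZ].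
apply: (@zero_hedge _ (cst 0) \1_A) => //= x y u Ix Iy u0.
by rewrite !patchI//=; lra.
Qed.

Lemma functional_variance_density : exists Y : R -> R,
  [/\ mu1.-integrable setT (EFin \o Y), forall x, 0 <= Y x,
   forall A, measurable A -> \int[P]_(z in A `*` setT) (gamma \_ I) z.2 =
     \int[mu1]_(x in A) ((gamma \_ I) x + Y x) &
   forall A, measurable A -> L (fun w => \1_A w.1.1 * w.2) <= \int[mu1]_(x in A) Y x].
Proof.
have g1 := onT gamma_mu1; have g2 := onT gamma_mu2.
have [i2 _] := integrable_snd g2; have [i1 E1] := integrable_fst g1.
have [Y0 [Y0i Y0E]] := conditional_density
  (measurable_fst : measurable_fun setT (@fst X X)) law1 (integrable_realB measurableT i2 i1).
have Y0E' A : measurable A -> \int[mu1]_(x in A) Y0 x =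
    \int[P]_(z in A `*` setT) (gamma \_ I) z.2 - \int[mu1]_(x in A) (gamma \_ I) x.
  move=> mA; rewrite -Y0E//.
  have -> : fst @^-1` A = A `*` [set: X] by apply/seteqP; split => z /=; [split|case].
  rewrite RintegralB ?E1//; first exact: mcyl.
  - by apply: integrableS i2 => //; exact: mcyl.
  - by apply: integrableS i1 => //; exact: mcyl.
have z1 : mu1.-integrable setT (EFin \o (cst 0 : X -> R)) by exact: integrable0.
have [|mN N0] := lt_null_of_integral_le z1 Y0i.
  move=> A mA; rewrite Rintegral_cst// mul0r Y0E'//.
  by have [h] := functional_variance mA; exact: le_trans.
have Yi := integrable_real_max measurableT Y0i z1.
have YE A : measurable A -> \int[mu1]_(x in A) Num.max (Y0 x) 0 = \int[mu1]_(x in A) Y0 x.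
  move=> mA; congr fine; apply: ae_eq_integral => //.
  - by apply: measurable_funTS; exact: measurable_int Yi.
  - by apply: measurable_funTS; exact: measurable_int Y0i.
  - exists [set x | Y0 x < cst 0 x]; split => // x /= /not_implyP[Ax].
    apply: contra_notP => /negP; rewrite -leNgt => Y0x.
    by congr EFin; apply/max_idPl.
exists (fun x => Num.max (Y0 x) 0); split.
- exact: Yi.
- by move=> x; rewrite le_max lexx orbT.
- move=> A mA; rewrite RintegralD//; last 2 first.
  + by apply: integrableS g1.
  + by apply: integrableS Yi.
  by rewrite YE// Y0E'//; ring.
- by move=> A mA; rewrite YE// Y0E'//; have [] := functional_variance mA.
Qed.

End functional_disintegration.

Section dominated_limit.
Context d (T : measurableType d) {R : realType} (mu : {measure set T -> \bar R}).
Context (D : set T) (mD : measurable D).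

Lemma dominated_Rintegral_le (f : nat -> T -> R) (g h : T -> R) (c : R) :
  (forall n, mu.-integrable D (EFin \o f n)) -> mu.-integrable D (EFin \o g) ->
  mu.-integrable D (EFin \o h) -> (forall n x, D x -> `|f n x| <= h x) ->
  (forall x, D x -> f n x @[n --> \oo] --> g x) ->
  (forall n, c <= \int[mu]_(x in D) f n x) -> c <= \int[mu]_(x in D) g x.
Proof.
move=> fi gi hi fh fg cf.
have [| | | | |_ _ H] := @dominated_convergence _ T R mu D mD
  (fun n => EFin \o f n) (EFin \o g) (EFin \o h).
- by move=> n; exact: measurable_int (fi n).
- exact: measurable_int gi.
- apply: aeW => x Dx; apply: cvg_EFin; last exact: fg.
  exact: nearW.
- exact: hi.
- by apply: aeW => x n Dx; rewrite lee_fin; exact: fh.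
rewrite -lee_fin -integralE_real//; apply: (cvge_to_ge H).
by apply: nearW => n /=; rewrite integralE_real// lee_fin.
Qed.

End dominated_limit.

Section link_bound.
Context {R : realType} (I : set R) (gamma phi : R -> R)
  (mu1 mu2 : probability (measurableTypeR R) R).
Local Notation X := (measurableTypeR R).
Hypothesis I_open : open I.
Hypothesis phi_ge0 : forall u : R, 0 <= u -> 0 <= phi u.
Hypothesis phi_concave : concave_function (nonneg R) phi.
Hypothesis phi_cont : {within nonneg R, continuous phi}.
Hypothesis phi0 : phi 0 = 0.
Hypothesis mu1_I : mu1 I = 1%E.
Hypothesis gamma_mu1 : mu1.-integrable I (EFin \o gamma).
Hypothesis gamma_mu2 : mu2.-integrable I (EFin \o gamma).

Let mI : measurable (I : set X).
Proof. exact: open_measurable. Qed.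

Local Notation K := (hedgeable I gamma mu1 mu2).
Local Notation S := (two_sided K).

Variable L : (R * R * R -> R) -> R.
Hypothesis LD : forall f g, S f -> S g -> L (f \+ g) = L f + L g.
Hypothesis LZ : forall t f, S f -> L (t \*o f) = t * L f.
Hypothesis L_le : forall f c, S f -> K (f, c) -> L f <= c.

Let kcone : cone K := hedgeable_cone gamma mu1 mu2 I_open.

Let i1 (mu : probability X R) c : mu.-integrable I (EFin \o (cst c : R -> R)).
Proof. exact: finite_measure_integrable_cst. Qed.

Lemma two_sided_link A : S (fun w => \1_A w.1.1 * phi w.2).
Proof.
have [k k0 kP] := concave_growth phi_ge0 phi_concave phi0.
apply: (two_sided_bound I_open gamma_mu1 gamma_mu2 (i1 mu1 k) (i1 mu2 0) k0).
move=> x y u _ _ u0 /=; rewrite indicE addr0.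
have := kP u u0; rewrite mulrDr mulr1; have := phi_ge0 u0.
case: (x \in A); rewrite ?mul1r ?mul0r ?normr0; first by move=> h; rewrite ger0_norm.
by move=> _ _; rewrite addr_ge0// mulr_ge0.
Qed.

Variable Y : R -> R.
Hypothesis Yi : mu1.-integrable setT (EFin \o Y).
Hypothesis Y_ge0 : forall x, 0 <= Y x.
Hypothesis YL : forall A, measurable (A : set X) ->
  L (fun w => \1_A w.1.1 * w.2) <= \int[mu1]_(x in A) Y x.

Lemma link_integrable : mu1.-integrable setT (EFin \o (phi \o Y)).
Proof.
have [k k0 kP] := concave_growth phi_ge0 phi_concave phi0.
apply: (@integrable_real_le _ _ _ mu1 setT measurableT _ (fun x => k * (1 + Y x))).
- apply: (@measurable_comp _ _ _ _ _ _ (nonneg R)) => //; first exact: measurable_itv.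
  + by move=> _ [x _ <-]; exact/nonnegE.
  + exact: link_measurable.
  + exact: integrable_real_measurable Yi.
- by move=> x _ /=; rewrite ger0_norm ?kP ?phi_ge0.
- apply: integrable_realZ => //; apply: integrable_realD => //.
  exact: finite_measure_integrable_cst.
Qed.

Lemma functional_link : L (fun w => phi w.2) <= \int[mu1]_x phi (Y x).
Proof.
have [al [s [s0 tan dense]]] := concave_countable_tangents phi_ge0 phi_concave phi_cont phi0.
pose l k y := - (al k + s k * y).
pose g n x := max_upto l n (Y x).
have li k : mu1.-integrable setT (EFin \o (fun x => l k (Y x))).
  apply: integrable_realN; apply: integrable_realD => //.
    exact: finite_measure_integrable_cst.
  exact: integrable_realZ.
have gi n : mu1.-integrable setT (EFin \o g n).
  elim: n => [|n IH]; first exact: li.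
  exact: (integrable_real_max measurableT IH (li n.+1)).
have iS (A : set X) f : measurable A -> mu1.-integrable setT (EFin \o f) ->
    mu1.-integrable A (EFin \o f).
  by move=> mA fi; exact: integrableS fi.
have one k (A : set X) : measurable A ->
    L (fun w => \1_A w.1.1 * phi w.2) <= - (\int[mu1]_(x in A) l k (Y x)).
  move=> mA.
  have iA : mu1.-integrable I (EFin \o (\1_A : X -> R)).
    by apply: (integrableS measurableT) => //; exact: integrable_indic.
  have [SA LA] := functional_static1 I_open gamma_mu1 gamma_mu2 LZ L_le iA.
  have Su := two_sided_third I_open gamma_mu1 gamma_mu2 A.
  apply: (@le_trans _ _ (L ((al k \*o (fun w => \1_A w.1.1)) \+
      (s k \*o (fun w => \1_A w.1.1 * w.2))))).
    apply: (functional_mono I_open LD LZ L_le).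
    - exact: two_sided_link.
    - by apply: two_sidedD => //; exact: two_sidedZ.
    - move=> x y u _ _ u0 /=; rewrite indicE.
      case: (x \in A); rewrite ?mul1r ?mulr1 ?mul0r ?mulr0 ?addr0//.
      exact: tan.
  rewrite LD; [|exact: two_sidedZ..]; rewrite !LZ// LA.
  rewrite -RintegralN//; last exact: iS.
  have -> : \int[mu1]_(x in A) (- l k (Y x)) =
      \int[mu1]_(x in A) al k + s k * \int[mu1]_(x in A) Y x.
    rewrite -RintegralZl//; last exact: iS.
    rewrite -RintegralD//; last 2 first.
    - exact: finite_measure_integrable_cst.
    - by apply: integrable_realZ => //; exact: iS.
    by apply: eq_Rintegral => x _; rewrite /l opprK.
  apply: lerD; last by rewrite ler_wpM2l// YL.
  rewrite Rintegral_cst//.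
  have -> : \int[mu1]_(x in I) \1_A x = fine (mu1 A); last by [].
  rewrite /Rintegral integral_indic//; congr fine; exact: probability_setI_full.
have all n : forall A : set X, measurable A ->
    L (fun w => \1_A w.1.1 * phi w.2) <= - (\int[mu1]_(x in A) g n x).
  elim: n => [|n IH] A mA; first exact: one.
  pose B := [set x | g n x < l n.+1 (Y x)].
  have mB : measurable (B : set X).
    rewrite (_ : B = (fun x => g n x < l n.+1 (Y x)) @^-1` [set true]); last first.
      by apply/seteqP; split => x /=; [move=> ->|].
    rewrite -[X in measurable X]setTI; apply: (@measurable_fun_ltr _ X R) => //.
    - exact: integrable_real_measurable (gi n).
    - exact: integrable_real_measurable (li n.+1).
  have mAB : measurable (A `&` B) by exact: measurableI.
  have mAD : measurable (A `\` B) by exact: measurableD.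
  have -> : (fun w : R * R * R => \1_A w.1.1 * phi w.2) =
      (fun w => \1_(A `&` B) w.1.1 * phi w.2) \+ (fun w => \1_(A `\` B) w.1.1 * phi w.2).
    apply/funext => w /=; rewrite -mulrDl; congr (_ * _).
    rewrite !indicE in_setI in_setD.
    by case: (_ \in A); case: (_ \in B); rewrite /= ?addr0 ?add0r.
  rewrite LD; [|exact: two_sided_link..].
  have -> : \int[mu1]_(x in A) g n.+1 x =
      \int[mu1]_(x in A `&` B) l n.+1 (Y x) + \int[mu1]_(x in A `\` B) g n x.
    rewrite -{1}(setUIDK A B) Rintegral_setU//; last 2 first.
    - by rewrite setUIDK; exact: iS.
    - by rewrite disj_set2E setDE setIACA setICr setI0.
    congr (_ + _); apply: eq_Rintegral => x /set_mem[Ax Bx]; rewrite /g /=.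
      by apply/max_idPr; exact: ltW.
    by apply/max_idPl; rewrite leNgt; exact/negP.
  by rewrite opprD lerD ?one ?IH.
rewrite -[X in L X](_ : (fun w => \1_setT w.1.1 * phi w.2) = _); last first.
  by apply/funext => w; rewrite indicT mul1r.
have phii := link_integrable.
have glt n x : phi (Y x) <= - g n x.
  rewrite /g; have [j _ ->] := max_uptoP l n (Y x).
  by rewrite /l opprK; exact: tan.
apply: (@dominated_Rintegral_le _ _ _ mu1 setT measurableT (fun n x => - g n x) _
  (fun x => `|l 0%N (Y x)| + phi (Y x))).
- by move=> n; exact: integrable_realN.
- exact: phii.
- by apply: integrable_realD => //; exact: integrable_real_norm.
- move=> n x _; have h := glt n x; have h0 := phi_ge0 (Y_ge0 x).
  have h1 : l 0%N (Y x) <= g n x by exact: le_max_upto.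
  rewrite ger0_norm; last exact: le_trans h.
  have := ler_norm (- l 0%N (Y x)); rewrite normrN; lra.
- move=> x _; apply/cvgrPdist_le => e e0.
  have [k kP] := dense (Y x) e (Y_ge0 x) e0.
  exists k => // n /= kn; have h := glt n x.
  have h1 : l k (Y x) <= g n x by exact: le_max_upto.
  rewrite distrC ger0_norm ?subr_ge0//; move: h1; rewrite /l; lra.
- by move=> n; rewrite RintegralN//; exact: all.
Qed.

End link_bound.

Lemma Rintegral_setI_full d (T : measurableType d) (R : realType)
    (P : probability T R) (E F : set T) (h : T -> R) :
  measurable E -> measurable F -> P F = 1%E -> P.-integrable E (EFin \o h) ->
  \int[P]_(x in E `&` F) h x = \int[P]_(x in E) h x.
Proof.
move=> mE mF PF hi; have mC := measurableC mF.
have C0 : P (~` F) = 0%E by rewrite probability_setC// [X in (_ - X)%E]PF subee.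
by congr fine; rewrite [RHS](negligible_integral mC)// setDE setCK.
Qed.

Section primal_construction.
Context {R : realType} (I : set R) (gamma phi : R -> R)
  (mu1 mu2 : probability (measurableTypeR R) R).
Local Notation X := (measurableTypeR R).
Hypothesis I_open : open I.
Hypothesis phi_ge0 : forall u : R, 0 <= u -> 0 <= phi u.
Hypothesis mu1_I : mu1 I = 1%E.
Hypothesis mu2_I : mu2 I = 1%E.
Hypothesis mu1_mean : mu1.-integrable I (EFin \o @id R).
Hypothesis mu2_mean : mu2.-integrable I (EFin \o @id R).
Hypothesis gamma_mu1 : mu1.-integrable I (EFin \o gamma).
Hypothesis gamma_mu2 : mu2.-integrable I (EFin \o gamma).

Let mI : measurable (I : set X).
Proof. exact: open_measurable. Qed.

Variable P : probability (X * X)%type R.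
Hypothesis P1 : forall A, measurable A -> P (A `*` setT) = mu1 A.
Hypothesis P2 : forall B, measurable B -> P (setT `*` B) = mu2 B.
Hypothesis P_martingale : forall A, measurable (A : set X) ->
  \int[P]_(z in A `*` setT) (@id R \_ I) z.2 = \int[mu1]_(x in A) (@id R \_ I) x.
Variable Y : R -> R.
Hypothesis Yi : mu1.-integrable setT (EFin \o Y).
Hypothesis Y_ge0 : forall x, 0 <= Y x.
Hypothesis P_variance : forall A, measurable (A : set X) ->
  \int[P]_(z in A `*` setT) (gamma \_ I) z.2 =
  \int[mu1]_(x in A) ((gamma \_ I) x + Y x).
Hypothesis phiYi : mu1.-integrable setT (EFin \o (phi \o Y)).

Let mY : measurable_fun setT (Y : X -> X).
Proof. exact: integrable_real_measurable Yi. Qed.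

Let mphiY : measurable_fun setT (phi \o Y : X -> X).
Proof. exact: integrable_real_measurable phiYi. Qed.

Let onT (mu : probability X R) h : mu.-integrable I (EFin \o h) ->
  mu.-integrable setT (EFin \o (h \_ I)).
Proof. by move=> /(integrable_mkcond _ mI); rewrite restrict_EFin. Qed.

Let patchI (h : R -> R) x : I x -> (h \_ I) x = h x.
Proof. by move=> Ix; rewrite patchE mem_set. Qed.

Let mcyl (A : set X) : measurable A -> measurable (A `*` [set: X]).
Proof. by move=> mA; exact: measurableX. Qed.

Let D := sample_space I.
Let Z (w : sample_type R) := (S1 w, V w).

Let mS1 : measurable_fun setT (@S1 R).
Proof. exact: (measurableT_comp measurable_fst measurable_fst). Qed.
Let mS2 : measurable_fun setT (@S2 R).
Proof. exact: (measurableT_comp measurable_snd measurable_fst). Qed.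
Let mV : measurable_fun setT (@V R).
Proof. exact: measurable_snd. Qed.

Let mD : measurable D.
Proof. by apply: measurableX; [exact: measurableX|exact: measurable_itv]. Qed.

Let f (z : X * X) : sample_type R := (z.1, z.2, phi (Y z.1)).

Let mf : measurable_fun setT f.
Proof.
apply: measurable_fun_pair.
  by apply: measurable_fun_pair; [exact: measurable_fst|exact: measurable_snd].
exact: (measurableT_comp mphiY measurable_fst).
Qed.

Lemma primal_construction : exists mu : probability (sample_type R) R,
  primal_feasible I gamma phi mu1 mu2 mu /\
  ('E_mu[V] = (\int[mu1]_x phi (Y x))%:E)%E.
Proof.
have [mu muE] := exists_law P mf; exists mu.
have law1 A : measurable A -> mu1 A = mu (@S1 R @^-1` A).
  move=> mA; rewrite -P1// [RHS]muE; congr (P _).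
  by apply/seteqP; split => z /=; [case|split].
have law2 A : measurable A -> mu2 A = mu (@S2 R @^-1` A).
  move=> mA; rewrite -P2// [RHS]muE; congr (P _).
  by apply/seteqP; split => z /=; [case|split].
have PI : P (setT `*` I) = 1%E by rewrite P2.
have muD : mu D = 1%E.
  rewrite [LHS]muE.
  have -> : f @^-1` D = (I `*` setT) `&` (setT `*` I).
    apply/seteqP; split => z /=; first by move=> [[? ?] _].
    move=> [[? _] [_ ?]]; split => //; apply/nonnegE; exact: phi_ge0.
  rewrite probability_setI_full//; [by rewrite P1|exact: measurableX|exact: mcyl].
have int1 h : mu1.-integrable I (EFin \o h) -> mu.-integrable D (EFin \o (h \o @S1 R)).
  move=> hi; have [hi' _] := law_integrable mS1 law1 mI hi.
  apply: integrableS hi' => //; last by move=> w [[]].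
  by rewrite -[X in measurable X]setTI; exact: mS1.
have int2 h : mu2.-integrable I (EFin \o h) -> mu.-integrable D (EFin \o (h \o @S2 R)).
  move=> hi; have [hi' _] := law_integrable mS2 law2 mI hi.
  apply: integrableS hi' => //; last by move=> w [[]].
  by rewrite -[X in measurable X]setTI; exact: mS2.
pose event (C : set (X * X)) : set X := [set x | C (x, phi (Y x))] `&` I.
have mevent C : measurable C -> measurable (event C).
  move=> mC; apply: measurableI => //.
  have mp : measurable_fun setT (fun x : X => (x, phi (Y x)) : X * X).
    by apply: measurable_fun_pair => //.
  by rewrite -[X in measurable X]setTI; exact: mp.
have fevent C : f @^-1` (D `&` Z @^-1` C) = (event C `*` setT) `&` (setT `*` I).
  apply/seteqP; split => z /=; first by move=> [[[? ?] _] ?].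
  by move=> [[[? ?] _] [_ ?]]; split => //; split => //; apply/nonnegE; exact: phi_ge0.
have mDC C : measurable C -> measurable (D `&` Z @^-1` C).
  move=> mC; apply: measurableI => //.
  have mZ : measurable_fun setT Z by apply: measurable_fun_pair.
  by rewrite -[X in measurable X]setTI; exact: mZ.
have toP C (h : sample_type R -> R) (k : X * X -> R) : measurable C ->
    mu.-integrable D (EFin \o h) -> P.-integrable setT (EFin \o k) ->
    (forall z, I z.1 -> I z.2 -> h (f z) = k z) ->
    (\int[mu]_(w in D `&` Z @^-1` C) (h w)%:E =
     (\int[P]_(z in event C `*` setT) k z)%:E)%E.
  move=> mC hi ki hk.
  have hiC : mu.-integrable (D `&` Z @^-1` C) (EFin \o h).
    by apply: integrableS hi => //; exact: mDC.
  rewrite integralE_real//; last exact: mDC; congr EFin.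
  have [_ <-] := law_integrable mf (fun A _ => muE A) (mDC _ mC) hiC.
  have mE := mcyl (mevent _ mC); have mTI : measurable ([set: X] `*` I) by exact: measurableX.
  have kiE : P.-integrable (event C `*` setT) (EFin \o k) by exact: integrableS ki.
  rewrite fevent -(Rintegral_setI_full mE mTI PI kiE).
  by apply: eq_Rintegral => z /set_mem[[[_ ?] _] [_ ?]]; exact: hk.
have i1P h : mu1.-integrable setT (EFin \o h) ->
    P.-integrable setT (EFin \o (fun z : X * X => h z.1)) /\
    forall A, measurable A -> \int[P]_(z in A `*` setT) h z.1 = \int[mu1]_(x in A) h x.
  by move=> hi; exact: integrable_fst.
have i2P h : mu2.-integrable setT (EFin \o h) ->
    P.-integrable setT (EFin \o (fun z : X * X => h z.2)).
  by move=> hi; have [] := integrable_snd P2 hi.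
have YI : mu1.-integrable I (EFin \o (fun x => gamma x + Y x)).
  by apply: integrable_realD => //; exact: integrableS Yi.
have VE : mu [set w | V w != phi (Y (S1 w))] = 0%E.
  rewrite [LHS]muE (_ : _ @^-1` _ = set0) ?measure0//.
  by apply/seteqP; split => z //=; rewrite eqxx.
have mVE : measurable [set w : sample_type R | V w != phi (Y (S1 w))].
  have mW : measurable_fun setT (fun w : sample_type R => V w - phi (Y (S1 w)) : X).
    by apply: measurable_funB => //; exact: (measurableT_comp mphiY mS1).
  rewrite (_ : [set _ | _] = (fun w : sample_type R => V w - phi (Y (S1 w))) @^-1` ~` [set 0]).
    rewrite -[X in measurable X]setTI; apply: mW => //.
    apply: measurableC; exact: (measurable_set1 (0 : R)).
  apply/seteqP; split => w /=; first by move=> h; apply/eqP; rewrite subr_eq0.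
  by move/eqP; rewrite subr_eq0.
split; first split.
- exact: muD.
- by move=> A mA; rewrite law1.
- by move=> A mA; rewrite law2.
- exists (@S1 R), (fun w => gamma (S1 w) + Y (S1 w)); split.
  + split.
    * exact: (int2 _ mu2_mean).
    * exact: (int1 _ mu1_mean).
    * move=> B mB; exists (B `*` setT); first exact: mcyl.
      by congr (_ `&` _); apply/seteqP; split => w /=; [case|split].
    * move=> _ [C mC <-].
      have [k1i k1E] := i1P _ (onT mu1_mean); have k2i := i2P _ (onT mu2_mean).
      rewrite (toP C _ (fun z => (@id R \_ I) z.1))//; last 2 first.
        exact: (int1 _ mu1_mean).
        by move=> z ? ?; rewrite patchI.
      rewrite (toP C _ (fun z => (@id R \_ I) z.2))//; last 2 first.
        exact: (int2 _ mu2_mean).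
        by move=> z ? ?; rewrite patchI.
      by rewrite k1E ?P_martingale//; exact: mevent.
  + split.
    * exact: (int2 _ gamma_mu2).
    * exact: (int1 _ YI).
    * move=> B mB; exists ((I `&` (fun x => gamma x + Y x) @^-1` B) `*` setT).
        by apply: mcyl; exact: (integrable_real_measurable YI).
      apply/seteqP; split => w /=; first by move=> [? [[? ?] _]].
      by move=> [[[? ?] ?] ?]; split.
    * move=> _ [C mC <-].
      have gYi : mu1.-integrable setT (EFin \o (fun x => (gamma \_ I) x + Y x)).
        by apply: integrable_realD => //; exact: onT.
      have [k1i k1E] := i1P _ gYi; have k2i := i2P _ (onT gamma_mu2).
      rewrite (toP C _ (fun z => (gamma \_ I) z.1 + Y z.1))//; last 2 first.
        exact: (int1 _ YI).
        by move=> z ? ?; rewrite patchI.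
      rewrite (toP C _ (fun z => (gamma \_ I) z.2))//; last 2 first.
        exact: (int2 _ gamma_mu2).
        by move=> z ? ?; rewrite patchI.
      by rewrite k1E ?P_variance//; exact: mevent.
  + exists [set w | V w != phi (Y (S1 w))]; split => // w /= /not_implyP[_].
    by apply: contra_notP => /negP/negPn/eqP ->; split => //; rewrite addrAC subrr add0r.
- rewrite unlock.
  have := law_integrable mS1 law1 measurableT phiYi; rewrite preimage_setT => -[vi vE].
  rewrite -vE -integralE_real//.
  apply: ae_eq_integral => //.
  + exact/measurable_EFinP.
  + by apply/measurable_EFinP; exact: (measurableT_comp mphiY mS1).
  + exists [set w | V w != phi (Y (S1 w))]; split => // w /= /not_implyP[_].
    by apply: contra_notP => /negP/negPn/eqP ->.
Qed.

End primal_construction.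

Section primal_existence.
Context {R : realType} (I : set R) (gamma phi : R -> R)
  (mu1 mu2 : probability (measurableTypeR R) R).
Local Notation X := (measurableTypeR R).
Hypothesis I_neq0 : I !=set0.
Hypothesis I_open : open I.
Hypothesis gamma_convex : convex_function I gamma.
Hypothesis phi_ge0 : forall u : R, 0 <= u -> 0 <= phi u.
Hypothesis phi_concave : concave_function (nonneg R) phi.
Hypothesis phi_cont : {within nonneg R, continuous phi}.
Hypothesis phi0 : phi 0 = 0.
Hypothesis mu1_I : mu1 I = 1%E.
Hypothesis mu2_I : mu2 I = 1%E.
Hypothesis mu1_mean : mu1.-integrable I (EFin \o @id R).
Hypothesis mu2_mean : mu2.-integrable I (EFin \o @id R).
Hypothesis mu12_order : convex_order I mu1 mu2.
Hypothesis gamma_mu1 : mu1.-integrable I (EFin \o gamma).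
Hypothesis gamma_mu2 : mu2.-integrable I (EFin \o gamma).

Lemma exists_primal p :
  (forall c, hedgeable I gamma mu1 mu2 (fun w => phi w.2, c) -> p <= c) ->
  exists2 mu, primal_feasible I gamma phi mu1 mu2 mu & (p%:E <= 'E_mu[V])%E.
Proof.
move=> pP.
have cK := hedgeable_cone gamma mu1 mu2 I_open.
have aK := hedgeable_arbitrage_free I_neq0 I_open gamma_convex mu1_mean mu2_mean
  mu12_order gamma_mu1 gamma_mu2.
have [L [LD LZ L_le Lp]] := conic_hahn_banach cK aK pP.
have [P [P1 P2 PL]] := functional_coupling I_open mu1_I mu2_I gamma_mu1 gamma_mu2 LD LZ L_le.
have [Y [Yi Y0 PY YL]] := functional_variance_density I_open gamma_mu1 gamma_mu2
  LD LZ L_le P1 P2 PL.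
have Pm := functional_martingale I_open mu1_mean mu2_mean gamma_mu1 gamma_mu2
  LD LZ L_le P2 PL.
have phii := link_integrable phi_ge0 phi_concave phi_cont phi0 Yi Y0.
have [mu [muF muE]] := primal_construction I_open phi_ge0 mu1_I mu2_I
  mu1_mean mu2_mean gamma_mu1 gamma_mu2 P1 P2 Pm Yi Y0 PY phii.
exists mu => //; rewrite muE lee_fin.
have Sphi : two_sided (hedgeable I gamma mu1 mu2) (fun w => phi w.2).
  have := two_sided_link I_open phi_ge0 phi_concave phi0 gamma_mu1 gamma_mu2 setT.
  by congr (two_sided _ _); apply/funext => w; rewrite indicT mul1r.
apply: le_trans (Lp Sphi) _.
exact: (functional_link I_open phi_ge0 phi_concave phi_cont phi0 mu1_I gamma_mu1 gamma_mu2
  LD LZ L_le Yi Y0 YL).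
Qed.

Lemma hedgeable_link_inf : exists p, [/\ forall c,
    hedgeable I gamma mu1 mu2 (fun w => phi w.2, c) -> p <= c &
  forall e, 0 < e -> exists2 c, hedgeable I gamma mu1 mu2 (fun w => phi w.2, c) & c < p + e].
Proof.
pose A := [set c | hedgeable I gamma mu1 mu2 (fun w => phi w.2, c)].
have infA : has_inf A.
  split.
    have := two_sided_link I_open phi_ge0 phi_concave phi0 gamma_mu1 gamma_mu2 setT.
    move=> [c [_ [Hc _]]]; exists c; move: Hc; rewrite /A/=; congr (hedgeable _ _ _ _ (_, _)).
    by apply/funext => w; rewrite indicT mul1r.
  exists 0 => c Hc.
  apply: (hedgeable_arbitrage_free I_neq0 I_open gamma_convex mu1_mean mu2_mean
    mu12_order gamma_mu1 gamma_mu2).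
  by apply: hedgeable_le Hc => x y u _ _ u0 /=; exact: phi_ge0.
exists (inf A); split; first by move=> c Hc; apply: ge_inf => //; exact: infA.2.
by move=> e e0; have [c Hc ce] := inf_adherent e0 infA; exists c.
Qed.

End primal_existence.

(** * Weak duality *)

Lemma staircase_approximation (R : realType) (e t : R) n : 0 < e -> 0 <= t <= n%:R * e ->
  0 <= t - \sum_(k < n) e * (k.+1%:R * e <= t)%R%:R <= e.
Proof.
move=> e0; elim: n => [|n IH] /andP[t0].
  rewrite mul0r big_ord0 subr0 => t0'; apply/andP; split; lra.
move=> tn; rewrite big_ord_recr/=; have [tn'|nt] := leP t (n%:R * e).
  have -> : (n.+1%:R * e <= t) = false.
    by apply/negbTE; rewrite -ltNge (le_lt_trans tn')// ltr_pM2r// ltr_nat.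
  by rewrite mulr0 addr0; apply: IH; rewrite t0.
rewrite (eq_bigr (fun=> e)); last first.
  move=> k _; have -> : (k.+1%:R * e <= t) = true; last by rewrite mulr1.
  by apply: le_trans (ltW nt); rewrite ler_pM2r// ler_nat.
rewrite sumr_const card_ord -mulr_natl.
have ne : n.+1%:R * e = n%:R * e + e by rewrite -natr1; ring.
rewrite ne in tn; case: (leP (n.+1%:R * e) t) => h; rewrite ?mulr1 ?mulr0; move: h; rewrite ne; lra.
Qed.

Section null_integrals.
Context d (T : measurableType d) {R : realType} (mu : {measure set T -> \bar R}).

Lemma ae_le_Rintegral (A N : set T) (f g : T -> R) : measurable A -> measurable N ->
  mu N = 0%E -> mu.-integrable A (EFin \o f) -> mu.-integrable A (EFin \o g) ->
  (forall x, A x -> ~ N x -> f x <= g x) ->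
  \int[mu]_(x in A) f x <= \int[mu]_(x in A) g x.
Proof.
move=> mA mN N0 fi gi fg; have mAN : measurable (A `\` N) by exact: measurableD.
have E h : mu.-integrable A (EFin \o h) ->
    \int[mu]_(x in A) h x = \int[mu]_(x in A `\` N) h x.
  by move=> hi; congr fine; exact: negligible_integral.
rewrite !E//; apply: le_Rintegral => //.
- by apply: integrableS fi => // x [].
- by apply: integrableS gi => // x [].
- by move=> x [Ax Nx]; exact: fg.
Qed.

Lemma ae_integrable (A N : set T) (f g : T -> R) : measurable A -> measurable N ->
  mu N = 0%E -> measurable_fun A f -> mu.-integrable A (EFin \o g) ->
  (forall x, A x -> ~ N x -> f x = g x) -> mu.-integrable A (EFin \o f).
Proof.
move=> mA mN N0 mf gi fg; have mAN : measurable (A `\` N) by exact: measurableD.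
rewrite (negligible_integrable mN)//; last exact/measurable_EFinP.
apply: (integrable_real_eq mAN) (integrableS mA mAN _ gi); last by move=> x [].
by move=> x [Ax Nx]; rewrite fg.
Qed.

End null_integrals.

Section bounded_multipliers.
Context d d' (T : measurableType d) (T' : measurableType d') {R : realType}
  (mu : probability T R) (D : set T) (Z : T -> T') (f : T -> R).
Hypothesis mD : measurable D.
Hypothesis mZ : measurable_fun setT Z.
Hypothesis fi : mu.-integrable D (EFin \o f).
Hypothesis f0 : forall C, measurable C -> \int[mu]_(w in D `&` Z @^-1` C) f w = 0.

Let mDC C : measurable C -> measurable (D `&` Z @^-1` C).
Proof.
by move=> mC; apply: measurableI => //; rewrite -[X in measurable X]setTI; exact: mZ.
Qed.

Let fiC C : measurable C -> mu.-integrable (D `&` Z @^-1` C) (EFin \o f).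
Proof. by move=> mC; apply: integrableS fi => //; exact: mDC. Qed.

Lemma bounded_multiplier (C : set T') (H : T' -> R) (b : R) : measurable C ->
  measurable_fun C H -> (forall z, C z -> `|H z| <= b) ->
  mu.-integrable (D `&` Z @^-1` C) (EFin \o (fun w => H (Z w) * f w)) /\
  \int[mu]_(w in D `&` Z @^-1` C) (H (Z w) * f w) = 0.
Proof.
move=> mC mH Hb; set E := D `&` Z @^-1` C.
have mE : measurable E by exact: mDC.
have fE : mu.-integrable E (EFin \o f) by exact: fiC.
have mHZ : measurable_fun E (H \o Z).
  apply: (measurable_comp mC) => //; first by move=> _ [w [_ Cw] <-].
  exact: measurable_funS mZ.
have Hfi : mu.-integrable E (EFin \o (fun w => H (Z w) * f w)).
  apply: (integrable_real_le mE _ _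
    (integrable_realZ mE b (integrable_real_norm mE fE))).
    by apply: measurable_funM => //; exact: integrable_real_measurable fE.
  by move=> w [_ Cw]; rewrite normrM ler_wpM2r// Hb.
split=> //; apply/eqP; rewrite -normr_le0; apply/ler_addgt0Pl => e e0; rewrite addr0.
pose c := \int[mu]_(w in E) `|f w|.
have c0 : 0 <= c by exact: Rintegral_ge0.
pose h := e / (c + 1).
have h0 : 0 < h by rewrite divr_gt0//; lra.
pose b' := `|b|; pose n := Num.bound (2 * b' / h).
have nb : 2 * b' <= n%:R * h.
  rewrite -ler_pdivrMr//; apply/ltW/archi_boundP.
  by rewrite divr_ge0 ?(ltW h0)// /b' mulr_ge0.
pose Ck k := C `&` [set z | k.+1%:R * h - b' <= H z].
have mCk k : measurable (Ck k).
  rewrite (_ : Ck k = C `&` H @^-1` `[k.+1%:R * h - b', +oo[%classic).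
    by apply: mH => //; exact: measurable_itv.
  by apply/seteqP; split => z /=; rewrite in_itv/= andbT.
pose st m w : R := \sum_(k < m) h * \1_(Ck k) (Z w).
have ind k : mu.-integrable E (EFin \o (fun w => (h * \1_(Ck k) (Z w)) * f w)) /\
    \int[mu]_(w in E) ((h * \1_(Ck k) (Z w)) * f w) = 0.
  have mZk : measurable (Z @^-1` Ck k).
    by rewrite -[X in measurable X]setTI; exact: mZ.
  have Ei : mu.-integrable E (EFin \o (fun w => \1_(Z @^-1` Ck k) w * f w)).
    exact: integrable_indicM.
  have EE : (fun w => (h * \1_(Ck k) (Z w)) * f w) =
      (fun w => h * (\1_(Z @^-1` Ck k) w * f w)).
    apply/funext => w; rewrite mulrA !indicE.
    have -> // : (Z w \in Ck k) = (w \in Z @^-1` Ck k).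
    by apply/idP/idP => /set_mem h'; exact: mem_set.
  rewrite EE RintegralZl// Rintegral_indicM; split; first exact: integrable_realZ.
  have -> : E `&` Z @^-1` Ck k = D `&` Z @^-1` Ck k.
    by apply/seteqP; split => w /=; [move=> [[? ?] ?]|move=> [? [? ?]]].
  by rewrite f0// mulr0.
have sti m : mu.-integrable E (EFin \o (fun w => st m w * f w)) /\
    \int[mu]_(w in E) (st m w * f w) = 0.
  elim: m => [|m [IH1 IH2]].
    have -> : (fun w => st 0%N w * f w) = cst 0.
      by apply/funext => w; rewrite /st big_ord0 mul0r.
    by rewrite Rintegral_cst// mul0r; split => //; exact: integrable0.
  have [k1 k2] := ind m.
  have -> : (fun w => st m.+1 w * f w) =
      (fun w => st m w * f w + (h * \1_(Ck m) (Z w)) * f w).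
    by apply/funext => w; rewrite /st big_ord_recr/= mulrDl.
  by rewrite RintegralD// IH2 k2 addr0; split => //; exact: integrable_realD.
have [sn1 sn2] := sti n.
have bi : mu.-integrable E (EFin \o (fun w => b' * f w)) by exact: integrable_realZ.
have b0 : \int[mu]_(w in E) (b' * f w) = 0 by rewrite RintegralZl// f0// mulr0.
have -> : \int[mu]_(w in E) (H (Z w) * f w) =
    \int[mu]_(w in E) ((H (Z w) + b' - st n w) * f w).
  transitivity (\int[mu]_(w in E) (H (Z w) * f w + b' * f w - st n w * f w)); last first.
    by apply: eq_Rintegral => w _; ring.
  rewrite RintegralB//; last exact: integrable_realD.
  by rewrite RintegralD// b0 sn2 addr0 subr0.
have di : mu.-integrable E (EFin \o (fun w => (H (Z w) + b' - st n w) * f w)).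
  apply: (integrable_real_eq mE) (integrable_realB mE (integrable_realD mE Hfi bi) sn1).
  by move=> w _; ring.
apply: (le_trans (le_normr_Rintegral mE di)).
apply: (@le_trans _ _ (\int[mu]_(w in E) (h * `|f w|))).
  apply: le_Rintegral => //; first exact: integrable_real_norm.
    by apply: integrable_realZ => //; exact: integrable_real_norm.
  move=> w [Dw Cw]; rewrite normrM ler_wpM2r//.
  have Hw := Hb _ Cw; have bb : b <= b' by exact: ler_norm.
  have := @staircase_approximation _ h (H (Z w) + b') n h0.
  have := ler_norm (H (Z w)); have := ler_norm (- H (Z w)); rewrite normrN => l1 l2.
  have -> : 0 <= H (Z w) + b' <= n%:R * h by apply/andP; split; lra.
  have -> : \sum_(k < n) h * (k.+1%:R * h <= H (Z w) + b')%R%:R = st n w.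
    apply: eq_bigr => k _; rewrite indicE.
    have -> // : (k.+1%:R * h <= H (Z w) + b') = (Z w \in Ck k).
    apply/idP/idP => [kh|/set_mem[_ /=]]; last by rewrite lerBlDr.
    by apply/mem_set; split => //=; rewrite lerBlDr.
  by move=> /(_ isT)/andP[g0 g1]; rewrite ger0_norm.
rewrite RintegralZl//; last exact: integrable_real_norm.
rewrite -/c /h mulrAC ler_pdivrMr; [nra|lra].
Qed.

End bounded_multipliers.

Section weak_duality.
Context {R : realType} (I : set R) (gamma phi : R -> R)
  (mu1 mu2 : probability (measurableTypeR R) R).
Local Notation X := (measurableTypeR R).
Hypothesis I_open : open I.
Hypothesis I_interval : is_interval I.
Hypothesis gamma_convex : convex_function I gamma.
Hypothesis phi_ge0 : forall u : R, 0 <= u -> 0 <= phi u.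
Hypothesis phi_concave : concave_function (nonneg R) phi.
Hypothesis phi_inj : set_inj (nonneg R) phi.
Hypothesis phi_cont : {within nonneg R, continuous phi}.
Hypothesis phi0 : phi 0 = 0.
Hypothesis mu1_mean : mu1.-integrable I (EFin \o @id R).
Hypothesis gamma_mu1 : mu1.-integrable I (EFin \o gamma).

Let mI : measurable (I : set X).
Proof. exact: open_measurable. Qed.

Let D := sample_space I.
Let Z (w : sample_type R) : X * X := (S1 w, V w).

Let mS1 : measurable_fun setT (@S1 R).
Proof. exact: (measurableT_comp measurable_fst measurable_fst). Qed.
Let mS2 : measurable_fun setT (@S2 R).
Proof. exact: (measurableT_comp measurable_snd measurable_fst). Qed.
Let mV : measurable_fun setT (@V R).
Proof. exact: measurable_snd. Qed.
Let mZ : measurable_fun setT Z.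
Proof. by apply: measurable_fun_pair. Qed.

Let mD : measurable D.
Proof. by apply: measurableX; [exact: measurableX|exact: measurable_itv]. Qed.

Let mDC C : measurable C -> measurable (D `&` Z @^-1` C).
Proof.
by move=> mC; apply: measurableI => //; rewrite -[X in measurable X]setTI; exact: mZ.
Qed.

Variable mu : probability (sample_type R) R.
Hypothesis muF : primal_feasible I gamma phi mu1 mu2 mu.

Let law1 A : measurable A -> mu1 A = mu (@S1 R @^-1` A).
Proof. by move=> mA; rewrite -(primal_law1 muF). Qed.

Let law2 A : measurable A -> mu2 A = mu (@S2 R @^-1` A).
Proof. by move=> mA; rewrite -(primal_law2 muF). Qed.

Let mpre1 : measurable (@S1 R @^-1` I).
Proof. by rewrite -[X in measurable X]setTI; exact: mS1. Qed.
Let mpre2 : measurable (@S2 R @^-1` I).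
Proof. by rewrite -[X in measurable X]setTI; exact: mS2. Qed.

Lemma primal_integral1 h : mu1.-integrable I (EFin \o h) ->
  mu.-integrable D (EFin \o (h \o @S1 R)) /\
  \int[mu]_(w in D) h (S1 w) = \int[mu1]_(x in I) h x.
Proof.
move=> hi; have [hi' <-] := law_integrable mS1 law1 mI hi.
rewrite -(Rintegral_setI_full mpre1 mD (primal_support muF) hi').
have -> : @S1 R @^-1` I `&` D = D by apply/setIidPr => w [[]].
by split => //; apply: integrableS hi' => // w [[]].
Qed.

Lemma primal_integral2 h : mu2.-integrable I (EFin \o h) ->
  mu.-integrable D (EFin \o (h \o @S2 R)) /\
  \int[mu]_(w in D) h (S2 w) = \int[mu2]_(x in I) h x.
Proof.
move=> hi; have [hi' <-] := law_integrable mS2 law2 mI hi.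
rewrite -(Rintegral_setI_full mpre2 mD (primal_support muF) hi').
have -> : @S2 R @^-1` I `&` D = D by apply/setIidPr => w [[]].
by split => //; apply: integrableS hi' => // w [[]].
Qed.

Lemma condexp_residual (f Y : sample_type R -> R) : is_condexp mu D Z f Y ->
  mu.-integrable D (EFin \o (fun w => f w - Y w)) /\
  forall C, measurable C -> \int[mu]_(w in D `&` Z @^-1` C) (f w - Y w) = 0.
Proof.
move=> [fi Yi _ fY]; split; first exact: integrable_realB.
move=> C mC; have mE := mDC mC.
have sub : D `&` Z @^-1` C `<=` D by move=> w [].
have fiC := integrableS mD mE sub fi; have YiC := integrableS mD mE sub Yi.
rewrite RintegralB//; apply/eqP; rewrite subr_eq0; apply/eqP; congr fine.
by rewrite fY//; exists C.
Qed.

Section conditional_jensen.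
Variables (M G : sample_type R -> R) (N : set (sample_type R)).
Hypothesis cM : is_condexp mu D Z (@S2 R) M.
Hypothesis cG : is_condexp mu D Z (gamma \o @S2 R) G.
Hypothesis mN : measurable N.
Hypothesis N0 : mu N = 0%E.
Hypothesis M1 : forall w, D w -> ~ N w -> M w = S1 w.

Lemma conditional_jensen : exists N' : set (sample_type R),
  [/\ measurable N', mu N' = 0%E &
      forall w, D w -> ~ N' w -> gamma (S1 w) <= G w].
Proof.
have [g mg gP] := convex_subgradient I_open I_interval gamma_convex.
have mgam := convex_function_measurable I_open gamma_convex.
have [_ Gi Gm _] := cG.
have [X1i X1z] := condexp_residual cM; have [X2i X2z] := condexp_residual cG.
have [gS1i _] := primal_integral1 gamma_mu1.
have [gS2i _ _ _] := cG.
have /choice[Cq CqP] : forall q : rat, exists C, measurable C /\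
    D `&` Z @^-1` C = D `&` G @^-1` `]-oo, ratr q[%classic.
  by move=> q; have [C mC CE] := Gm _ (measurable_itv `]-oo, ratr q[); exists C.
pose Eq (q : rat) : set X := I `&` gamma @^-1` `]ratr q, +oo[%classic.
have mEq q : measurable (Eq q) by apply: mgam => //; exact: measurable_itv.
pose C := \bigcup_q (Cq q `&` (Eq q `*` setT)).
have mC : measurable C.
  apply: bigcupT_measurable_rat => q; apply: measurableI; first by case: (CqP q).
  exact: measurableX.
have CP w : D w -> C (Z w) <-> G w < gamma (S1 w).
  move=> Dw; have CG q : Cq q (Z w) <-> G w < ratr q.
    have [_ E] := CqP q; split => [h|h].
      have : (D `&` Z @^-1` Cq q) w by [].
      by rewrite E => -[_] /=; rewrite in_itv.
    have : (D `&` G @^-1` `]-oo, ratr q[%classic) w by split => //=; rewrite in_itv.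
    by rewrite -E => -[].
  split.
    move=> [q _ [/CG Gq [[_ /= qg] _]]]; apply: (lt_trans Gq).
    by move: qg; rewrite in_itv/= andbT.
  move=> /rat_in_itvoo[q]; rewrite in_itv/= => /andP[Gq qg].
  exists q => //; split; first exact/CG.
  by split => //; split; [case: Dw => -[]|rewrite /= in_itv/= andbT].
pose Bn (n : nat) : set X := I `&` g @^-1` `[- n%:R, n%:R]%classic.
have mBn n : measurable (Bn n) by apply: mg => //; exact: measurable_itv.
pose Cn n := C `&` (Bn n `*` setT).
have mCn n : measurable (Cn n) by apply: measurableI => //; exact: measurableX.
pose A n := D `&` Z @^-1` Cn n.
have mA n : measurable (A n) by exact: mDC.
have sub n : A n `<=` D by move=> w [].
have iA n f : mu.-integrable D (EFin \o f) -> mu.-integrable (A n) (EFin \o f).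
  by move=> fi; exact: integrableS fi.
have A0 n : mu (A n) = 0%E.
  apply: (@negative_integrand_null _ _ _ mu (A n) (fun w => G w - gamma (S1 w))) => //.
  - by apply: integrable_realB => //; exact: iA.
  - by move=> w [Dw [Cw _]]; rewrite subr_lt0; exact/CP.
  have mgfst : measurable_fun (Cn n) (g \o fst : X * X -> X).
    apply: (@measurable_comp _ _ _ _ _ _ I) => //.
      by move=> _ [z [_ [[? _] _]] <-].
    by apply: measurable_funTS; exact: measurable_fst.
  have gb z : Cn n z -> `|(g \o fst) z| <= n%:R.
    by move=> [_ [[_ /=]]]; rewrite in_itv/= => h _; rewrite ler_norml.
  have [ji jz] := bounded_multiplier mD mZ X1i X1z (mCn n) mgfst gb.
  have -> : \int[mu]_(w in A n) (G w - gamma (S1 w)) =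
      \int[mu]_(w in A n) (gamma (S2 w) - gamma (S1 w)).
    rewrite (RintegralB (mA n) (iA n _ Gi) (iA n _ gS1i)).
    rewrite (RintegralB (mA n) (iA n _ gS2i) (iA n _ gS1i)).
    have := X2z _ (mCn n); rewrite (RintegralB (mA n) (iA n _ gS2i) (iA n _ Gi)).
    by rewrite /=; lra.
  rewrite -jz; apply: (ae_le_Rintegral (mA n) mN N0) => //.
  - by apply: integrable_realB => //; exact: iA.
  - move=> w [Dw _] Nw; rewrite M1//=; case: Dw => -[I1 I2] _.
    by have := gP _ _ I1 I2; rewrite /S1 /S2; lra.
exists (\bigcup_n A n); split.
- by apply: bigcupT_measurable.
- have mU : measurable (\bigcup_n A n) by exact: bigcupT_measurable.
  apply: (@negligibleP _ _ _ mu _ mU).1; apply: negligible_bigcup => n.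
  exact: ((@negligibleP _ _ _ mu _ (mA n)).2 (A0 n)).
- move=> w Dw nA; rewrite leNgt; apply/negP => /(CP w Dw) Cw; apply: nA.
  pose n := Num.bound `|g (S1 w)|; exists n => //; split => //; split => //.
  split => //; split; first by case: Dw => -[].
  rewrite /= in_itv/= -ler_norml; apply/ltW/archi_boundP; exact: normr_ge0.
Qed.

End conditional_jensen.

Hypothesis phi_pinfty : phi u @[u --> +oo] --> +oo.

Theorem weak_duality q : dual_feasible I gamma phi mu1 mu2 q ->
  ('E_mu[V] <= dual_cost I mu1 mu2 q)%E.
Proof.
move=> [u1i u2i mDe [b0 [_ bP]] mGa ineq].
have [M [G [cM cG [N [mN N0 NP]]]]] := primal_condexp muF.
have NE w : D w -> ~ N w -> M w = S1 w /\ phi (G w - gamma (S1 w)) = V w.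
  by move=> Dw Nw; have := contra_notP (@NP w) Nw; exact.
have [J [mJ J0 JP]] := conditional_jensen cM cG mN N0 (fun w Dw Nw => (NE w Dw Nw).1).
pose N' := N `|` J.
have mN' : measurable N' by exact: measurableU.
have N'0 : mu N' = 0%E by exact: null_set_setU.
have [X1i X1z] := condexp_residual cM; have [X2i X2z] := condexp_residual cG.
have [gS1i _] := primal_integral1 gamma_mu1.
have [_ Gi _ _] := cG.
pose Y w := Num.max (G w - gamma (S1 w)) 0.
have Yi : mu.-integrable D (EFin \o Y).
  apply: (integrable_real_max mD) (integrable_realB mD Gi gS1i) _.
  exact: integrable0.
have Y0 w : 0 <= Y w by rewrite /Y le_max lexx orbT.
have VY w : D w -> ~ N' w -> [/\ V w = phi (Y w), phi_inv phi (V w) = Y w &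
    Y w = G w - gamma (S1 w)].
  move=> Dw /not_orP[Nw Jw]; have [_ Vw] := NE _ Dw Nw; have GJ := JP _ Dw Jw.
  have YE : Y w = G w - gamma (S1 w) by apply/max_idPl; rewrite subr_ge0.
  by rewrite -Vw -YE phi_invK.
have phiYi : mu.-integrable D (EFin \o (phi \o Y)).
  have [k k0 kP] := concave_growth phi_ge0 phi_concave phi0.
  apply: (@integrable_real_le _ _ _ mu D mD _ (fun w => k * (1 + Y w))).
  - apply: (@measurable_comp _ _ _ _ _ _ (nonneg R)) => //; first exact: measurable_itv.
    + by move=> _ [w _ <-]; exact/nonnegE.
    + exact: link_measurable.
    + exact: integrable_real_measurable Yi.
  - by move=> w _ /=; rewrite ger0_norm ?kP ?phi_ge0.
  - apply: integrable_realZ => //; apply: integrable_realD => //.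
    exact: finite_measure_integrable_cst.
have Vi : mu.-integrable D (EFin \o @V R).
  apply: (ae_integrable mD mN' N'0 _ phiYi); first exact: measurable_funTS.
  by move=> w Dw Nw; have [] := VY w Dw Nw.
have [U1i U1E] := primal_integral1 u1i; have [U2i U2E] := primal_integral2 u2i.
pose W w := u1 q (S1 w) + u2 q (S2 w).
have Wi : mu.-integrable D (EFin \o W) by exact: integrable_realD.
have WVi : mu.-integrable D (EFin \o (fun w => W w - V w)) by exact: integrable_realB.
have mIn : measurable (I `*` nonneg R : set (X * X)).
  by apply: measurableX => //; exact: measurable_itv.
pose C (n : nat) : set (X * X) := (I `*` nonneg R) `&` Gamma q @^-1` `[- n%:R, n%:R]%classic.
have mC n : measurable (C n) by apply: mGa => //; exact: measurable_itv.
have subC n : C n `<=` I `*` nonneg R by move=> z [].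
have step n : 0 <= \int[mu]_(w in D `&` Z @^-1` C n) (W w - V w).
  have mE := mDC (mC n).
  have sub : D `&` Z @^-1` C n `<=` D by move=> w [].
  have Db z : C n z -> `|Delta q z| <= b0 + 1.
    by move=> /subC Cz; apply: (bP (b0 + 1)) => //; rewrite ltrDl.
  have Gb z : C n z -> `|Gamma q z| <= n%:R.
    by move=> [_ /=]; rewrite in_itv/= => h; rewrite ler_norml.
  have [di dz] := bounded_multiplier mD mZ X1i X1z (mC n) (measurable_funS mIn (@subC n) mDe) Db.
  have [gi gz] := bounded_multiplier mD mZ X2i X2z (mC n) (measurable_funS mIn (@subC n) mGa) Gb.
  rewrite -oppr_le0 -RintegralN//; last exact: integrableS WVi.
  have <- : \int[mu]_(w in D `&` Z @^-1` C n) (Delta q (Z w) * (S2 w - M w) +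
     Gamma q (Z w) * ((gamma \o @S2 R) w - G w)) = 0.
    by rewrite RintegralD// dz gz addr0.
  apply: (ae_le_Rintegral mE mN' N'0).
  - by apply: integrable_realN; exact: integrableS WVi.
  - exact: integrable_realD.
  move=> w [Dw _] Nw; have [_ iv YE] := VY w Dw Nw.
  have [M1 _] : M w = S1 w /\ phi (G w - gamma (S1 w)) = V w.
    by apply: NE => // Nw'; apply: Nw; left.
  have [[I1 I2] V0] := Dw; have := ineq _ _ _ I1 I2 ((nonnegE _).1 V0).
  rewrite -[w.2]/(V w) -[w.1.1]/(S1 w) -[w.1.2]/(S2 w) iv YE M1 /W /Z /=; lra.
have WV0 : 0 <= \int[mu]_(w in D) (W w - V w).
  apply: (@dominated_Rintegral_le _ _ _ mu D mD
    (fun n w => \1_(Z @^-1` C n) w * (W w - V w)) _ (fun w => `|W w - V w|)) => //.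
  - move=> n; apply: integrable_indicM => //.
    by rewrite -[X in measurable X]setTI; exact: mZ.
  - exact: integrable_real_norm.
  - by move=> n w _; rewrite indicE; case: (_ \in _); rewrite ?mul1r ?mul0r ?normr0.
  - move=> w Dw; apply/cvgrPdist_le => e e0.
    exists (Num.bound `|Gamma q (Z w)|) => // n /= bn.
    rewrite indicE mem_set ?mul1r ?subrr ?normr0 ?(ltW e0)//.
    have [[I1 I2] V0] := Dw; split => //=; rewrite in_itv/= -ler_norml.
    by apply: (le_trans (ltW (archi_boundP (normr_ge0 _)))); rewrite ler_nat.
  - by move=> n; rewrite Rintegral_indicM.
have mDc : measurable (~` D) by exact: measurableC.
have Dc0 : mu (~` D) = 0%E.
  by rewrite probability_setC// [X in (_ - X)%E](primal_support muF) subee.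
have TD : [set: sample_type R] `\` ~` D = D by rewrite setTD setCK.
have ViT : mu.-integrable setT (EFin \o @V R).
  by rewrite (negligible_integrable mDc)// ?TD//; exact/measurable_EFinP.
have -> : ('E_mu[V] = (\int[mu]_(w in D) V w)%:E)%E.
  by rewrite unlock (negligible_integral mDc)// TD integralE_real.
rewrite /dual_cost !integralE_real// -EFinD lee_fin -U1E -U2E -RintegralD//.
by rewrite -subr_ge0 -RintegralB.
Qed.

End weak_duality.

Lemma convex_integrable (R : realType) (I : set R) (gamma : R -> R)
    (mu : probability (measurableTypeR R) R) :
  I !=set0 -> open I -> convex_function I gamma ->
  mu.-integrable I (EFin \o @id R) ->
  (\int[mu]_(x in I) (gamma^\+ x)%:E < +oo)%E ->
  mu.-integrable I (EFin \o gamma).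
Proof.
move=> [x0 Ix0] oI cg idi gp.
have mI : measurable (I : set (measurableTypeR R)) by exact: open_measurable.
have mg := convex_function_measurable oI cg.
have [a [b [Ia Ib ax xb]]] := open_nbr oI Ix0.
have [s sP] := convex_function_support cg Ia Ix0 Ib ax xb.
have gpi : mu.-integrable I (EFin \o gamma^\+).
  apply/integrableP; split; first exact/measurable_EFinP/measurable_funrpos.
  move: gp; congr (_ < _)%E; apply: eq_integral => x _ /=.
  by rewrite ger0_norm// funrposE le_max lexx orbT.
apply: (@integrable_real_le _ _ _ mu I mI _
  (fun x => gamma^\+ x + `|gamma x0 + s * (x - x0)|)) => //.
  move=> x Ix; have := sP x Ix; rewrite /funrpos.
  have := ler_norm (- (gamma x0 + s * (x - x0))); rewrite normrN.
  have := normr_ge0 (gamma x0 + s * (x - x0)).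
  by have [g0|g0] := lerP 0 (gamma x) => *; rewrite ?(ger0_norm g0) ?(ltr0_norm g0); lra.
apply: integrable_realD => //; apply: integrable_real_norm => //.
apply: integrable_realD => //; first exact: finite_measure_integrable_cst.
apply: integrable_realZ => //; apply: integrable_realB => //.
exact: finite_measure_integrable_cst.
Qed.

Theorem theorem3p18 (R : realType) (I : set R) (gamma phi : R -> R)
    (mu1 mu2 : probability (measurableTypeR R) R)
    (I_neq0 : I !=set0) (I_open : open I) (I_interval : is_interval I)
    (gamma_convex : convex_function I gamma)
    (phi_ge0 : forall u : R, 0 <= u -> 0 <= phi u)
    (phi_concave : concave_function (nonneg R) phi)
    (phi_inj : set_inj (nonneg R) phi)
    (phi_cont : {within nonneg R, continuous phi})
    (phi0 : phi 0 = 0)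
    (phi_pinfty : phi u @[u --> +oo] --> +oo)
    (mu1_I : mu1 I = 1%E) (mu2_I : mu2 I = 1%E)
    (mu1_mean : mu1.-integrable I (EFin \o @id R))
    (mu2_mean : mu2.-integrable I (EFin \o @id R))
    (mu12_order : convex_order I mu1 mu2)
    (gamma_mu1 : (\int[mu1]_(x in I) (gamma^\+ x)%:E < +oo)%E)
    (gamma_mu2 : (\int[mu2]_(x in I) (gamma^\+ x)%:E < +oo)%E)
    (gamma_inf : `|gamma x| + `|x| @[x --> right_of (inf_end I)] --> +oo)
    (gamma_sup : `|gamma x| + `|x| @[x --> left_of (sup_end I)] --> +oo) :
  let M' := [set mu | primal_feasible I gamma phi mu1 mu2 mu] in
  let U' := [set q | dual_feasible I gamma phi mu1 mu2 q] in
  let U'reg := [set q | U' q /\ dual_regular I q] in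
  let supM := ereal_sup [set 'E_mu[V] | mu in M']%E in
  [/\ supM = ereal_inf [set dual_cost I mu1 mu2 q | q in U'],
      (exists2 mu, M' mu & 'E_mu[V]%E = supM) &
      supM = ereal_inf [set dual_cost I mu1 mu2 q | q in U'reg]].
Proof.
move=> M' U' U'reg supM.
have g1 := convex_integrable I_neq0 I_open gamma_convex mu1_mean gamma_mu1.
have g2 := convex_integrable I_neq0 I_open gamma_convex mu2_mean gamma_mu2.
have [p [pP pe]] := hedgeable_link_inf I_neq0 I_open gamma_convex phi_ge0 phi_concave
  phi0 mu1_mean mu2_mean mu12_order g1 g2.
have [mu muM pmu] := exists_primal I_neq0 I_open gamma_convex phi_ge0 phi_concave phi_cont
  phi0 mu1_I mu2_I mu1_mean mu2_mean mu12_order g1 g2 pP.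
have muS : ('E_mu[V] <= supM)%E by apply: ereal_sup_ubound; exists mu.
have supU : (supM <= ereal_inf [set dual_cost I mu1 mu2 q | q in U'])%E.
  apply: le_ereal_inf_tmp => _ [q Uq <-]; apply: ge_ereal_sup => _ [nu nuM <-].
  exact: weak_duality nuM _ Uq.
have Ureg : (ereal_inf [set dual_cost I mu1 mu2 q | q in U'] <=
    ereal_inf [set dual_cost I mu1 mu2 q | q in U'reg])%E.
  by apply: ereal_inf_le_tmp => _ [q [Uq _] <-]; exists q.
have regp : (ereal_inf [set dual_cost I mu1 mu2 q | q in U'reg] <= p%:E)%E.
  apply/lee_addgt0Pr => e e0; have e20 : 0 < e / 2 by rewrite divr_gt0.
  have [c Hc cp] := pe _ e20.
  have [q [Uq rq qc]] := hedgeable_regular I_neq0 I_open gamma_convex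
    (phi_invKV phi_ge0 phi_cont phi0 phi_pinfty phi_inj) mu1_I mu1_mean mu2_mean g1 g2 e20 Hc.
  apply: le_trans (ereal_inf_lbound _) _; first by exists q.
  by apply: (le_trans qc); rewrite -EFinD lee_fin; lra.
have supp : supM = p%:E.
  apply/eqP; rewrite eq_le (le_trans supU (le_trans Ureg regp))/=.
  exact: le_trans pmu muS.
split.
- by apply/eqP; rewrite eq_le supU/= supp (le_trans Ureg).
- exists mu => //; apply/eqP; rewrite eq_le muS/= supp; exact: pmu.
- by apply/eqP; rewrite eq_le (le_trans supU Ureg)/= supp.
Qed.
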